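(* Let $n \ge 2$ and let $V \in L^\infty(\mathbb{R}^n)$ satisfy $\|V\|_{L^\infty(\mathbb{R}^n)} \le 1$. Let $C_0>0$ and assume that $u$ is a solution to $$-\Delta u + V u = 0 \quad \text{in } \mathbb{R}^n$$ such that $|u(x)| \le \exp\left(C_0 |x|^{4/3}\right)$ for all $x\in\mathbb{R}^n$, and $\|u\|_{L^2(B_1)} \ge 1$, where $B_1$ is the unit ball centered at the origin. Then there exists a constant $C = C(n, C_0) > 0$ such that for every sufficiently large $R$ (i.e. $R \ge R_0$ for some $R_0\ge 1$) and every $x_0 \in \mathbb{R}^n$ with $|x_0| = R$, $$\|u\|_{L^2(B_1(x_0))} \ge \exp\left(-C R^{4/3}\log R\right).$$
   Context: $B_r(x)$ denotes the open ball of radius $r$ centered at $x$; $B_r$ denotes the ball centered at the origin. *)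

(* Defs.v *)
From HB Require Import structures.
From mathcomp Require Import all_boot all_order all_algebra.
From mathcomp Require Import all_classical all_reals all_analysis.
Set Implicit Arguments. Unset Strict Implicit. Unset Printing Implicit Defensive.
Import Order.TTheory GRing.Theory Num.Theory.
Import numFieldNormedType.Exports.
Local Open Scope classical_set_scope.
Local Open Scope ring_scope.

(* Euclidean norm on R^n (the library norm on 'rV is the sup norm). *)
Definition enorm (R : realType) (n : nat) (x : 'rV[R]_n) : R :=
  Num.sqrt (\sum_(i < n) x ord0 i ^+ 2).

Definition eball (R : realType) (n : nat) (x0 : 'rV[R]_n) (r : R) : set 'rV[R]_n :=
  [set x | enorm (x - x0) < r].

(* Lebesgue measurability on R^n: measurability w.r.t. the product
   (= Borel) sigma-algebra, transported from n.-tuple R. *)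
Definition Rn_measurable_fun (R : realType) (n : nat) (f : 'rV[R]_n -> R) : Prop :=
  measurable_fun [set: n.-tuple R] (fun t : n.-tuple R => f (\row_i tnth t i)).

(* Lebesgue integral over R^n, computed as the iterated integral over the
   coordinates (Fubini/Tonelli: equal to the n-dimensional Lebesgue integral
   for nonnegative measurable or for integrable functions). *)
Fixpoint intRn (R : realType) (n : nat) : ('rV[R]_n -> \bar R) -> \bar R :=
  match n return ('rV[R]_n -> \bar R) -> \bar R with
  | 0 => fun f => f 0
  | m.+1 => fun f =>
      (\int[@lebesgue_measure R]_(x in [set: R])
         intRn (fun v : 'rV[R]_m => f (row_mx (\row_(j < 1) x) v)))%E
  end.

Definition L2sq_ball (R : realType) (n : nat) (u : 'rV[R]_n -> R)
  (x0 : 'rV[R]_n) (r : R) : \bar R :=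
  intRn (fun x => ((\1_(eball x0 r) x : R) * u x ^+ 2)%:E).

Definition ess_bounded_by_1 (R : realType) (n : nat) (V : 'rV[R]_n -> R) : Prop :=
  intRn (fun x => (\1_([set y | 1 < `|V y|]) x : R)%:E) = 0%E.

Fixpoint iterD (R : realType) (n : nat) (vs : seq 'rV[R]_n) (f : 'rV[R]_n -> R)
  : 'rV[R]_n -> R :=
  match vs with
  | [::] => f
  | v :: vs' => 'D_v (iterD vs' f)
  end.

Definition test_fun (R : realType) (n : nat) (phi : 'rV[R]_n -> R) : Prop :=
  (forall (vs : seq 'rV[R]_n) x, differentiable (iterD vs phi) x) /\
  (exists M : R, forall x, M < enorm x -> phi x = 0).

Definition evec (R : realType) (n : nat) (i : 'I_n) : 'rV[R]_n := delta_mx ord0 i.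

Definition lap (R : realType) (n : nat) (phi : 'rV[R]_n -> R) (x : 'rV[R]_n) : R :=
  \sum_(i < n) 'D_(@evec R n i) ('D_(@evec R n i) phi) x.

(* u (locally integrable, here measurable) solves -Delta u + V u = 0 in the
   sense of distributions on R^n. *)
Definition dist_solution (R : realType) (n : nat) (V u : 'rV[R]_n -> R) : Prop :=
  Rn_measurable_fun u /\
  forall phi, test_fun phi ->
    intRn (fun x => (- u x * lap phi x + V x * u x * phi x)%:E) = 0%E.

(* Main.v *)
(* A Carleman estimate with the radial weight e^phi centred at x0, where
   phi = -tau ln |y| + tau |y|^2 / (64 R^2) with y = x - x0 and tau = K R^(4/3). On
   1/4 <= |y| <= 4 R the conjugated Laplacian dominates v itself as soon as tau^3 is a
   large multiple of R^4, which is what produces the exponent 4/3. It is applied to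
   chi u, where chi equals 1 for 1/2 <= |y| <= 2 R and cuts u off near x0 and near
   infinity; the first order errors are absorbed by Caccioppoli's inequality. The error
   at |y| >= 2 R is bounded through the growth of u by exp(c R^(4/3)), and since phi
   decreases by at least tau / 8 between |y| = R + 1 and |y| = 2 R it is beaten by the
   contribution of the unit ball at the origin, where u has mass 1. Hence the error at
   |y| <= 1 must be large, and comparing phi at the two places gives the lower bound.
   Since u is only a distributional solution, the estimate is first proved for a
   mollification of u and the limit is taken in L^1. *)
Require Import Defs.
From HB Require Import structures.
From mathcomp Require Import all_boot all_order all_algebra.
From mathcomp Require Import all_classical all_reals all_analysis.
From mathcomp Require Import measurable_realfun ring lra.
From mathcomp Require finmap.
Set Implicit Arguments. Unset Strict Implicit. Unset Printing Implicit Defensive.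
Import Order.TTheory GRing.Theory Num.Theory.
Import numFieldNormedType.Exports.
Local Open Scope classical_set_scope.
Local Open Scope ring_scope.

(** * Lebesgue measure on row vectors *)

(** With the choice of the auxiliary function made below, the logarithmic part of the weight
    contributes no positive zeroth order term: the whole gain carries the factor
    [b = 1 / (32 Rad^2)] of the quadratic part. The gain is of size [tau^3 b / |y|^2], at worst
    [tau^3 / Rad^4] up to constants, and it must exceed a fixed number to absorb the potential;
    hence the power 4/3. The logarithm in the conclusion is the drop of [tau ln |y|] between unit
    distance and distance [Rad]. No derivative of [u] is available, so [grad u] is never written.
    The Carleman and Caccioppoli inequalities are merged, for smooth [w], into one inequality in
    [w^2] and [(lap w)^2] alone. If [w] mollifies [u], then [lap w] mollifies [V u], which is
    locally bounded although [V] has no regularity; uniformly bounded functions that converge in L^1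
    are then enough for the limit. Multiplication by [V] is never commuted with mollification: the
    potential is absorbed through [|V u| <= |u|] once the limit has been taken. *)

Section measurable_rV.
Variables (R : realType) (n : nat).

Definition rVcoord (i : 'I_n) (x : 'rV[R]_n) : R := x ord0 i.

Let rV_set0 : g_sigma_preimage rVcoord set0.
Proof. exact: sigma_algebra0. Qed.

Let rV_setC A : g_sigma_preimage rVcoord A -> g_sigma_preimage rVcoord (~` A).
Proof. exact: sigma_algebraC. Qed.

Let rV_bigcup (F : (set 'rV[R]_n)^nat) : (forall i, g_sigma_preimage rVcoord (F i)) ->
  g_sigma_preimage rVcoord (\bigcup_i (F i)).
Proof. exact: sigma_algebra_bigcup. Qed.

(** Generated by the coordinates, so that a map into row vectors is measurable as soon as its
    coordinates are. *)
HB.instance Definition _ := @isMeasurable.Build default_measure_display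
  ('rV[R]_n) (g_sigma_preimage rVcoord) rV_set0 rV_setC rV_bigcup.

Lemma measurable_rVcoord i : measurable_fun [set: 'rV[R]_n] (rVcoord i).
Proof.
move=> _ Y mY; rewrite setTI; apply: sub_sigma_algebra => /=.
rewrite -bigcup_seq/=; exists i => /=; first by rewrite mem_index_enum.
by exists Y => //; rewrite setTI.
Qed.

Lemma measurable_fun_rVP d (T : measurableType d) (f : T -> 'rV[R]_n) :
  (forall i, measurable_fun setT (rVcoord i \o f)) -> measurable_fun setT f.
Proof.
move=> mf; suff H : g_sigma_preimage (fun i => rVcoord i \o f) `<=` measurable.
  move: H; rewrite g_sigma_preimage_comp => H _ A mA.
  by apply: H; exists A.
apply: smallest_sub; first exact: sigma_algebra_measurable.
rewrite -bigcup_seq => A [i _ [B mB <-]].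
exact: mf.
Qed.

End measurable_rV.

Section rVcons.
Variables (R : realType) (n : nat).

Definition rVcons (p : measurableTypeR R * 'rV[R]_n) : 'rV[R]_(n.+1) :=
  row_mx (\row_(j < 1) p.1) p.2.

Lemma measurable_rVcons : measurable_fun setT rVcons.
Proof.
apply: measurable_fun_rVP => i.
rewrite /rVcons /rVcoord /comp.
case: (split_ordP (i : 'I_(1 + n))) => j ->.
- apply: (eq_measurable_fun fst) => //.
  by move=> x _; rewrite (@row_mxEl R 1 1 n) mxE.
- apply: (eq_measurable_fun (fun x : R * 'rV[R]_n => rVcoord j x.2)).
    by move=> x _; rewrite (@row_mxEr R 1 1 n).
  exact: (measurableT_comp (@measurable_rVcoord R n j) measurable_snd).
Qed.

End rVcons.

Section rVlebesgue_step.
Local Open Scope ereal_scope.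
Variables (R : realType) (n : nat).
Variable m : {sigma_finite_measure set 'rV[R]_n -> \bar R}.

Definition rVstep : set 'rV[R]_(n.+1) -> \bar R :=
  pushforward (@lebesgue_measure R \x m) (@rVcons R n).

Let mstep := measure_function_pushforward__canonical__measure_function_Measure
  (@lebesgue_measure R \x m) (@measurable_rVcons R n).

Let rVstep0 : rVstep set0 = 0.
Proof. exact: (measure0 mstep). Qed.

Let rVstep_ge0 A : 0 <= rVstep A.
Proof. exact: (measure_ge0 mstep). Qed.

Let rVstep_sigma_additive : semi_sigma_additive rVstep.
Proof.
exact: (@measure_semi_sigma_additive _ _ _ mstep).
Qed.

HB.instance Definition _ := isMeasure.Build _ _ _ rVstep
  rVstep0 rVstep_ge0 rVstep_sigma_additive.

Definition rVuncons (x : 'rV[R]_(n.+1)) : measurableTypeR R * 'rV[R]_n :=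
  (@lsubmx R 1 1 n x ord0 ord0, @rsubmx R 1 1 n x).

Lemma rVunconsK : cancel rVuncons (@rVcons R n).
Proof.
move=> x; apply: (etrans _ (@hsubmxK R 1 1 n x)); rewrite /rVuncons /rVcons.
have -> : (\row_(j < 1) (@lsubmx R 1 1 n x) ord0 ord0) = @lsubmx R 1 1 n x.
  by apply/rowP => i; rewrite (ord1 i) !mxE.
by [].
Qed.

Lemma rVconsK : cancel (@rVcons R n) rVuncons.
Proof.
move=> [x v]; rewrite /rVuncons /rVcons /=.
by rewrite row_mxKl row_mxKr mxE.
Qed.

Lemma measurable_rVuncons : measurable_fun setT rVuncons.
Proof.
apply: (@measurable_fun_pair _ _ _ _ _ _ (fun x => (@lsubmx R 1 1 n x ord0 ord0))
  (fun x => @rsubmx R 1 1 n x)).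
  apply: (eq_measurable_fun (rVcoord (lshift n ord0 : 'I_(1 + n)))).
    by move=> x _; rewrite mxE.
  exact: measurable_rVcoord.
apply: measurable_fun_rVP => i.
apply: (eq_measurable_fun (rVcoord (rshift 1 i : 'I_(1 + n)))).
  by move=> x _; rewrite /= /rVcoord mxE.
exact: measurable_rVcoord.
Qed.

Let rVstep_sigma_finite : sigma_finite setT rVstep.
Proof.
have /sigma_finiteP[F [TF ndF Foo]] := @sigma_finiteT _ _ _ (@lebesgue_measure R).
have /sigma_finiteP[G [TG ndG Goo]] := @sigma_finiteT _ _ _ m.
have mFG i : measurable (F i `*` G i).
  by apply: measurableX; [case: (Foo i)|case: (Goo i)].
exists (fun i => rVuncons @^-1` (F i `*` G i)).
  apply/esym/seteqP; split => // x _.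
  have [k _ Fk] : (\bigcup_i F i) (rVuncons x).1 by rewrite -TF.
  have [l _ Gl] : (\bigcup_i G i) (rVuncons x).2 by rewrite -TG.
  (* Both exhaustions increase, so the larger index serves both factors. *)
  exists (maxn k l) => //; rewrite /preimage; split.
    by have /subsetPset := ndF _ _ (leq_maxl k l); apply; exact: Fk.
  by have /subsetPset := ndG _ _ (leq_maxr k l); apply; exact: Gl.
move=> i; split.
  by rewrite -[X in measurable X]setTI; exact: measurable_rVuncons.
rewrite /rVstep /pushforward.
rewrite (_ : _ @^-1` _ = F i `*` G i); last first.
  by apply/seteqP; split => x; rewrite /preimage /mkset rVconsK.
have [? ?] := Foo i; have [? ?] := Goo i.
by rewrite product_measure1E// lte_mul_pinfty// ge0_fin_numE.
Qed.

HB.instance Definition _ := Measure_isSigmaFinite.Build _ _ _ rVstep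
  rVstep_sigma_finite.

End rVlebesgue_step.

(* The recursion follows that of [intRn], so that Fubini identifies the two integrals. *)
Fixpoint rVlebesgue (R : realType) (n : nat) :
    {sigma_finite_measure set 'rV[R]_n -> \bar R} :=
  match n return {sigma_finite_measure set 'rV[R]_n -> \bar R} with
  | 0 => dirac (0 : 'rV[R]_0)
  | m.+1 => rVstep (rVlebesgue R m)
  end.

Arguments rVlebesgue : simpl never.

Section fubini_rV.
Local Open Scope ereal_scope.
Variables (R : realType) (n : nat).
Notation leb := (rVlebesgue R).

Lemma ge0_integral_rVS (f : 'rV[R]_n.+1 -> \bar R) :
  measurable_fun setT f -> (forall x, 0 <= f x) ->
  \int[leb n.+1]_x f x =
  \int[@lebesgue_measure R]_x \int[leb n]_v f (rVcons (x, v)).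
Proof.
move=> mf f0.
rewrite [LHS](ge0_integral_pushforward (@measurable_rVcons R n))//=.
rewrite preimage_setT fubini_tonelli1//=.
  by apply: measurableT_comp => //; exact: measurable_rVcons.
Qed.

Lemma integrable_rVS (f : 'rV[R]_n.+1 -> \bar R) :
  (leb n.+1).-integrable setT f ->
  (@lebesgue_measure R \x leb n).-integrable setT (f \o @rVcons R n).
Proof.
move=> intf; have mf := measurable_int _ intf.
apply/integrableP; split.
  by apply: measurableT_comp => //; exact: measurable_rVcons.
move/integrableP : intf => [_]; apply: le_lt_trans.
rewrite [in leRHS](ge0_integral_pushforward (@measurable_rVcons R n))//=.
by apply: measurableT_comp.
Qed.

Lemma integral_rVS (f : 'rV[R]_n.+1 -> \bar R) :
  (leb n.+1).-integrable setT f ->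
  \int[leb n.+1]_x f x =
  \int[@lebesgue_measure R]_x \int[leb n]_v f (rVcons (x, v)).
Proof.
move=> intf; have mf := measurable_int _ intf.
rewrite [LHS](integral_pushforward (@measurable_rVcons R n))//=.
  by rewrite preimage_setT -integral12_prod_meas1 //; exact: integrable_rVS.
by rewrite preimage_setT; exact: integrable_rVS.
Qed.

End fubini_rV.

(** * The iterated integral as an integral against Lebesgue measure *)

Section intRnE.
Local Open Scope ereal_scope.
Variables (R : realType).
Notation leb := (rVlebesgue R).

Lemma integral_rV0 (f : 'rV[R]_0 -> \bar R) : \int[leb 0%N]_x f x = f 0%R.
Proof.
rewrite [rVlebesgue]lock -lock integral_dirac//= ?diracT ?mul1e//.
move=> _ Y mY; rewrite setTI.
have [f0|nf0] := pselect (Y (f 0%R)).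
  rewrite (_ : _ @^-1` _ = setT)//.
  by apply/seteqP; split => // x _ /=; rewrite (_ : x = 0%R)//; apply/rowP; case.
rewrite (_ : _ @^-1` _ = set0)//.
by apply/seteqP; split => // x /=; rewrite (_ : x = 0%R)//; apply/rowP; case.
Qed.

Lemma intRnS n (f : 'rV[R]_n.+1 -> \bar R) : intRn f =
  \int[@lebesgue_measure R]_x intRn (fun v => f (rVcons (x, v))).
Proof. by []. Qed.

Lemma ge0_intRnE n (f : 'rV[R]_n -> \bar R) :
  measurable_fun setT f -> (forall x, 0 <= f x) ->
  intRn f = \int[leb n]_x f x.
Proof.
elim: n f => [|n ih] f mf f0; first by rewrite integral_rV0.
rewrite intRnS ge0_integral_rVS//; apply: eq_integral => x _.
apply: (ih (fun v => f (rVcons (x, v)))) => //.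
apply: (measurableT_comp mf); apply: (measurableT_comp (@measurable_rVcons R n)).
exact: measurable_fun_pair.
Qed.

(** Without integrability: Tonelli applies to the positive and the negative part, and a difference
    of measurable extended functions is measurable whatever values it takes. *)
Lemma measurable_integral_slice d (S : measurableType d) d' (T : measurableType d')
    (m : {sigma_finite_measure set T -> \bar R}) (f : S * T -> \bar R) :
  measurable_fun setT f -> measurable_fun setT (fun s => \int[m]_t f (s, t)).
Proof.
move=> mf.
rewrite (_ : (fun s => _) = (fun s => \int[m]_t f^\+ (s, t)) \-
   (fun s => \int[m]_t f^\- (s, t))); last first.
  apply/funext => s; rewrite [LHS]integralE.
  under eq_integral do rewrite funepos_comp/=.
  by under [X in _ - X = _]eq_integral do rewrite funeneg_comp/=.
apply: emeasurable_funB; apply: measurable_fun_fubini_tonelli_F => //.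
  exact: measurable_funepos.
exact: measurable_funeneg.
Qed.

(** The parameter space is arbitrary because in the induction the coordinate that is split off joins
    the parameters. *)
Lemma measurable_intRn_slice d (S : measurableType d) n
    (f : S * 'rV[R]_n -> \bar R) :
  measurable_fun setT f -> measurable_fun setT (fun s => intRn (fun x => f (s, x))).
Proof.
elim: n d S f => [|n ih] d S f mf.
  by rewrite /=; apply: (measurableT_comp mf); exact: measurable_fun_pair.
rewrite (_ : (fun s => _) = (fun s => \int[@lebesgue_measure R]_x
  intRn (fun v => f (s, rVcons (x, v)))))//.
apply: (@measurable_integral_slice _ S _ _ (@lebesgue_measure R)
  (fun p => intRn (fun v => f (p.1, rVcons (p.2, v))))).
apply: (ih _ _ (fun q : (S * (measurableTypeR R)) * 'rV[R]_n =>
   f (q.1.1, rVcons (q.1.2, q.2)))).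
apply: (measurableT_comp mf); apply: measurable_fun_pair.
  by apply: measurableT_comp => //.
apply: (measurableT_comp (@measurable_rVcons R n)).
apply: measurable_fun_pair => //.
by apply: measurableT_comp => //.
Qed.

(** Slices of an integrable function are integrable only for almost every first coordinate, so the
    induction hypothesis is available almost everywhere. Comparing the outer integrals then requires
    both inner integrals to be measurable in that coordinate, which the two slice lemmas provide. *)
Lemma intRnE n (f : 'rV[R]_n -> \bar R) :
  (leb n).-integrable setT f -> intRn f = \int[leb n]_x f x.
Proof.
elim: n f => [|n ih] f intf; first by rewrite integral_rV0.
have mf := measurable_int _ intf.
have mfc : measurable_fun setT (f \o @rVcons R n).
  by apply: (measurableT_comp mf); exact: measurable_rVcons.
rewrite intRnS integral_rVS//; apply: ae_eq_integral => //.
- exact: (@measurable_intRn_slice _ (measurableTypeR R) n (f \o @rVcons R n)).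
- exact: (@measurable_integral_slice _ (measurableTypeR R) _ _ (leb n) (f \o @rVcons R n)).
have := ae_integrable1 (integrable_rVS intf).
apply: filterS => x /= intx _.
exact: (ih (fun v => f (rVcons (x, v)))).
Qed.

End intRnE.

(** * Translation invariance, product functions and the volume of cubes *)

Section translation.
Local Open Scope ereal_scope.
Variables (R : realType).
Notation leb := (rVlebesgue R).

Lemma measurable_addr1 (a : R) : measurable_fun [set: measurableTypeR R]
  ((fun x : measurableTypeR R => (x + a)%R) : _ -> measurableTypeR R).
Proof. by apply: measurable_funD => //. Qed.

(** Lebesgue measure is determined by its values on half-open intervals, whose length a translation
    preserves. *)
Lemma lebesgue_measureD (a : R) (A : set R) : measurable A ->
  pushforward (@lebesgue_measure R) (fun x => (x + a)%R : measurableTypeR R) A =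
  lebesgue_measure A.
Proof.
have ma := measurable_addr1 a.
pose m := measure_function_pushforward__canonical__measure_function_Measure
  (@lebesgue_measure R) ma.
move=> mA; apply/esym; apply: (@lebesgue_measure_unique _ m) => //= _ [[b c]] _ <-.
rewrite /m /= /pushforward.
rewrite (_ : _ @^-1` _ = `](b - a)%R, (c - a)%R]%classic); last first.
  by apply/seteqP; split => x /=; rewrite !in_itv /= lerBrDr ltrBlDr.
rewrite !lebesgue_measure_itv/= !lte_fin ltrD2r; case: ifP => // _.
by rewrite -!EFinB; congr EFin; ring.
Qed.

Lemma ge0_integral_addr1 (a : R) (f : measurableTypeR R -> \bar R) :
  measurable_fun setT f -> (forall x, 0 <= f x) ->
  \int[@lebesgue_measure R]_x f (x + a)%R = \int[@lebesgue_measure R]_x f x.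
Proof.
move=> mf f0; have ma := measurable_addr1 a.
transitivity (\int[pushforward (@lebesgue_measure R)
    (fun x => (x + a)%R : measurableTypeR R)]_x f x).
  by rewrite (ge0_integral_pushforward ma)//= preimage_setT.
by apply: eq_measure_integral => A mA _; exact: lebesgue_measureD.
Qed.

Lemma measurable_rVadd n (a : 'rV[R]_n) :
  measurable_fun [set: 'rV[R]_n] (fun x : 'rV[R]_n => (x + a)%R).
Proof.
apply: measurable_fun_rVP => i.
apply: (eq_measurable_fun (fun x : 'rV[R]_n => (rVcoord i x + a ord0 i)%R)).
  by move=> x _; rewrite /rVcoord /= !mxE.
by apply: measurable_funD => //; exact: measurable_rVcoord.
Qed.

Lemma rVconsD n (p q : measurableTypeR R * 'rV[R]_n) :
  (rVcons p + rVcons q)%R = rVcons ((p.1 + q.1)%R, (p.2 + q.2)%R).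
Proof.
apply: (etrans (@add_row_mx R 1 1 n _ _ _ _)); congr row_mx.
by apply/rowP => i; rewrite !mxE.
Qed.

Lemma ge0_integral_rVD n (a : 'rV[R]_n) (f : 'rV[R]_n -> \bar R) :
  measurable_fun setT f -> (forall x, 0 <= f x) ->
  \int[leb n]_x f (x + a)%R = \int[leb n]_x f x.
Proof.
elim: n a f => [|n ih] a f mf f0.
  by rewrite !integral_rV0; congr f; apply/rowP; case.
have mfa : measurable_fun setT (fun x : 'rV[R]_n.+1 => f (x + a)%R).
  by apply: (measurableT_comp mf); exact: measurable_rVadd.
rewrite !ge0_integral_rVS// -(rVunconsK a).
pose b := (rVuncons a).1; pose w := (rVuncons a).2.
have mfc : measurable_fun setT (f \o @rVcons R n).
  by apply: (measurableT_comp mf); exact: measurable_rVcons.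
rewrite -[RHS](ge0_integral_addr1 b); last 2 first.
- exact: (@measurable_integral_slice R _ (measurableTypeR R) _ _ (leb n) (f \o @rVcons R n) mfc).
- by move=> x; exact: integral_ge0.
apply: eq_integral => x _.
under eq_integral do rewrite rVconsD /=.
rewrite (ih w (fun v => f (rVcons (_, v))))//.
apply: (measurableT_comp mfc); exact: measurable_fun_pair.
Qed.

Lemma integral_rVD n (a : 'rV[R]_n) (f : 'rV[R]_n -> \bar R) :
  measurable_fun setT f ->
  \int[leb n]_x f (x + a)%R = \int[leb n]_x f x.
Proof.
move=> mf; rewrite [LHS]integralE [RHS]integralE.
under eq_integral do rewrite (funepos_comp f (fun x : 'rV[R]_n => (x + a)%R))/=.
under [X in _ - X = _]eq_integral do
  rewrite (funeneg_comp f (fun x : 'rV[R]_n => (x + a)%R))/=.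
by rewrite !ge0_integral_rVD//; [exact: measurable_funeneg|exact: measurable_funepos].
Qed.

Lemma rVcons0 n (p : measurableTypeR R * 'rV[R]_n) : rVcons p ord0 ord0 = p.1.
Proof.
have E : ord0 = lshift n (ord0 : 'I_1) :> 'I_(1 + n) by apply: val_inj.
apply: (etrans (congr1 (rVcons p ord0) E)).
by rewrite /rVcons (@row_mxEl R 1 1 n) mxE.
Qed.

Lemma rVconsS n (p : measurableTypeR R * 'rV[R]_n) i :
  rVcons p ord0 (lift ord0 i) = p.2 ord0 i.
Proof.
have E : lift ord0 i = rshift 1 i :> 'I_(1 + n) by apply: val_inj.
apply: (etrans (congr1 (rVcons p ord0) E)).
by rewrite /rVcons (@row_mxEr R 1 1 n).
Qed.

Lemma ge0_integral_rV_prod n (b : 'I_n -> R -> R) :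
  (forall i, measurable_fun setT (b i)) -> (forall i x, (0 <= b i x)%R) ->
  \int[leb n]_x (\prod_(i < n) b i (x ord0 i))%:E =
  \prod_(i < n) \int[@lebesgue_measure R]_t (b i t)%:E.
Proof.
elim: n b => [|n ih] b mb b0.
  by rewrite integral_rV0 !big_ord0.
rewrite ge0_integral_rVS; last 2 first.
- apply/measurable_EFinP.
  apply: measurable_prod => i _.
  by apply: (measurableT_comp (mb i)); exact: measurable_rVcoord.
- by move=> x; rewrite lee_fin; exact: prodr_ge0.
rewrite big_ord_recl -ih; [|by move=> i|by move=> i x].
rewrite -ge0_integralZr//; last 3 first.
- have H : measurable_fun setT (EFin \o b ord0) by apply/measurable_EFinP; exact: mb.
  exact: H.
- by move=> x _; rewrite lee_fin.
- by apply: integral_ge0 => x _; rewrite lee_fin; exact: prodr_ge0.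
apply: eq_integral => t _.
rewrite -ge0_integralZl//; last 3 first.
- apply/measurable_EFinP.
  apply: measurable_prod => i _.
  by apply: (measurableT_comp (mb _)); exact: measurable_rVcoord.
- by move=> x _; rewrite lee_fin; exact: prodr_ge0.
- by rewrite lee_fin.
apply: eq_integral => v _; rewrite -EFinM big_ord_recl; congr (_ * _)%:E.
  by rewrite rVcons0.
by apply: eq_bigr => i _; rewrite rVconsS.
Qed.

Lemma measurable_cube n (a : 'rV[R]_n) (L : R) :
  measurable [set x : 'rV[R]_n | forall i, (a ord0 i <= x ord0 i <= a ord0 i + L)%R].
Proof.
rewrite (_ : [set _ | _] = \bigcap_(i in [set: 'I_n]) (rVcoord i @^-1` `[a ord0 i, (a ord0 i + L)%R])).
  apply: fin_bigcap_measurable => // i _.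
  by rewrite -[X in measurable X]setTI; apply: measurable_rVcoord.
apply/seteqP; split => x /=.
  by move=> H i _; rewrite /rVcoord/= in_itv/=; exact: H.
by move=> H i; have := H i I; rewrite /rVcoord/= in_itv/=.
Qed.

(** The one volume that is computed: it bounds norm balls from above and the integral of a bump from
    below. *)
Lemma rVlebesgue_cube n (a : 'rV[R]_n) (L : R) : (0 <= L)%R ->
  leb n [set x | forall i, (a ord0 i <= x ord0 i <= a ord0 i + L)%R] = (L ^+ n)%:E.
Proof.
move=> L0.
pose b (i : 'I_n) (t : R) : R := \1_(`[a ord0 i, (a ord0 i + L)%R]%classic) t.
have mA := measurable_cube a L.
have := integral_indic (leb n) measurableT mA; rewrite setIT => <-.
transitivity (\int[leb n]_x (\prod_(i < n) b i (x ord0 i))%:E).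
  apply: eq_integral => x _; congr EFin; rewrite /b indicE.
  have [xA|xA] := boolP (_ \in _).
    rewrite big1// => i _; rewrite indicE mem_set//=.
    by rewrite in_itv/=; move: xA; rewrite inE; exact.
  have [i /negP xi] : exists i, ~ (a ord0 i <= x ord0 i <= a ord0 i + L)%R.
    by apply/existsNP; move: xA; rewrite notin_setE.
  rewrite (bigD1 i)//= indicE memNset ?mul0r//=.
  by rewrite in_itv/=; exact/negP.
rewrite ge0_integral_rV_prod//; last by move=> i; exact: measurable_indic.
rewrite (eq_bigr (fun=> L%:E)).
  by rewrite -(big_morph _ (@EFinM R) (erefl _)) prodr_const card_ord.
move=> i _; rewrite /b integral_indic//= setIT lebesgue_measure_itv/= lte_fin.
case: ifPn => [_|]; first by rewrite -EFinB addrAC subrr add0r.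
by rewrite ltrDl -leNgt => L0'; congr EFin; apply/eqP; rewrite eq_le L0 L0'.
Qed.

End translation.

(** * Measurability of open sets and of continuous functions *)

Section open_measurable.
Variables (R : realType) (n : nat).

Lemma rV_ball_measurable (q : 'rV[R]_n) (e : R) : measurable (ball q e : set 'rV[R]_n).
Proof.
have [e0|e0] := ltP 0 e; last first.
  rewrite (_ : ball q e = set0)//; apply/seteqP; split => // x [].
  by rewrite ltNge e0.
rewrite (_ : ball q e = \bigcap_(i in [set: 'I_n]) (rVcoord i @^-1` (ball (q ord0 i) e))).
  apply: fin_bigcap_measurable => // i _.
  rewrite -[X in measurable X]setTI; apply: measurable_rVcoord => //.
  exact: measurable_ball.
apply/seteqP; split => x.
  by move=> [_ H] i _; exact: H.
by move=> H; split => // i j; rewrite ord1; exact: H.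
Qed.

(** Balls with rational centre and radius [1 / (k + 1)] are countably many, and those contained in
    an open set cover it. A ball of the sup norm is a finite intersection of coordinate
    conditions. *)
Lemma rV_open_measurable (U : set 'rV[R]_n) : open U -> measurable U.
Proof.
move=> oU.
pose c (p : 'rV[rat]_n) : 'rV[R]_n := map_mx ratr p.
pose F (p : 'rV[rat]_n * nat) : set 'rV[R]_n :=
  if `[< ball (c p.1) p.2.+1%:R^-1 `<=` U >] then ball (c p.1) p.2.+1%:R^-1 else set0.
rewrite (_ : U = \bigcup_p F p).
  apply: countable_bigcupT_measurable => [|p].
    exact: countableP.
  by rewrite /F; case: asboolP => // _; exact: rV_ball_measurable.
apply/seteqP; split => [x Ux|x [p _]]; last first.
  by rewrite /F; case: asboolP => // pU; exact: pU.
have [e /= e0 eU] : exists2 e : R, 0 < e & ball x e `<=` U.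
  by apply/nbhs_ballP; exact: open_nbhs_nbhs.
(* A ball of radius below [e / 2] that contains [x] stays in the ball of radius [e] around [x]. *)
have [k ke] : exists k : nat, (k.+1%:R^-1 : R) < e / 2.
  have e2 : 0 < e / 2 by rewrite divr_gt0.
  have [k _ /(_ k (leqnn k))] := near_infty_natSinv_lt (PosNum e2).
  by exists k.
have /choice[q qP] : forall i : 'I_n, exists q : rat,
    ball (x ord0 i) k.+1%:R^-1 (ratr q : R).
  move=> i.
  have : x ord0 i - k.+1%:R^-1 < x ord0 i + k.+1%:R^-1.
    by rewrite ltrD2l gtrN ?invr_gt0.
  move=> /rat_in_itvoo[q]; rewrite in_itv/= => /andP[q1 q2]; exists q.
  by rewrite /ball/= ltr_distlC q1 q2.
have xq : ball (c (\row_i q i)) k.+1%:R^-1 x.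
  split; first by rewrite invr_gt0.
  by move=> i j; rewrite ord1 !mxE; apply: ball_sym; exact: qP.
exists (\row_i q i, k) => //; rewrite /F/=; case: asboolP => // -[].
move=> y qy; apply: eU; rewrite (splitr e).
apply: (@ball_triangle _ _ (c (\row_i q i))).
  apply: ball_sym; exact: (le_ball (ltW ke)).
exact: (le_ball (ltW ke)).
Qed.

Lemma continuous_rV_measurable (f : 'rV[R]_n -> R) : continuous f ->
  measurable_fun setT f.
Proof.
move=> cf; apply: (measurability _ (RGenOpens.measurableE R)).
move=> _ [_ [a [b ->]] <-]; rewrite setTI.
apply: rV_open_measurable; by apply: open_comp => // *; exact: interval_open.
Qed.

Lemma Rn_measurable_fun_rV (f : 'rV[R]_n -> R) : Rn_measurable_fun f ->
  measurable_fun setT f.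
Proof.
move=> mf.
pose g (x : 'rV[R]_n) : n.-tuple R := [tuple x ord0 i | i < n].
apply: (eq_measurable_fun ((fun t : n.-tuple R => f (\row_i tnth t i)) \o g)).
  move=> x _ /=; congr f; apply/rowP => i; rewrite mxE /g tnth_mktuple.
  by [].
apply: (measurableT_comp mf).
apply/measurable_fun_tnthP => i.
apply: (eq_measurable_fun (rVcoord i)); last exact: measurable_rVcoord.
by move=> x _ /=; rewrite /g tnth_mktuple.
Qed.

End open_measurable.

(** * Smooth functions *)

Section smooth.
Variables (R : realType) (n : nat).
Implicit Types (f g : 'rV[R]_n -> R) (x v : 'rV[R]_n).

(** Counting derivatives turns closure under products, inverses and compositions into inductions on
    [k]: one differentiation leads to an expression in functions that are again [k] times
    differentiable. *)
Fixpoint smk (k : nat) f : Prop :=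
  (forall x, differentiable f x) /\
  (if k is k'.+1 then forall v, smk k' ('D_v f) else True).

Definition smooth f := forall k, smk k f.

Lemma smkSP k f : smk k.+1 f <->
  (forall x, differentiable f x) /\ (forall v, smk k ('D_v f)).
Proof. by []. Qed.

Lemma smkS k f : smk k.+1 f -> smk k f.
Proof.
elim: k f => [|k ih] f /smkSP[df sf]; first by split.
by apply/smkSP; split => // v; apply: ih; exact: sf.
Qed.

Lemma smooth_diff f : smooth f -> forall x, differentiable f x.
Proof. by move=> /(_ 0%N)[]. Qed.

Lemma smooth_continuous f : smooth f -> continuous f.
Proof. by move=> sf x; apply/differentiable_continuous/smooth_diff. Qed.

Lemma smooth_derivable f x v : smooth f -> derivable f x v.
Proof. by move=> sf; apply/diff_derivable/smooth_diff. Qed.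

Arguments smooth_derivable {f} x v.

Lemma smooth_D f v : smooth f -> smooth ('D_v f).
Proof. by move=> sf k; have [_] := sf k.+1; exact. Qed.

Lemma smooth_iterD f (vs : seq 'rV[R]_n) : smooth f -> smooth (Defs.iterD vs f).
Proof. by move=> sf; elim: vs => //= v vs ih; exact: smooth_D. Qed.

Lemma smk_cst k (c : R) : smk k (cst c).
Proof.
elim: k c => [|k ih] c; split => // v.
by rewrite (_ : 'D_v _ = cst 0)//; apply/funext => x; exact: derive_cst.
Qed.

Lemma smooth_cst (c : R) : smooth (cst c).
Proof. by move=> k; exact: smk_cst. Qed.

Lemma smk_add k f g : smk k f -> smk k g -> smk k (f \+ g).
Proof.
elim: k f g => [|k ih] f g.
  by move=> [df _] [dg _]; split => // x; exact: differentiableD.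
move=> /smkSP[df sf] /smkSP[dg sg].
apply/smkSP; split; first by move=> x; exact: differentiableD.
move=> v; rewrite (_ : 'D_v _ = 'D_v f \+ 'D_v g); first exact: ih.
by apply/funext => x; rewrite [LHS]deriveD//; exact: diff_derivable.
Qed.

Lemma smooth_add f g : smooth f -> smooth g -> smooth (fun x => f x + g x).
Proof. by move=> sf sg k; exact: (smk_add (sf k) (sg k)). Qed.

Lemma derive_mulE f g x v : differentiable f x -> differentiable g x ->
  'D_v (fun y => f y * g y) x = f x * 'D_v g x + 'D_v f x * g x.
Proof.
move=> df dg; have := @deriveM _ _ f g x v (diff_derivable df) (diff_derivable dg).
by move=> ->; rewrite /GRing.scale/= (mulrC (g x)).
Qed.

Lemma smk_mul k f g : smk k f -> smk k g -> smk k (fun x => f x * g x).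
Proof.
elim: k f g => [|k ih] f g sf sg.
  have [df _] := sf; have [dg _] := sg.
  by split => // x; exact: (differentiableM (df x) (dg x)).
have /smkSP[df Df] := sf; have /smkSP[dg Dg] := sg.
apply/smkSP; split; first by move=> x; exact: (differentiableM (df x) (dg x)).
move=> v; rewrite (_ : 'D_v _ =
  (fun x => f x * 'D_v g x) \+ (fun x => 'D_v f x * g x)); last first.
  by apply/funext => x; rewrite derive_mulE.
by apply: smk_add; apply: ih => //; exact: smkS.
Qed.

Lemma smooth_mul f g : smooth f -> smooth g -> smooth (fun x => f x * g x).
Proof. by move=> sf sg k; exact: (smk_mul (sf k) (sg k)). Qed.

Lemma smooth_scale (c : R) f : smooth f -> smooth (fun x => c * f x).
Proof. by move=> sf; apply: (@smooth_mul (cst c)) => //; exact: smooth_cst. Qed.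

Lemma smooth_opp f : smooth f -> smooth (fun x => - f x).
Proof.
move=> sf; rewrite (_ : (fun _ => _) = (fun x => -1 * f x)).
  exact: smooth_scale.
by apply/funext => x; rewrite mulN1r.
Qed.

Lemma smooth_sub f g : smooth f -> smooth g -> smooth (fun x => f x - g x).
Proof. by move=> sf sg; apply: smooth_add => //; exact: smooth_opp. Qed.

Lemma smooth_sum (I : Type) (r : seq I) (P : pred I) (F : I -> 'rV[R]_n -> R) :
  (forall i, smooth (F i)) -> smooth (fun x => \sum_(i <- r | P i) F i x).
Proof.
move=> sF; elim: r => [|i r ih].
  by rewrite (_ : (fun _ => _) = cst 0); [exact: smooth_cst|
    apply/funext => x; rewrite big_nil].
rewrite (_ : (fun _ => _) = (fun x => (if P i then F i x else 0) +
    \sum_(i <- r | P i) F i x)); last first.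
  by apply/funext => x; rewrite big_cons; case: ifP => //; rewrite add0r.
apply: smooth_add => //; case: (P i) => //; exact: smooth_cst.
Qed.

Lemma smooth_prod (I : Type) (r : seq I) (P : pred I) (F : I -> 'rV[R]_n -> R) :
  (forall i, smooth (F i)) -> smooth (fun x => \prod_(i <- r | P i) F i x).
Proof.
move=> sF; elim: r => [|i r ih].
  by rewrite (_ : (fun _ => _) = cst 1); [exact: smooth_cst|
    apply/funext => x; rewrite big_nil].
rewrite (_ : (fun _ => _) = (fun x => (if P i then F i x else 1) *
    \prod_(i <- r | P i) F i x)); last first.
  by apply/funext => x; rewrite big_cons; case: ifP => //; rewrite mul1r.
apply: smooth_mul => //; case: (P i) => //; exact: smooth_cst.
Qed.

Lemma is_derive_comp1 f x v (b : R -> R) (db : R) : differentiable f x ->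
  is_derive (f x) 1 b db -> differentiable (b \o f) x /\
  'D_v (b \o f) x = db * 'D_v f x.
Proof.
move=> df [derb bE].
have dbf : differentiable b (f x) by apply/derivable1_diffP.
split; first exact: differentiable_comp.
have -> := deriveE v (differentiable_comp df dbf).
have -> := diff_comp df dbf.
rewrite [LHS]/= -(deriveE v df) (_ : 'D_v f x = 'D_v f x *: 1); last by rewrite /GRing.scale/= mulr1.
have -> : 'd b (f x) ('D_v f x *: 1) = 'D_v f x *: 'd b (f x) 1 by exact: linearZ.
by rewrite -deriveE// bE /GRing.scale/= mulr1 mulrC.
Qed.

(** The outer function comes with all its derivatives [b m], so that differentiating stays inside
    the family. For [expR] the family is constant; for the bump it runs through the polynomials
    [bump_iter m]. *)
Lemma smooth_comp f (b : nat -> R -> R) m :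
  (forall m (t : R), is_derive t 1 (b m) (b m.+1 t)) -> smooth f -> smooth (b m \o f).
Proof.
move=> hb sf k; elim: k m => [|k ih] m; split => //.
- by move=> x; have [] := is_derive_comp1 0 (smooth_diff sf x) (hb m (f x)).
- by move=> x; have [] := is_derive_comp1 0 (smooth_diff sf x) (hb m (f x)).
move=> v; rewrite (_ : 'D_v _ = (fun x => (b m.+1 \o f) x * 'D_v f x)); last first.
  by apply/funext => x; have [_] := is_derive_comp1 v (smooth_diff sf x) (hb m (f x)).
apply: smk_mul; first exact: ih.
exact: smooth_D.
Qed.

Lemma smooth_exp f : smooth f -> smooth (fun x => expR (f x)).
Proof.
move=> sf; apply: (@smooth_comp f (fun=> expR) 0%N) => // m t.
Qed.

Lemma derive_invE f x v : differentiable f x -> f x != 0 ->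
  differentiable (fun y => (f y)^-1) x /\
  'D_v (fun y => (f y)^-1) x = - (f x)^-1 ^+ 2 * 'D_v f x.
Proof.
move=> df fx0.
have h : is_derive (f x) 1 (@GRing.inv R) (- (f x)^-1 ^+ 2).
  have di := @derivable_id R R (f x) 1.
  split; first exact: (@derivableV _ _ id).
  rewrite (@deriveV _ _ id)// derive_id /GRing.scale/= mulr1.
  by rewrite exprVn.
exact: (is_derive_comp1 v df h).
Qed.

Lemma smooth_inv f : (forall x, f x != 0) -> smooth f -> smooth (fun x => (f x)^-1).
Proof.
move=> f0 sf k; elim: k => [|k ih]; split => //.
- by move=> x; have [] := derive_invE 0 (smooth_diff sf x) (f0 x).
- by move=> x; have [] := derive_invE 0 (smooth_diff sf x) (f0 x).
move=> v; rewrite (_ : 'D_v _ = (fun x => -1 * (((f x)^-1 * (f x)^-1) * 'D_v f x))).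
  apply: smk_mul; first exact: smk_cst.
  by apply: smk_mul; [exact: smk_mul|exact: smooth_D].
apply/funext => x; have [_ ->] := derive_invE v (smooth_diff sf x) (f0 x).
by rewrite expr2 mulN1r mulNr.
Qed.

Lemma derive_lnE f x v : differentiable f x -> 0 < f x ->
  differentiable (fun y => ln (f y)) x /\
  'D_v (fun y => ln (f y)) x = (f x)^-1 * 'D_v f x.
Proof. by move=> df fx0; exact: (is_derive_comp1 v df (is_derive1_ln fx0)). Qed.

Lemma smooth_ln f : (forall x, 0 < f x) -> smooth f -> smooth (fun x => ln (f x)).
Proof.
move=> f0 sf; case => [|k].
  by split => // x; have [] := derive_lnE 0 (smooth_diff sf x) (f0 x).
split; first by move=> x; have [] := derive_lnE 0 (smooth_diff sf x) (f0 x).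
move=> v; rewrite (_ : 'D_v _ = (fun x => (f x)^-1 * 'D_v f x)).
  apply: smk_mul; [apply: smooth_inv => //|exact: smooth_D].
  by move=> x; rewrite gt_eqF.
by apply/funext => x; have [] := derive_lnE v (smooth_diff sf x) (f0 x).
Qed.

Lemma derive_rVcoord i x v : 'D_v (fun y : 'rV[R]_n => y ord0 i) x = v ord0 i.
Proof.
have dc := differentiable_coord x ord0 i.
rewrite deriveE//.
have lc : linear (fun y : 'rV[R]_n => y ord0 i) by move=> a y z; rewrite !mxE.
pose l : {linear 'rV[R]_n -> R} := HB.pack (fun y : 'rV[R]_n => y ord0 i)
  (GRing.isLinear.Build _ _ _ _ _ lc).
rewrite (_ : (fun y : 'rV[R]_n => y ord0 i) = l)// diff_lin//.
exact: coord_continuous.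
Qed.

Lemma smooth_rVcoord i : smooth (fun x : 'rV[R]_n => x ord0 i).
Proof.
case => [|k]; first by split => // x; exact: differentiable_coord.
apply/smkSP; split => [x|v]; first exact: differentiable_coord.
rewrite (_ : 'D_v _ = cst (v ord0 i)); first exact: smk_cst.
by apply/funext => x; rewrite derive_rVcoord.
Qed.

Lemma is_derive_line f x v t : differentiable f (x + t *: v) ->
  is_derive t 1 (fun s : R => f (x + s *: v)) ('D_v f (x + t *: v)).
Proof.
move=> df; have := @derivableP _ _ _ f (x + t *: v) v (diff_derivable df).
move=> -[dfd dfE].
have E : (fun h : R => h^-1 *: (((fun s : R => f (x + s *: v)) \o shift t) (h *: 1) - f (x + t *: v)))
  = (fun h : R => h^-1 *: ((f \o shift (x + t *: v)) (h *: v) - f (x + t *: v))).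
  apply/funext => h /=; congr (_ *: (f _ - _)).
  by rewrite [h *: 1]mulr1 scalerDl addrCA.
by split; rewrite /derivable /derive E.
Qed.

Lemma line_MVT f x v t : (forall x, differentiable f x) -> 0 < t ->
  exists2 c, 0 < c < t & f (x + t *: v) - f x = t * 'D_v f (x + c *: v).
Proof.
move=> df t0.
have h s : s \in `]0, t[ -> is_derive s 1 (fun s : R => f (x + s *: v)) ('D_v f (x + s *: v)).
  by move=> _; exact: is_derive_line.
have ch : {within `[0, t], continuous (fun s : R => f (x + s *: v))}.
  apply: continuous_subspaceT => s.
  by apply/differentiable_continuous/derivable1_diffP; case: (is_derive_line (df (x + s *: v))).
have [c c0t /esym] := MVT t0 h ch.
rewrite scale0r addr0 subr0 => E.
exists c; first by move: c0t; rewrite in_itv.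
by rewrite -E mulrC.
Qed.

(** Schwarz's theorem. The second difference over the parallelogram spanned by [h u] and [h v] is
    symmetric in the two directions, and two mean value steps write it as [h^2] times either mixed
    derivative at a nearby point; continuity does the rest. *)
Lemma smooth_derive_comm f u v x : smooth f -> 'D_u ('D_v f) x = 'D_v ('D_u f) x.
Proof.
move=> sf.
have key a b h : 0 < h -> exists c d, [/\ 0 < c < h, 0 < d < h &
   f (x + h *: a + h *: b) - f (x + h *: a) - (f (x + h *: b) - f x) =
   h * (h * 'D_b ('D_a f) (x + c *: a + d *: b))].
  move=> h0.
  pose g y := f (y + h *: b) - f y.
  have dg y : differentiable g y.
    apply: differentiableB; last exact: smooth_diff.
    apply: (@differentiable_comp _ _ _ _ (fun y => y + h *: b) f); last exact: smooth_diff.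
    by apply: differentiableD.
  have [c c0h E] := line_MVT x a dg h0.
  have [d d0h E2] := line_MVT (x + c *: a) b (smooth_diff (smooth_D a sf)) h0.
  exists c, d; split => //.
  have -> : f (x + h *: a + h *: b) - f (x + h *: a) - (f (x + h *: b) - f x) = g (x + h *: a) - g x.
    by [].
  rewrite E -E2; congr (_ * _).
  have dsh y : is_derive y a (fun y => f (y + h *: b)) ('D_a f (y + h *: b)).
    have := @derivableP _ _ _ f (y + h *: b) a (smooth_derivable _ _ sf).
    move=> -[dfd dfE].
    have E' : (fun s : R => s^-1 *: (((fun y => f (y + h *: b)) \o shift y) (s *: a) - f (y + h *: b)))
      = (fun s : R => s^-1 *: ((f \o shift (y + h *: b)) (s *: a) - f (y + h *: b))).
      by apply/funext => s /=; congr (_ *: (f _ - _)); rewrite addrA.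
    by split; rewrite /derivable /derive E'.
  have [dd DE] := dsh (x + c *: a).
  rewrite /g [LHS]deriveB//; first by rewrite DE.
  exact: smooth_derivable.
pose F := 'D_v ('D_u f); pose G := 'D_u ('D_v f).
have cF : F @ x --> F x by apply: smooth_continuous; do 2 apply: smooth_D.
have cG : G @ x --> G x by apply: smooth_continuous; do 2 apply: smooth_D.
apply/eqP/negPn/negP => neq.
have e0 : 0 < `|G x - F x| / 2 by rewrite divr_gt0// normr_gt0 subr_eq0.
have /nbhs_ballP[r1 /= r10 Fr] : \forall y \near x, `|F x - F y| < `|G x - F x| / 2.
  by move/cvgrPdist_lt : cF; apply.
have /nbhs_ballP[r2 /= r20 Gr] : \forall y \near x, `|G x - G y| < `|G x - F x| / 2.
  by move/cvgrPdist_lt : cG; apply.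
pose r := Num.min r1 r2; have r0 : 0 < r by rewrite lt_min r10 r20.
(* Small enough for every [x + c u + d v] with [c] and [d] below [h] to lie within [r] of [x]. *)
pose h := r / (1 + `|u| + `|v|).
have h0 : 0 < h by rewrite divr_gt0// !ltr_wpDr.
have inb a b : 0 < a < h -> 0 < b < h -> `|a *: u + b *: v| < r.
  move=> /andP[a0 ah] /andP[b0 bh].
  apply: (le_lt_trans (ler_normD _ _)); rewrite !normrZ !gtr0_norm//.
  apply: (@le_lt_trans _ _ (h * (`|u| + `|v|))).
    by rewrite mulrDr lerD// ler_wpM2r// ltW.
  rewrite /h mulrAC ltr_pdivrMr ?ltr_wpDr// ltr_pM2l// -addrA ltrDr//.
have [c [d [c0 d0 E1]]] := key u v h h0.
have [c' [d' [c'0 d'0 E2]]] := key v u h h0.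
have : h * (h * F (x + c *: u + d *: v)) = h * (h * G (x + c' *: v + d' *: u)).
  have swap4 (p q s t : R) : p - q - (s - t) = p - s - (q - t) by ring.
  by move: E2; rewrite (addrAC x (h *: v)) swap4 => E2; exact: (etrans (esym E1) E2).
move=> /(mulfI (lt0r_neq0 h0)) /(mulfI (lt0r_neq0 h0)) FG.
have F1 : `|F x - F (x + c *: u + d *: v)| < `|G x - F x| / 2.
  apply: Fr; rewrite mx_norm_ball /ball_/= -addrA opprD addNKr normrN.
  by apply: (lt_le_trans (inb _ _ c0 d0)); rewrite ge_min lexx.
have G1 : `|G x - G (x + c' *: v + d' *: u)| < `|G x - F x| / 2.
  apply: Gr; rewrite mx_norm_ball /ball_/= -addrA opprD addNKr normrN addrC.
  by apply: (lt_le_trans (inb _ _ d'0 c'0)); rewrite ge_min lexx orbT.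
have : `|G x - F x| < `|G x - F x|.
  rewrite [ltRHS]splitr; apply: le_lt_trans (ltrD G1 F1).
  rewrite -FG; apply: le_trans (ler_normB _ _).
  by rewrite opprB addrA subrK.
by rewrite ltxx.
Qed.

End smooth.

(** * Bounded functions of compact support *)

Section bounded_compact_support.
Variables (R : realType) (n : nat).
Implicit Types (f g : 'rV[R]_n -> R) (x v : 'rV[R]_n).
Notation leb := (rVlebesgue R n).

Definition csupp f := exists M, forall x, M < `|x| -> f x = 0.

(** A class of integrable functions closed under sums, products, translations and absolute values:
    on it [Int] is linear and monotone with no integrability conditions to check. *)
Definition bcs f := [/\ measurable_fun setT f, exists C, forall x, `|f x| <= C & csupp f].

Definition Int f : R := (\int[leb]_x f x)%R.

Lemma rV_coord_le x i : `|x ord0 i| <= `|x|.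
Proof.
rewrite [leRHS]/Num.norm /= mx_normrE; apply/bigmax_geP; right => /=.
by exists (ord0, i).
Qed.

Lemma rV_norm_le x (c : R) : 0 <= c -> (forall i, `|x ord0 i| <= c) -> `|x| <= c.
Proof.
move=> c0 xc; rewrite [leLHS]/Num.norm /= mx_normrE; apply/bigmax_leP; split => //= -[i j] _ /=.
by rewrite ord1.
Qed.

Lemma measurable_rV_ballN (M : R) : measurable [set x : 'rV[R]_n | `|x| <= M].
Proof.
rewrite -[X in measurable X]setCK; apply: measurableC; apply: rV_open_measurable.
rewrite openC; apply: (closed_comp (f := (fun x : 'rV[R]_n => `|x|)) (D := [set r | r <= M])).
  by move=> x _; exact: norm_continuous.
exact: closed_le.
Qed.

Lemma rVlebesgue_ballN (M : R) : (leb [set x : 'rV[R]_n | (`|x| <= M)%R] <= ((2 * `|M|) ^+ n)%:E)%E.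
Proof.
have M2 : 0 <= 2 * `|M| by rewrite mulr_ge0.
pose a : 'rV[R]_n := const_mx (- `|M|).
rewrite -(rVlebesgue_cube a M2).
apply: le_measure; rewrite ?inE.
- exact: measurable_rV_ballN.
- exact: measurable_cube.
move=> x /= xM i; rewrite mxE.
have := le_trans (rV_coord_le x i) (le_trans xM (ler_norm M)).
rewrite ler_norml => /andP[-> /=] /le_trans; apply.
by rewrite mulr_natl mulr2n addKr.
Qed.

Lemma bcs_integrable f : bcs f -> leb.-integrable setT (EFin \o f).
Proof.
move=> [mf [C fC] [M fM]].
apply/integrableP; split; first exact/measurable_EFinP.
have mB := measurable_rV_ballN M.
apply: (@le_lt_trans _ _ (\int[leb]_x ((`|C|)%:E * (\1_[set x | `|x| <= M] x)%:E))%E).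
  apply: ge0_le_integral => //=.
  - by apply/measurable_EFinP; exact: measurableT_comp.
  - by apply: measurable_funeM; apply/measurable_EFinP; exact: measurable_indic.
  move=> x _; rewrite -EFinM lee_fin indicE.
  have [xM|xM] := leP `|x| M.
    by rewrite mem_set//= mulr1 (le_trans (fC x))// ler_norm.
  by rewrite fM// normr0 mulr_ge0.
rewrite ge0_integralZl//; last by apply/measurable_EFinP; exact: measurable_indic.
rewrite integral_indic// setIT.
apply: lte_mul_pinfty => //.
by apply: le_lt_trans (rVlebesgue_ballN M) _; rewrite ltry.
Qed.

Lemma csupp_mulr f g : csupp f -> csupp (fun x => f x * g x).
Proof. by move=> [M fM]; exists M => x /fM ->; rewrite mul0r. Qed.

Lemma csupp_mull f g : csupp g -> csupp (fun x => f x * g x).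
Proof. by move=> [M fM]; exists M => x /fM ->; rewrite mulr0. Qed.

Lemma csupp_add f g : csupp f -> csupp g -> csupp (fun x => f x + g x).
Proof.
move=> [M fM] [N gN]; exists (Num.max M N) => x; rewrite gt_max => /andP[xM xN].
by rewrite fM// gN// addr0.
Qed.

Lemma continuous_bounded_on f (M : R) : continuous f ->
  exists C, forall x, `|x| <= M -> `|f x| <= C.
Proof.
move=> cf.
have [M0|M0] := ltP M 0.
  by exists 0 => x xM; have := le_lt_trans xM M0; rewrite ltNge normr_ge0.
pose A := [set x : 'rV[R]_n | `|x| <= M].
have A0 : A !=set0 by exists 0; rewrite /A/= normr0.
have cA : compact A.
  apply: bounded_closed_compact; last first.
    apply: (closed_comp (f := (fun x : 'rV[R]_n => `|x|)) (D := [set r | r <= M])).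
      by move=> x _; exact: norm_continuous.
    exact: closed_le.
  by exists M; split; [exact: num_real|move=> y My x /= xM; exact: (le_trans xM (ltW My))].
have [|c cA' cmax] := @EVT_max_rV R n (fun x => `|f x|) A A0 cA.
  apply: continuous_subspaceT => x; apply: continuous_comp; first exact: cf.
  exact: norm_continuous.
by exists `|f c| => x xM; apply: cmax; rewrite inE.
Qed.

Lemma continuous_csupp_bounded f : continuous f -> csupp f -> exists C, forall x, `|f x| <= C.
Proof.
move=> cf [M fM]; have [C hC] := continuous_bounded_on M cf.
exists `|C| => x; have [xM|xM] := leP `|x| M.
  by rewrite (le_trans (hC _ xM))// ler_norm.
by rewrite fM// normr0.
Qed.

Lemma bcs_continuous f : continuous f -> csupp f -> bcs f.
Proof.
move=> cf sf; split => //; first exact: continuous_rV_measurable.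
exact: continuous_csupp_bounded.
Qed.

Lemma bcs_mul_continuous f g : bcs f -> continuous g -> bcs (fun x => f x * g x).
Proof.
move=> [mf [C fC] [M fM]] cg; split.
- by apply: measurable_funM => //; exact: continuous_rV_measurable.
- have [D gD] := continuous_bounded_on M cg.
  exists (`|C| * `|D|) => x; have [xM|xM] := leP `|x| M.
    rewrite normrM ler_pM// ?(le_trans (fC x)) ?ler_norm//.
    by rewrite (le_trans (gD x _))// ler_norm.
  by rewrite fM// mul0r normr0 mulr_ge0.
- by apply: csupp_mulr; exists M.
Qed.

Lemma bcs_mul f g : bcs f -> bcs g -> bcs (fun x => f x * g x).
Proof.
move=> [mf [C fC] [M fM]] [mg [D gD] _]; split.
- exact: measurable_funM.
- by exists (C * D) => x; rewrite normrM ler_pM.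
- by apply: csupp_mulr; exists M.
Qed.

Lemma bcs_add f g : bcs f -> bcs g -> bcs (fun x => f x + g x).
Proof.
move=> [mf [C fC] sf] [mg [D gD] sg]; split.
- exact: measurable_funD.
- by exists (C + D) => x; rewrite (le_trans (ler_normD _ _))// lerD.
- exact: csupp_add.
Qed.

Lemma bcs_scale (c : R) f : bcs f -> bcs (fun x => c * f x).
Proof.
move=> bf; rewrite (_ : (fun x => c * f x) = (fun x => f x * c)).
  by apply: (bcs_mul_continuous bf) ; exact: cst_continuous.
by apply/funext => x; rewrite mulrC.
Qed.

Lemma bcs_opp f : bcs f -> bcs (fun x => - f x).
Proof.
move=> bf; rewrite (_ : (fun x => - f x) = (fun x => -1 * f x)); first exact: bcs_scale.
by apply/funext => x; rewrite mulN1r.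
Qed.

Lemma bcs_sub f g : bcs f -> bcs g -> bcs (fun x => f x - g x).
Proof. by move=> bf bg; apply: bcs_add => //; exact: bcs_opp. Qed.

Lemma bcs_norm f : bcs f -> bcs (fun x => `|f x|).
Proof.
move=> [mf [C fC] [M fM]]; split.
- exact: measurableT_comp.
- by exists C => x; rewrite normr_id.
- by exists M => x /fM ->; rewrite normr0.
Qed.

Lemma bcs0 : bcs (fun=> 0).
Proof. by split; [|exists 0 => x; rewrite normr0|exists 0]. Qed.

Lemma bcs_sum (I : Type) (r : seq I) (F : I -> 'rV[R]_n -> R) :
  (forall i, bcs (F i)) -> bcs (fun x => \sum_(i <- r) F i x).
Proof.
move=> bF; elim: r => [|i r ih].
  by rewrite (_ : (fun _ => _) = (fun=> 0)); [exact: bcs0|apply/funext => x; rewrite big_nil].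
rewrite (_ : (fun _ => _) = (fun x => F i x + \sum_(i <- r) F i x)); first exact: bcs_add.
by apply/funext => x; rewrite big_cons.
Qed.

Lemma bcs_shift f v : bcs f -> bcs (fun x => f (x + v)).
Proof.
move=> [mf [C fC] [M fM]]; split.
- by apply: (measurableT_comp mf); exact: measurable_rVadd.
- by exists C => x.
- exists (M + `|v|) => x xM; apply: fM.
  rewrite -(ltrD2r `|v|); apply: (lt_le_trans xM).
  by rewrite -[in leLHS](addrK v x) (le_trans (ler_normB _ _)).
Qed.

Lemma IntD f g : bcs f -> bcs g -> Int (fun x => f x + g x) = Int f + Int g.
Proof. by move=> bf bg; rewrite /Int RintegralD//; exact: bcs_integrable. Qed.

Lemma IntB f g : bcs f -> bcs g -> Int (fun x => f x - g x) = Int f - Int g.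
Proof. by move=> bf bg; rewrite /Int RintegralB//; exact: bcs_integrable. Qed.

Lemma IntZ (c : R) f : bcs f -> Int (fun x => c * f x) = c * Int f.
Proof. by move=> bf; rewrite /Int RintegralZl//; exact: bcs_integrable. Qed.

Lemma Int_ge0 f : (forall x, 0 <= f x) -> 0 <= Int f.
Proof. by move=> f0; apply: Rintegral_ge0. Qed.

Lemma Int_le f g : bcs f -> bcs g -> (forall x, f x <= g x) -> Int f <= Int g.
Proof. by move=> bf bg fg; apply: le_Rintegral => //; exact: bcs_integrable. Qed.

Lemma Int_norm f : bcs f -> `|Int f| <= Int (fun x => `|f x|).
Proof. by move=> bf; apply: le_normr_Rintegral => //; exact: bcs_integrable. Qed.

Lemma Int_sum (I : Type) (r : seq I) (F : I -> 'rV[R]_n -> R) :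
  (forall i, bcs (F i)) -> Int (fun x => \sum_(i <- r) F i x) = \sum_(i <- r) Int (F i).
Proof.
move=> bF; elim: r => [|i r ih].
  rewrite big_nil (_ : (fun _ => _) = (fun=> 0)); last by apply/funext => x; rewrite big_nil.
  by rewrite /Int Rintegral_cst// mul0r.
rewrite (_ : (fun _ => _) = (fun x => F i x + \sum_(i <- r) F i x)); last first.
  by apply/funext => x; rewrite big_cons.
by rewrite IntD// ?ih ?big_cons//; exact: bcs_sum.
Qed.

Lemma Int_shift f v : bcs f -> Int (fun x => f (x + v)) = Int f.
Proof.
move=> [mf _ _]; rewrite /Int /Rintegral (@integral_rVD R n v (EFin \o f))//.
exact/measurable_EFinP.
Qed.

Lemma EFin_Int f : bcs f -> (Int f)%:E = (\int[leb]_x (f x)%:E)%E.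
Proof.
by move=> bf; rewrite /Int /Rintegral fineK//; apply: integrable_fin_num => //; exact: bcs_integrable.
Qed.

Lemma Int_ballN_le f (C M : R) : bcs f -> (forall x, f x <= C) -> 0 <= C -> 0 <= M ->
  (forall x, M < `|x| -> f x <= 0) -> Int f <= C * (2 * M) ^+ n.
Proof.
move=> bf fC C0 M0 fM.
have mB := measurable_rV_ballN M.
have bI : bcs (fun x => C * \1_[set x | `|x| <= M] x).
  apply: bcs_scale; split; first exact: measurable_indic.
    by exists 1 => x; rewrite indicE; case: (_ \in _); rewrite ?normr1 ?normr0.
  by exists M => x xM; rewrite indicE memNset//= => /le_lt_trans /(_ xM); rewrite ltxx.
apply: (@le_trans _ _ (Int (fun x => C * \1_[set x | `|x| <= M] x))).
  apply: Int_le => // x; have [xM|xM] := leP `|x| M.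
    by rewrite indicE mem_set//= mulr1.
  by rewrite (le_trans (fM _ xM))// mulr_ge0.
rewrite -lee_fin EFin_Int//.
under eq_integral do rewrite EFinM.
rewrite ge0_integralZl//; last by apply/measurable_EFinP; exact: measurable_indic.
rewrite integral_indic// setIT EFinM lee_pmul//.
by have := rVlebesgue_ballN M; rewrite ger0_norm.
Qed.

Lemma Int_dominated (F : nat -> 'rV[R]_n -> R) f g :
  (forall k, bcs (F k)) -> measurable_fun setT f -> bcs g ->
  (forall k x, `|F k x| <= g x) -> (forall x, F k x @[k --> \oo] --> f x) ->
  Int (F k) @[k --> \oo] --> Int f.
Proof.
move=> bF mf bg Fg Ff.
have [] := @dominated_convergence _ _ _ leb _ measurableT (fun k => EFin \o F k) (EFin \o f) (EFin \o g).
- by move=> k; have [mF _ _] := bF k; exact/measurable_EFinP.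
- exact/measurable_EFinP.
- by apply: aeW => x _; apply: cvg_EFin; [exact: nearW|exact: Ff].
- exact: bcs_integrable.
- by apply: aeW => x k _; rewrite lee_fin.
move=> intf _ H; rewrite /Int; apply: fine_cvg.
by rewrite fineK//; exact: integrable_fin_num.
Qed.

Lemma derive_csupp f v : csupp f -> csupp ('D_v f).
Proof.
move=> [M fM]; exists M => x xM.
have -> : 'D_v f x = 'D_v (cst 0 : 'rV[R]_n -> R) x; last exact: derive_cst.
apply: near_eq_derive.
have : \forall y \near x, M < `|y|.
  by have /cvgr_gt := @norm_continuous _ _ x; apply.
by apply: filterS => y /fM.
Qed.

(** By translation invariance every difference quotient has integral zero. The mean value theorem
    bounds the quotients uniformly, with supports in a fixed ball, and dominated convergence gives
    the derivative. All later integrations by parts rest on this. *)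
Lemma Int_derive0 f v : (forall x, differentiable f x) -> continuous ('D_v f) -> csupp f ->
  Int ('D_v f) = 0.
Proof.
move=> df cDf sf.
have cf : continuous f by move=> x; exact: differentiable_continuous.
have bf := bcs_continuous cf sf.
have sDf := derive_csupp v sf.
have bDf := bcs_continuous cDf sDf.
have [C DC] := continuous_csupp_bounded cDf sDf.
pose t (k : nat) : R := k.+1%:R^-1.
have t0 k : 0 < t k by rewrite invr_gt0.
pose F k x := (t k)^-1 * (f (x + t k *: v) - f x).
have F0 k : Int (F k) = 0.
  rewrite /F IntZ; last by apply: bcs_sub => //; exact: bcs_shift.
  rewrite IntB//; last exact: bcs_shift.
  by rewrite Int_shift// subrr mulr0.
have [M fM] := sf.
have FC k x : `|F k x| <= `|C| * \1_[set x | `|x| <= M + `|v|] x.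
  have [xM|xM] := leP `|x| (M + `|v|).
    rewrite indicE mem_set//= mulr1 /F.
    have [c _ ->] := line_MVT x v df (t0 k).
    by rewrite mulKf ?gt_eqF// (le_trans (DC _))// ler_norm.
  rewrite /F fM; last first.
    rewrite -(ltrD2r `|v|); apply: (lt_le_trans xM).
    rewrite -[in leLHS](addrK (t k *: v) x) (le_trans (ler_normB _ _))// lerD2l.
    by rewrite normrZ ger0_norm ?(ltW (t0 k))// ler_piMl// invf_le1// ler1n.
  rewrite fM ?subr0 ?mulr0 ?normr0 ?mulr_ge0//.
  by apply: le_lt_trans xM; rewrite lerDl.
have bG : bcs (fun x => `|C| * \1_[set x : 'rV[R]_n | `|x| <= M + `|v|] x).
  apply: bcs_scale; split; first by apply: measurable_indic; exact: measurable_rV_ballN.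
    by exists 1 => x; rewrite indicE; case: (_ \in _); rewrite ?normr1 ?normr0.
  by exists (M + `|v|) => x xM; rewrite indicE memNset//= => /le_lt_trans /(_ xM); rewrite ltxx.
have bF k : bcs (F k).
  by apply: bcs_scale; apply: bcs_sub => //; exact: bcs_shift.
have tcvg : t k @[k --> \oo] --> 0^'.
  move=> A /= A0; have := @cvg_harmonic R _ A0.
  move=> H; have {}H : \forall k \near \oo, harmonic k != 0 :> R -> A (harmonic k) by [].
  have : \forall k \near \oo, A (t k) by move: H; apply: filterS => k; apply; rewrite gt_eqF.
  by [].
have Fcvg x : F k x @[k --> \oo] --> 'D_v f x.
  have := @diff_derivable _ _ _ f x v (df x).
  rewrite /derivable => /cvg_ex[l Hl].
  have -> : 'D_v f x = l by apply: cvg_lim Hl.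
  move=> A HA; have H := tcvg _ (Hl _ HA).
  have {}H : \forall k \near \oo, A ((t k)^-1 *: (f (t k *: v + x) - f x)) by [].
  have : \forall k \near \oo, A (F k x).
    by move: H; apply: filterS => k; rewrite /F (addrC x).
  by [].
have := Int_dominated bF (continuous_rV_measurable cDf) bG FC Fcvg.
rewrite (_ : (fun k => Int (F k)) = (fun=> 0)); last exact/funext.
by move=> H; apply/esym; apply: (cvg_unique _ (cvg_cst 0) H).
Qed.

End bounded_compact_support.

(** Dividing by [C + 1] instead of [C] covers the case [C = 0]. *)
Lemma mul_div_succ_le (R : realFieldType) (C e : R) : 0 <= C -> 0 < e ->
  C * (e / (C + 1)) <= e.
Proof.
move=> C0 e0; rewrite mulrA ler_pdivrMr ?ltr_wpDl//.
by rewrite mulrDr mulr1 (mulrC C) lerDl ltW.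
Qed.

(** * Mollification *)

Section bump.
Variable R : realType.
Implicit Types (P : {poly R}) (x : R).

(* The functions [P(1/x) exp(-1/x)] on [x > 0] are closed under differentiation, hence all smooth. *)
Definition bumpP P x : R := if 0 < x then P.[x^-1] * expR (- x^-1) else 0.

(** A quadratic bound at the origin forces the derivative there to be zero. Each monomial of degree
    [i] in [x^-1] is beaten by the term of order [i + 2] in the series of [expR (x^-1)]. *)
Lemma bumpP_bound P : exists2 C, 0 <= C & forall x, `|bumpP P x| <= C * x ^+ 2.
Proof.
exists (\sum_(i < size P) `|P`_i| * (i.+2)`!%:R).
  by apply: sumr_ge0 => i _; rewrite mulr_ge0.
move=> x; rewrite /bumpP; case: ifPn => [x0|_]; last first.
  by rewrite normr0 mulr_ge0 ?sqr_ge0//; apply: sumr_ge0 => i _; rewrite mulr_ge0.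
have y0 : 0 < x^-1 by rewrite invr_gt0.
rewrite horner_coef mulr_suml mulr_suml (le_trans (ler_norm_sum _ _ _))//.
apply: ler_sum => i _; rewrite !normrM (ger0_norm (expR_ge0 _)) -!mulrA ler_wpM2l//.
rewrite (ger0_norm (exprn_ge0 _ (ltW y0))) expRN ler_pdivrMr ?expR_gt0//.
have := @expR_ge1Dxn R x^-1 i.+1 (ltW y0).
move=> /(le_trans (lerD (@ler01 R) (lexx _))); rewrite add0r => h.
have -> : x^-1 ^+ i = x ^+ 2 * (x^-1 ^+ i.+2).
  by rewrite (_ : i.+2 = (i + 2)%N); [rewrite exprD mulrCA -exprMn divff ?gt_eqF// expr1n mulr1|rewrite addn2].
have -> : (i.+2)`!%:R * x ^+ 2 * expR x^-1 = x ^+ 2 * ((i.+2)`!%:R * expR x^-1) by ring.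
apply: ler_wpM2l; first exact: sqr_ge0.
by rewrite (mulrC _`!%:R) -ler_pdivrMr ?ltr0n ?fact_gt0//.
Qed.

(** With [y = x^-1] one has [y' = - y^2], so [P(y) exp(-y)] has derivative
    [y^2 (P - P')(y) exp(-y)]. At the origin the quadratic bound applies. *)
Lemma is_derive_bumpP P x : is_derive x 1 (bumpP P) (bumpP ('X^2 * (P - P^`())) x).
Proof.
have [x0|x0|->] := ltgtP x 0.
- have E : bumpP ('X^2 * (P - P^`())) x = 0 by rewrite /bumpP ltNge ltW.
  rewrite E; apply: (@near_eq_is_derive _ _ _ (cst 0)).
  near=> y; rewrite /bumpP /= ltNge ltW//; near: y.
  exact: lt_nbhsl.
- have xn0 : x != 0 by rewrite gt_eqF.
  have di : is_derive x 1 (@GRing.inv R) (- x^-1 ^+ 2).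
    split; first exact: (@derivableV _ _ id).
    by rewrite (@deriveV _ _ id)// derive_id /GRing.scale/= mulr1 exprVn.
  have dn : is_derive x 1 (fun y : R => - y^-1) (x^-1 ^+ 2).
    by apply: is_derive_eq; rewrite opprK.
  have de : is_derive x 1 (fun y : R => expR (- y^-1)) (x^-1 ^+ 2 * expR (- x^-1)).
    by rewrite mulrC; apply: (@is_derive1_comp _ expR (fun y => - y^-1)).
  have dp : is_derive x 1 (fun y : R => P.[y^-1]) (- x^-1 ^+ 2 * P^`().[x^-1]).
    by rewrite mulrC; apply: (@is_derive1_comp _ (horner P) (@GRing.inv R)).
  have dm := @is_deriveM _ _ _ _ _ _ _ _ dp de.
  have -> : bumpP ('X^2 * (P - P^`())) x =
     P.[x^-1] *: (x^-1 ^+ 2 * expR (- x^-1)) + expR (- x^-1) *: (- x^-1 ^+ 2 * P^`().[x^-1]).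
    by rewrite /bumpP x0 !hornerE /GRing.scale/=; ring.
  apply: near_eq_is_derive dm.
  near=> y; rewrite /bumpP ifT//=.
  by near: y; exact: lt_nbhsr.
- have -> : bumpP ('X^2 * (P - P^`())) 0 = 0 by rewrite /bumpP ltxx.
  have [C C0 PC] := bumpP_bound P.
  have H : h^-1 *: ((bumpP P \o shift 0) (h *: 1) - bumpP P 0) @[h --> 0^'] --> 0.
    apply/cvgrPdist_le => e e0; near=> h.
    have h0 : h != 0 by near: h; exact: nbhs_dnbhs_neq.
    rewrite sub0r normrN /= addr0 [h *: 1]mulr1 [bumpP P 0]/bumpP ltxx subr0 normrZ normfV.
    rewrite mulrC ler_pdivrMr ?normr_gt0//.
    apply: (le_trans (PC h)).
    rewrite -[h ^+ 2]ger0_norm ?sqr_ge0// normrX expr2 mulrA ler_pM2r ?normr_gt0//.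
    apply: (@le_trans _ _ (C * (e / (C + 1)))).
      rewrite ler_wpM2l// ltW//; near: h.
      apply: dnbhs0_lt; rewrite divr_gt0// ltr_wpDl//.
    exact: mul_div_succ_le.
  split; first by apply/cvg_ex; exists 0.
  exact: cvg_lim H.
Unshelve. all: by end_near. Qed.

Definition ebump : R -> R := bumpP 1.

Lemma bumpE x : 0 < x -> ebump x = expR (- x^-1).
Proof. by move=> x0; rewrite /ebump /bumpP x0 hornerC mul1r. Qed.

Lemma bump_ge0 x : 0 <= ebump x.
Proof. by rewrite /ebump /bumpP; case: ifP => // _; rewrite hornerC mul1r expR_ge0. Qed.

Lemma bump_gt0 x : 0 < x -> 0 < ebump x.
Proof. by move=> x0; rewrite bumpE// expR_gt0. Qed.

Lemma bump_le0 x : x <= 0 -> ebump x = 0.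
Proof. by move=> x0; rewrite /ebump /bumpP ltNge x0. Qed.

Fixpoint bump_iter (m : nat) : {poly R} :=
  if m is m'.+1 then 'X^2 * (bump_iter m' - (bump_iter m')^`()) else 1.

Lemma smooth_bump n (f : 'rV[R]_n -> R) : smooth f -> smooth (fun y => ebump (f y)).
Proof.
move=> sf; apply: (@smooth_comp _ _ f (fun m => bumpP (bump_iter m)) 0%N) => // m t.
exact: is_derive_bumpP.
Qed.

End bump.

Section affine.
Variables (R : realType) (n : nat).
Implicit Types (f g : 'rV[R]_n -> R) (x v : 'rV[R]_n).

Lemma derive_scale f x v (c : R) : differentiable f x ->
  'D_(c *: v) f x = c * 'D_v f x.
Proof.
move=> df; rewrite (deriveE _ df) (deriveE _ df).
by rewrite linearZ.
Qed.

Lemma derive_affine f (a : 'rV[R]_n) (c : R) y v :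
  (forall x, differentiable f x) ->
  differentiable (fun y => f (a + c *: y)) y /\
  'D_v (fun y => f (a + c *: y)) y = c * 'D_v f (a + c *: y).
Proof.
move=> df; split.
  apply: (@differentiable_comp _ _ _ _ (fun y => a + c *: y) f); last exact: df.
  by apply: differentiableD => //; exact: differentiableZ.
rewrite -derive_scale// /derive.
have -> : (fun h : R => h^-1 *: (((fun y => f (a + c *: y)) \o shift y) (h *: v) - f (a + c *: y))) =
  (fun h : R => h^-1 *: ((f \o shift (a + c *: y)) (h *: (c *: v)) - f (a + c *: y))).
  by apply/funext => h /=; congr (_ *: (f _ - _)); rewrite scalerDr !scalerA (mulrC c) addrCA.
by [].
Qed.

Lemma smooth_affine f (a : 'rV[R]_n) (c : R) : smooth f -> smooth (fun y => f (a + c *: y)).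
Proof.
move=> sf k; elim: k f sf => [|k ih] f sf.
  by split => // x; have [] := derive_affine a c x 0 (smooth_diff sf).
apply/smkSP; split => [x|v]; first by have [] := derive_affine a c x 0 (smooth_diff sf).
rewrite (_ : 'D_v _ = (fun y => c * 'D_v f (a + c *: y))).
  by apply: smk_mul; [exact: smk_cst|apply: (ih ('D_v f)); exact: smooth_D].
by apply/funext => x; have [] := derive_affine a c x v (smooth_diff sf).
Qed.

Lemma derive_coord f x v : differentiable f x ->
  'D_v f x = \sum_(i < n) v ord0 i * 'D_(evec R i) f x.
Proof.
move=> df; rewrite [in LHS](row_sum_delta v) (deriveE _ df).
rewrite linear_sum; apply: eq_bigr => i _.
by rewrite (deriveE _ df) linearZ.
Qed.

Lemma derive_linear f x v w (c : R) : differentiable f x ->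
  'D_(c *: v + w) f x = c * 'D_v f x + 'D_w f x.
Proof.
move=> df; rewrite !(deriveE _ df) linearP.
by [].
Qed.

(** The l^1 norm of the gradient, dual to the sup norm carried by row vectors. *)
Definition gradB f x := \sum_(i < n) `|'D_(evec R i) f x|.

Lemma derive_le_grad f x v : differentiable f x -> `|'D_v f x| <= `|v| * gradB f x.
Proof.
move=> df; rewrite derive_coord// (le_trans (ler_norm_sum _ _ _))// mulr_sumr.
by apply: ler_sum => i _; rewrite normrM ler_wpM2r// rV_coord_le.
Qed.

Lemma smooth_lipschitz_bound f : smooth f -> csupp f ->
  exists2 C, 0 <= C & forall x v, `|'D_v f x| <= C * `|v|.
Proof.
move=> sf cf.
have /choice[C hC] : forall i : 'I_n, exists C, forall x, `|'D_(evec R i) f x| <= C.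
  move=> i; apply: continuous_csupp_bounded; last exact: derive_csupp.
  exact/smooth_continuous/smooth_D.
exists (\sum_(i < n) `|C i|); first by apply: sumr_ge0.
move=> x v; rewrite (le_trans (derive_le_grad _ (smooth_diff sf x)))// mulrC ler_wpM2r//.
by apply: ler_sum => i _; rewrite (le_trans (hC _ _))// ler_norm.
Qed.

(** Two mean value steps reduce the remainder to a multiple at most 1 of a second derivative in the
    direction [h]. Compact support makes the constant independent of [z], as differentiation under
    the integral requires. *)
Lemma smooth_taylor2 f : smooth f -> csupp f ->
  exists2 C, 0 <= C & forall z h, `|f (z + h) - f z - 'D_h f z| <= C * `|h| ^+ 2.
Proof.
move=> sf cf.
have /choice[C hC] : forall i : 'I_n, exists C, 0 <= C /\
    forall x v, `|'D_v ('D_(evec R i) f) x| <= C * `|v|.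
  move=> i; have [] := @smooth_lipschitz_bound ('D_(evec R i) f).
  - exact: smooth_D.
  - exact: derive_csupp.
  by move=> C C0 H; exists C.
exists (\sum_(i < n) C i); first by apply: sumr_ge0 => i _; have [] := hC i.
move=> z h.
have [c /andP[c0 c1]] := line_MVT z h (smooth_diff sf) ltr01.
rewrite scale1r mul1r => ->.
have sDf := smooth_D h sf.
have [d _ ->] := line_MVT z h (smooth_diff sDf) c0.
rewrite normrM (gtr0_norm c0).
apply: (@le_trans _ _ `|'D_h ('D_h f) (z + d *: h)|).
  by rewrite ler_piMl// ltW.
apply: (le_trans (derive_le_grad _ (smooth_diff sDf _))).
rewrite expr2 mulrCA ler_wpM2l// mulr_suml; apply: ler_sum => i _.
by rewrite smooth_derive_comm//; have [_] := hC i; exact.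
Qed.

End affine.

(** * Smoothness and derivatives of convolutions *)

Section convolution.
Variables (R : realType) (n : nat).
Implicit Types (f g r : 'rV[R]_n -> R) (x v : 'rV[R]_n).

Definition convol f r x := Int (fun y => f y * r (x - y)).

Lemma smooth_refl r x : smooth r -> smooth (fun y => r (x - y)).
Proof.
move=> sr; have := smooth_affine x (-1) sr.
by rewrite (_ : (fun y => r (x + -1 *: y)) = (fun y => r (x - y)))//; apply/funext => y; rewrite scaleN1r.
Qed.

Lemma derive_refl r x v y : smooth r -> 'D_v (fun y => r (x - y)) y = - 'D_v r (x - y).
Proof.
move=> sr; have [_] := derive_affine x (-1) y v (smooth_diff sr).
rewrite scaleN1r mulN1r => <-.
rewrite (_ : (fun y => r (x - y)) = (fun y => r (x + -1 *: y)))//.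
by apply/funext => z; rewrite scaleN1r.
Qed.

Lemma csupp_refl r x : csupp r -> csupp (fun y => r (x - y)).
Proof.
move=> [M rM]; exists (M + `|x|) => y yM; apply: rM.
rewrite -(ltrD2r `|x|); apply: (lt_le_trans yM).
have -> : y = x - (x - y) by rewrite subKr.
by rewrite (le_trans (ler_normB _ _))// addrC lerD2r subKr.
Qed.

Lemma convol_bcs f r x : bcs f -> continuous r -> bcs (fun y => f y * r (x - y)).
Proof.
move=> bf cr; apply: bcs_mul_continuous => // y.
have : {for y, continuous (r \o (fun z : 'rV[R]_n => x - z))}; last by [].
apply: continuous_comp; last exact: cr.
apply: continuousB; [exact: cst_continuous|exact: cvg_id].
Qed.

(** The candidate differential integrates [f y] against ['D_v r (x - y)]. The uniform Taylor bound
    on [r] leaves a remainder of order [|h|^2] times the integral of [|f|], so no regularity of [f]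
    enters. *)
Lemma convol_derive f r x v : bcs f -> smooth r -> csupp r ->
  differentiable (convol f r) x /\ 'D_v (convol f r) x = convol f ('D_v r) x.
Proof.
move=> bf sr cr.
pose L v := Int (fun y => f y * 'D_v r (x - y)).
have bD w : bcs (fun y => f y * 'D_w r (x - y)).
  by apply: (@convol_bcs f ('D_w r)) => //; exact/smooth_continuous/smooth_D.
have lL : linear L.
  move=> c v1 v2; rewrite /L.
  rewrite (_ : (fun y => f y * 'D_(c *: v1 + v2) r (x - y)) =
    (fun y => c * (f y * 'D_v1 r (x - y)) + f y * 'D_v2 r (x - y))).
    by rewrite IntD ?IntZ//; exact: bcs_scale.
  apply/funext => y; rewrite derive_linear; last exact: smooth_diff.
  by rewrite mulrDr mulrCA.
pose Ll : {linear 'rV[R]_n -> R} := HB.pack L (GRing.isLinear.Build _ _ _ _ _ lL).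
have cL : continuous L.
  rewrite (_ : L = fun v => \sum_(i < n) v ord0 i * L (evec R i)); last first.
    apply/funext => w; rewrite -[L]/(Ll : _ -> _) {1}(row_sum_delta w) linear_sum.
    by apply: eq_bigr => i _; rewrite linearZ.
  apply: smooth_continuous; apply: smooth_sum => i.
  by apply: smooth_mul; [exact: smooth_rVcoord|exact: smooth_cst].
have [C C0 hC] := smooth_taylor2 sr cr.
have := @diff_unique _ _ _ (convol f r) Ll x cL.
set lo := (X in (X -> _) -> _) => dE0.
have Hlo : lo.
  rewrite /lo; apply/eqaddoP => e e0.
  pose I := Int (fun y => `|f y|).
  have I0 : 0 <= I by apply: Int_ge0 => y.
  have H : \forall y \near (0 : 'rV[R]_n), `|y| < e / (C * I + 1).
    by apply: nbhs0_lt; rewrite divr_gt0// ltr_wpDl// mulr_ge0.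
  near=> h.
  have -> : (convol f r \o shift x - (cst (convol f r x) + L)) h =
    convol f r (x + h) - convol f r x - L h.
    have -> : (convol f r \o shift x - (cst (convol f r x) + L)) h =
      convol f r (h + x) - (convol f r x + L h) by [].
    by rewrite opprD addrA (addrC h x).
  have br z : bcs (fun y => f y * r (z - y)).
    by apply: convol_bcs => //; exact: smooth_continuous.
  rewrite /convol /L -!IntB//; last by apply: bcs_sub.
  apply: (le_trans (Int_norm _)); first by apply: bcs_sub => //; exact: bcs_sub.
  apply: (@le_trans _ _ (Int (fun y => (C * `|h| ^+ 2) * `|f y|))).
    apply: Int_le.
    - by apply: bcs_norm; apply: bcs_sub => //; exact: bcs_sub.
    - by apply: bcs_scale; exact: bcs_norm.
    move=> y; rewrite -!mulrBr normrM mulrC ler_wpM2r//.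
    have -> : x + h - y = x - y + h by rewrite addrAC.
    exact: hC.
  rewrite IntZ; last exact: bcs_norm.
  rewrite expr2 mulrAC mulrA -[leLHS]mulrA mulrC -/I.
  have -> : `|h| * `|h| * (C * I) = (C * I * `|h|) * `|h| by ring.
  rewrite ler_wpM2r//.
  apply: (@le_trans _ _ (C * I * (e / (C * I + 1)))).
    rewrite ler_wpM2l ?mulr_ge0// ltW//; near: h.
    exact: H.
  by apply: mul_div_succ_le => //; exact: mulr_ge0.
have dE := dE0 Hlo.
have df : differentiable (convol f r) x by apply/diff_locallyP; rewrite dE.
by split => //; rewrite (deriveE _ df) dE.
Unshelve. all: by end_near. Qed.

Lemma convol_smooth f r : bcs f -> smooth r -> csupp r -> smooth (convol f r).
Proof.
move=> bf sr cr k; elim: k r sr cr => [|k ih] r sr cr.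
  by split => // x; have [] := convol_derive x 0 bf sr cr.
apply/smkSP; split => [x|v]; first by have [] := convol_derive x 0 bf sr cr.
rewrite (_ : 'D_v _ = convol f ('D_v r)).
  by apply: ih; [exact: smooth_D|exact: derive_csupp].
by apply/funext => x; have [] := convol_derive x v bf sr cr.
Qed.

Lemma convol_lap f r x : bcs f -> smooth r -> csupp r -> lap (convol f r) x = convol f (lap r) x.
Proof.
move=> bf sr cr; rewrite /lap.
have E i : 'D_(evec R i) ('D_(evec R i) (convol f r)) x =
    convol f ('D_(evec R i) ('D_(evec R i) r)) x.
  rewrite (_ : 'D_(evec R i) (convol f r) = convol f ('D_(evec R i) r)).
    have [_ ->//] := convol_derive x (evec R i) bf (smooth_D _ sr) (derive_csupp (evec R i) cr).
  by apply/funext => z; have [] := convol_derive z (evec R i) bf sr cr.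
rewrite (eq_bigr _ (fun i _ => E i)) /convol -Int_sum.
  by congr Int; apply/funext => y; rewrite mulr_sumr.
by move=> i; apply: (@convol_bcs f ('D_(evec R i) ('D_(evec R i) r))) => //; apply: smooth_continuous; do 2 apply: smooth_D.
Qed.

Lemma lap_refl r x y : smooth r -> lap (fun y => r (x - y)) y = lap r (x - y).
Proof.
move=> sr; rewrite /lap; apply: eq_bigr => i _.
rewrite (_ : 'D_(evec R i) (fun y => r (x - y)) = (fun y => -1 * 'D_(evec R i) r (x - y))).
  rewrite derive_mulE//; last first.
    by apply: smooth_diff; apply: (@smooth_refl ('D_(evec R i) r)); exact: smooth_D.
  by rewrite derive_cst mul0r addr0 (@derive_refl ('D_(evec R i) r)) ?mulN1r ?opprK//; exact: smooth_D.
by apply/funext => z; rewrite derive_refl// mulN1r.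
Qed.

End convolution.

Section mollifier.
Variables (R : realType) (n : nat).
Implicit Types (f g r w : 'rV[R]_n -> R) (x z : 'rV[R]_n).
Notation leb := (rVlebesgue R n).

(** Evenness allows [r (x - y)] to be read as a translate of [r] in the variable [y]. *)
Definition mollifier (d : R) r := [/\ smooth r, forall x, 0 <= r x, Int r = 1,
  forall x, r (- x) = r x & forall x, d <= `|x| -> r x = 0].

Lemma mollifier_csupp d r : mollifier d r -> csupp r.
Proof. by move=> [_ _ _ _ rd]; exists d => x /ltW /rd. Qed.

Lemma bump_half_ge (t : R) : 2^-1 <= t -> expR (-2) <= ebump t.
Proof.
move=> t2; have t0 : 0 < t by apply: lt_le_trans t2.
by rewrite bumpE// ler_expR lerN2 invf_ple ?posrE.
Qed.

(** A product of one-dimensional bumps in [x_i / d] is supported in a sup norm ball. Its integral is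
    positive because on the cube with sides [[0, d / 2]] both factors of every coordinate are at
    least [expR (-2)]. *)
Lemma mollifier_exists (d : R) : 0 < d -> exists r, mollifier d r.
Proof.
move=> d0.
pose p x := \prod_(i < n) (ebump (1 + d^-1 * x ord0 i) * ebump (1 - d^-1 * x ord0 i)).
have sp : smooth p.
  apply: smooth_prod => i; apply: smooth_mul; apply: smooth_bump.
    apply: smooth_add; first exact: smooth_cst.
    by apply: smooth_scale; exact: smooth_rVcoord.
  apply: smooth_sub; first exact: smooth_cst.
  by apply: smooth_scale; exact: smooth_rVcoord.
have p0 x : 0 <= p x by apply: prodr_ge0 => i _; rewrite mulr_ge0// bump_ge0.
have pd x : d <= `|x| -> p x = 0.
  move=> dx.
  have [i xi] : exists i, d <= `|x ord0 i|.
    apply: contrapT => /forallNP xd; move: dx; apply/negP; rewrite -ltNge.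
    rewrite [ltLHS]/Num.norm /= mx_normrE; apply/bigmax_ltP; split => //= -[j i] _ /=.
    by rewrite ord1 ltNge; exact/negP/xd.
  rewrite /p (bigD1 i)//=; move: xi; rewrite ler_normr => /orP[xi|xi].
    by rewrite (bump_le0 (x := 1 - _)) ?mulr0 ?mul0r// subr_le0 ler_pdivlMl// mulr1.
  have : 1 <= d^-1 * - x ord0 i by rewrite ler_pdivlMl// mulr1.
  by rewrite mulrN => xi'; rewrite (bump_le0 (x := 1 + _)) ?mul0r//; lra.
have cp : csupp p by exists d => x /ltW /pd.
have bp := bcs_continuous (smooth_continuous sp) cp.
pose c : R := (expR (-2) * expR (-2)) ^+ n.
have c0 : 0 < c by rewrite exprn_gt0// mulr_gt0// expR_gt0.
have d2 : 0 <= d / 2 by rewrite divr_ge0// ltW.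
pose A := [set x : 'rV[R]_n | forall i, (0 : 'rV[R]_n) ord0 i <= x ord0 i <= (0 : 'rV[R]_n) ord0 i + d / 2].
have mA : measurable A by exact: measurable_cube.
have Ip : 0 < Int p.
  apply: (@lt_le_trans _ _ (c * (d / 2) ^+ n)).
    by rewrite mulr_gt0// exprn_gt0// divr_gt0.
  rewrite -lee_fin EFin_Int//.
  apply: (@le_trans _ _ (\int[leb]_x (c%:E * (\1_A x)%:E))%E).
    rewrite ge0_integralZl//; last by rewrite lee_fin ltW.
      have -> : (\int[leb]_x (\1_A x)%:E = ((d / 2) ^+ n)%:E)%E.
        by rewrite integral_indic// setIT; exact: (rVlebesgue_cube (0 : 'rV[R]_n) d2).
      by [].
    by apply/measurable_EFinP; exact: measurable_indic.
  apply: ge0_le_integral => //=.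
  - by move=> x _; rewrite -EFinM lee_fin mulr_ge0// ltW.
  - by apply: measurable_funeM; apply/measurable_EFinP; exact: measurable_indic.
  - by apply/measurable_EFinP; case: bp.
  move=> x _; rewrite -EFinM lee_fin indicE.
  have [xA|xA] := boolP (_ \in _); last by rewrite mulr0.
  rewrite mulr1 /c /p -[n in X in X <= _](card_ord n) -prodr_const.
  apply: ler_prod => i _; rewrite mulr_ge0 ?expR_ge0//=.
  move: (set_mem xA) => /(_ i); rewrite mxE add0r => /andP[x0 xd].
  have dx0 : 0 <= d^-1 * x ord0 i by rewrite mulr_ge0// invr_ge0 ltW.
  have dx1 : d^-1 * x ord0 i <= 2^-1 by rewrite ler_pdivrMl.
  by apply: ler_pM; rewrite ?expR_ge0// bump_half_ge//; lra.
exists (fun x => (Int p)^-1 * p x); split.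
- exact: smooth_scale.
- by move=> x; rewrite mulr_ge0// invr_ge0 ltW.
- by rewrite IntZ// mulVf// gt_eqF.
- move=> x; congr (_ * _); apply: eq_bigr => i _.
  by rewrite mxE !mulrN opprK mulrC.
- by move=> x /pd ->; rewrite mulr0.
Qed.

End mollifier.

Section clamp.
Variable R : realType.

(** Truncation of [t] to the interval from 0 to 1, written with absolute values so that continuity
    is inherited from the norm. *)
Definition clamp (t : R) : R := (`|t| - `|t - 1| + 1) / 2.

Lemma clamp01 t : 0 <= clamp t <= 1.
Proof.
rewrite /clamp; have := ler_normB t 1; have := ler_normB (t - 1) t.
rewrite normr1 (_ : t - 1 - t = -1) ?normrN ?normr1; last by ring.
have := ler_distD t (t - 1) 0; have := ler_distD (t - 1) t 0.
rewrite !subr0 opprB addrCA subrr addr0 normr1 (_ : t - 1 - t = -1) ?normrN ?normr1; last by ring.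
by move=> *; apply/andP; split; lra.
Qed.

Lemma clamp_le0 t : t <= 0 -> clamp t = 0.
Proof. by move=> t0; rewrite /clamp !ler0_norm//; lra. Qed.

Lemma clamp_ge1 t : 1 <= t -> clamp t = 1.
Proof. by move=> t1; rewrite /clamp !ger0_norm//; lra. Qed.

Lemma clamp_cvg (T : Type) (F : set_system T) (FF : Filter F) (f : T -> R) (l : R) :
  f @ F --> l -> clamp (f x) @[x --> F] --> clamp l.
Proof.
move=> fl; apply: cvgM; last exact: cvg_cst.
apply: cvgD; last exact: cvg_cst.
apply: cvgB; apply: cvg_norm => //; apply: cvgB => //; exact: cvg_cst.
Qed.

Lemma continuous_clamp n (f : 'rV[R]_n -> R) :
  continuous f -> continuous (fun x => clamp (f x)).
Proof. by move=> cf x; apply: (@clamp_cvg _ (nbhs x) _ f (f x)); exact: cf. Qed.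

Lemma continuous_mulr n (f g : 'rV[R]_n -> R) :
  continuous f -> continuous g -> continuous (fun x => f x * g x).
Proof. by move=> cf cg x; exact: (cvgM (cf x) (cg x)). Qed.

End clamp.

(** * Continuity of translations in L^1 and convergence of mollifications *)

Section translation_continuity.
Import finmap.finmap HBSimple.
Variables (R : realType) (n : nat).
Implicit Types (f g r w : 'rV[R]_n -> R) (x z : 'rV[R]_n).
Notation leb := (rVlebesgue R n).

Definition L1_translation_continuous f := forall e, 0 < e -> exists2 d, 0 < d &
  forall z, `|z| < d -> Int (fun x => `|f (x + z) - f x|) <= e.

Lemma bcs_tr f z : bcs f -> bcs (fun x => `|f (x + z) - f x|).
Proof. by move=> bf; apply: bcs_norm; apply: bcs_sub => //; exact: bcs_shift. Qed.

Lemma Int0 : Int ((fun=> 0) : 'rV[R]_n -> R) = 0.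
Proof. by rewrite /Int Rintegral_cst// mul0r. Qed.

Lemma tc_approx f : bcs f ->
  (forall e, 0 < e -> exists g, [/\ bcs g, L1_translation_continuous g & Int (fun x => `|f x - g x|) <= e]) -> L1_translation_continuous f.
Proof.
move=> bf fg e e0; have e3 : 0 < e / 3 by rewrite divr_gt0.
have [g [bg tg fge]] := fg _ e3.
have [d d0 dg] := tg _ e3; exists d => // z zd.
have bfg : bcs (fun x => `|f x - g x|) by apply: bcs_norm; exact: bcs_sub.
have bfgz := bcs_shift z bfg.
apply: (@le_trans _ _ (Int (fun x => (`|f (x + z) - g (x + z)| + `|f x - g x|) + `|g (x + z) - g x|))).
  apply: Int_le; [exact: bcs_tr| |].
    by apply: bcs_add; [exact: bcs_add|exact: bcs_tr].
  move=> x.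
  have -> : f (x + z) - f x = (f (x + z) - g (x + z)) - (f x - g x) + (g (x + z) - g x) by ring.
  by rewrite (le_trans (ler_normD _ _))// lerD2r ler_normB.
rewrite IntD; [|exact: bcs_add|exact: bcs_tr].
rewrite IntD// (Int_shift z bfg); have := dg _ zd; lra.
Qed.

Lemma tc_add f g : bcs f -> bcs g -> L1_translation_continuous f -> L1_translation_continuous g -> L1_translation_continuous (fun x => f x + g x).
Proof.
move=> bf bg tf tg e e0; have e2 : 0 < e / 2 by rewrite divr_gt0.
have [d1 d10 h1] := tf _ e2; have [d2 d20 h2] := tg _ e2.
exists (Num.min d1 d2); first by rewrite lt_min d10.
move=> z; rewrite lt_min => /andP[z1 z2].
apply: (@le_trans _ _ (Int (fun x => `|f (x + z) - f x| + `|g (x + z) - g x|))).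
  apply: Int_le.
  - by apply: (bcs_tr (f := fun x => f x + g x)); exact: bcs_add.
  - by apply: bcs_add; exact: bcs_tr.
  by move=> x; rewrite opprD addrACA ler_normD.
rewrite IntD; [|exact: bcs_tr..].
by rewrite [leRHS]splitr lerD// ?h1// h2.
Qed.

Lemma tc_scale (c : R) f : bcs f -> L1_translation_continuous f -> L1_translation_continuous (fun x => c * f x).
Proof.
move=> bf tf e e0.
have e2 : 0 < e / (`|c| + 1) by rewrite divr_gt0// ltr_wpDl.
have [d d0 hd] := tf _ e2; exists d => // z zd.
have -> : (fun x => `|c * f (x + z) - c * f x|) = (fun x => `|c| * `|f (x + z) - f x|).
  by apply/funext => x; rewrite -mulrBr normrM.
rewrite IntZ; last exact: bcs_tr.
apply: le_trans (mul_div_succ_le (normr_ge0 c) e0).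
by rewrite ler_wpM2l// hd.
Qed.

Lemma tc0 : L1_translation_continuous (fun=> 0).
Proof.
move=> e e0; exists 1 => // z _.
rewrite (_ : (fun _ => _) = (fun=> 0 * 0)); last by apply/funext => x; rewrite subrr normr0 mulr0.
by rewrite IntZ ?mul0r ?ltW//; exact: bcs0.
Qed.

Lemma tc_sum (I : Type) (s : seq I) (F : I -> 'rV[R]_n -> R) :
  (forall i, bcs (F i)) -> (forall i, L1_translation_continuous (F i)) -> L1_translation_continuous (fun x => \sum_(i <- s) F i x).
Proof.
move=> bF tF; elim: s => [|i s ih].
  by rewrite (_ : (fun _ => _) = (fun=> 0)); [exact: tc0|apply/funext => x; rewrite big_nil].
rewrite (_ : (fun _ => _) = (fun x => F i x + \sum_(i <- s) F i x)).
  by apply: tc_add => //; exact: bcs_sum.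
by apply/funext => x; rewrite big_cons.
Qed.

Lemma tc_dominated (F : nat -> 'rV[R]_n -> R) f g :
  (forall k, bcs (F k)) -> (forall k, L1_translation_continuous (F k)) -> bcs f -> bcs g ->
  (forall k x, `|F k x| <= g x) -> (forall x, F k x @[k --> \oo] --> f x) -> L1_translation_continuous f.
Proof.
move=> bF tF bf bg Fg Ff; apply: tc_approx => // e e0.
have bD k : bcs (fun x => `|f x - F k x|) by apply: bcs_norm; exact: bcs_sub.
have H1 k x : `|(`|f x - F k x|)| <= `|f x| + g x.
  by rewrite normr_id (le_trans (ler_normB _ _))// lerD2l.
have H2 x : `|f x - F k x| @[k --> \oo] --> (0 : R).
  rewrite -[X in _ --> X](normr0 R) -(subrr (f x)); apply: cvg_norm.
  by apply: cvgB; [exact: cvg_cst|exact: Ff].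
have m0 : measurable_fun setT ((fun=> 0) : 'rV[R]_n -> R) by exact: measurable_cst.
have := Int_dominated bD m0 (bcs_add (bcs_norm bf) bg) H1 H2.
rewrite Int0 => H; have : \forall k \near \oo, Int (fun x => `|f x - F k x|) < e.
  by move/cvgr_lt : H; apply.
move=> [k _ /(_ k (leqnn k)) /= He]; exists (F k); split => //; exact: ltW.
Qed.

(** Translations [z k] tending to 0 along which the L^1 error stays above [e] would contradict
    dominated convergence, since the integrand tends to 0 pointwise. *)
Lemma tc_continuous f : continuous f -> csupp f -> L1_translation_continuous f.
Proof.
move=> cf sf; have bf := bcs_continuous cf sf.
apply: contrapT => /existsNP[e /not_implyP[e0 ne]].
have /choice[z zP] : forall k : nat, exists z, `|z| < k.+1%:R^-1 /\
    e < Int (fun x => `|f (x + z) - f x|).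
  move=> k; apply: contrapT => /forallNP H; apply: ne.
  exists k.+1%:R^-1; first by rewrite invr_gt0.
  by move=> z zk; rewrite leNgt; apply/negP => Hz; apply: (H z).
have [C fC] := continuous_csupp_bounded cf sf.
have [M fM] := sf.
have zcvg : z k @[k --> \oo] --> (0 : 'rV[R]_n).
  apply/cvgrPdist_lt => d d0.
  have [N _ HN] := near_infty_natSinv_lt (PosNum d0).
  exists N => // k Nk /=; rewrite sub0r normrN.
  by apply: lt_trans (HN _ Nk); have [] := zP k.
have bG : bcs (fun x => (2 * `|C|) * \1_[set x : 'rV[R]_n | `|x| <= M + 1] x).
  apply: bcs_scale; split; first by apply: measurable_indic; exact: measurable_rV_ballN.
    by exists 1 => x; rewrite indicE; case: (_ \in _); rewrite ?normr1 ?normr0.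
  by exists (M + 1) => x xM; rewrite indicE memNset//= => /le_lt_trans /(_ xM); rewrite ltxx.
have H1 k x : `|(`|f (x + z k) - f x|)| <= (2 * `|C|) * \1_[set x : 'rV[R]_n | `|x| <= M + 1] x.
  rewrite normr_id indicE.
  have [xM|xM] := leP `|x| (M + 1).
    rewrite mem_set//= mulr1 (le_trans (ler_normB _ _))// mulr_natl mulr2n.
    by rewrite lerD// (le_trans (fC _))// ler_norm.
  rewrite !fM ?subrr ?normr0 ?mulr_ge0//; first by apply: le_lt_trans xM; rewrite lerDl.
  have [zk _] := zP k.
  have zk1 : `|z k| < 1 by apply: (lt_le_trans zk); rewrite invf_le1// ler1n.
  rewrite -(ltrD2r 1); apply: (lt_le_trans xM).
  have -> : x = (x + z k) - z k by rewrite addrK.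
  by rewrite (le_trans (ler_normB _ _))// addrK lerD2l ltW.
have H2 x : `|f (x + z k) - f x| @[k --> \oo] --> (0 : R).
  rewrite -[X in _ --> X](normr0 R) -(subrr (f x)); apply: cvg_norm.
  apply: cvgB; last exact: cvg_cst.
  have xz : x + z k @[k --> \oo] --> x.
    by rewrite -[X in _ --> X]addr0; apply: cvgD => //; exact: cvg_cst.
  by move=> A HA; exact: (xz _ (cf x _ HA)).
have m0 : measurable_fun setT ((fun=> 0) : 'rV[R]_n -> R) by exact: measurable_cst.
have := Int_dominated (fun k => bcs_tr (z k) bf) m0 bG H1 H2.
rewrite Int0 => H; have : \forall k \near \oo, Int (fun x => `|f (x + z k) - f x|) < e.
  by move/cvgr_lt : H; apply.
move=> [k _ /(_ k (leqnn k)) /=].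
by have [_ /lt_trans h] := zP k => /h; rewrite ltxx.
Qed.

Lemma bcs_mul_bounded f g (C : R) : measurable_fun setT f -> (forall x, `|f x| <= C) ->
  bcs g -> bcs (fun x => f x * g x).
Proof.
move=> mf fC [mg [D gD] sg]; split; [exact: measurable_funM| |exact: csupp_mull].
by exists (C * D) => x; rewrite normrM ler_pM.
Qed.

Lemma bcs_indic_mul (A : set 'rV[R]_n) w : measurable A -> bcs w -> bcs (fun x => \1_A x * w x).
Proof.
move=> mA bw; apply: (@bcs_mul_bounded (\1_A) _ 1) => //.
by move=> x; rewrite indicE; case: (_ \in _); rewrite ?normr1 ?normr0.
Qed.

Section window.
Variable w : 'rV[R]_n -> R.
Hypotheses (cw : continuous w) (sw : csupp w) (w0 : forall x, 0 <= w x).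
Let bw := bcs_continuous cw sw.
Let tw := tc_continuous cw sw.

(** Good sets for a generation argument. The window [w] keeps the functions compactly supported, so
    that complements remain in the class and the good sets form a sigma-algebra. *)
Definition tcset (A : set 'rV[R]_n) := measurable A /\ L1_translation_continuous (fun x => \1_A x * w x).

Lemma tcset0 : tcset set0.
Proof.
split => //; rewrite (_ : (fun _ => _) = (fun=> 0)); first exact: tc0.
by apply/funext => x; rewrite indic0 mul0r.
Qed.

Lemma tcsetC A : tcset A -> tcset (~` A).
Proof.
move=> [mA tA]; split; first exact: measurableC.
rewrite (_ : (fun _ => _) = (fun x => w x + (-1) * (\1_A x * w x))).
  apply: tc_add => //; first by apply: bcs_scale; exact: bcs_indic_mul.
  by apply: tc_scale => //; exact: bcs_indic_mul.
by apply/funext => x; rewrite !indicE in_setC; case: (_ \in _) => /=; ring.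
Qed.

Lemma tcsetI A B : tcset A -> tcset B -> tcset (A `&` B).
Proof.
move=> [mA tA] [mB tB]; split; first exact: measurableI.
move=> e e0; have e3 : 0 < e / 3 by rewrite divr_gt0.
have [d1 d10 h1] := tA _ e3; have [d2 d20 h2] := tB _ e3; have [d3 d30 h3] := tw e3.
exists (Num.min d1 (Num.min d2 d3)); first by rewrite !lt_min d10 d20.
move=> z; rewrite !lt_min => /and3P[z1 z2 z3].
have bA := bcs_indic_mul mA bw; have bB := bcs_indic_mul mB bw.
apply: (@le_trans _ _ (Int (fun x => (`|\1_B (x + z) * w (x + z) - \1_B x * w x| +
    `|\1_A (x + z) * w (x + z) - \1_A x * w x|) + `|w (x + z) - w x|))).
  apply: Int_le.
  - apply: (bcs_tr (f := fun x => \1_(A `&` B) x * w x)).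
    by apply: bcs_indic_mul => //; exact: measurableI.
  - apply: bcs_add; last exact: bcs_tr.
    apply: bcs_add; first exact: (bcs_tr z bB).
    exact: (bcs_tr z bA).
  move=> x; rewrite !indicE !in_setI.
  have := w0 x; have := w0 (x + z).
  move: (w x) (w (x + z)) => p q q0 p0.
  (* Sixteen cases of membership, each a linear inequality between [p], [q] and [|q - p|]. *)
  case: (x \in A); case: (x \in B); case: (x + z \in A); case: (x + z \in B) => /=;
    rewrite ?mul1r ?mul0r ?subr0 ?sub0r ?normrN ?normr0 ?addr0 ?add0r ?(ger0_norm p0) ?(ger0_norm q0);
    have := normr_ge0 (q - p); have := ler_norm (q - p); have := ler_norm (p - q); rewrite (distrC p q); lra.
have bAB : bcs (fun x => `|\1_B (x + z) * w (x + z) - \1_B x * w x| +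
    `|\1_A (x + z) * w (x + z) - \1_A x * w x|).
  by apply: bcs_add; [exact: (bcs_tr z bB)|exact: (bcs_tr z bA)].
rewrite IntD//; last exact: bcs_tr.
rewrite IntD; [|exact: (bcs_tr z bB)|exact: (bcs_tr z bA)].
have := h1 _ z1; have := h2 _ z2; have := h3 _ z3; lra.
Qed.

Lemma tcsetU A B : tcset A -> tcset B -> tcset (A `|` B).
Proof.
move=> tA tB; rewrite -[A `|` B]setCK setCU; apply: tcsetC; apply: tcsetI; exact: tcsetC.
Qed.

Lemma tcset_bigcup (A : (set 'rV[R]_n)^nat) : (forall k, tcset (A k)) -> tcset (\bigcup_k A k).
Proof.
move=> tA.
pose U k := \big[setU/set0]_(i < k) A i.
have tU k : tcset (U k).
  elim: k => [|k ih]; first by rewrite /U big_ord0; exact: tcset0.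
  by rewrite /U big_ord_recr; apply: tcsetU.
have mU : measurable (\bigcup_k A k) by apply: bigcupT_measurable => k; case: (tA k).
split => //.
apply: (@tc_dominated (fun k x => \1_(U k) x * w x) _ w) => //.
- by move=> k; apply: bcs_indic_mul => //; case: (tU k).
- by move=> k; case: (tU k).
- exact: bcs_indic_mul.
- move=> k x; rewrite normrM (ger0_norm (w0 x)) indicE.
  by case: (_ \in _); rewrite ?normr1 ?normr0 ?mul1r ?mul0r.
move=> x; apply: cvgMl; rewrite indicE.
have [/set_mem[k _ Akx]|xU] := boolP (x \in \bigcup_k A k).
  apply: cvg_near_cst; exists k.+1 => // m /= km.
  rewrite indicE mem_set//; rewrite /U; apply: (bigsetU_sup km) Akx.
apply: cvg_near_cst; apply: nearW => m; rewrite indicE memNset//.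
by rewrite /U -bigcup_mkord => -[i _ Aix]; move: xU; rewrite notin_setE; apply; exists i.
Qed.

Lemma tcset_sigma_algebra : sigma_algebra setT tcset.
Proof.
split; [exact: tcset0| |exact: tcset_bigcup].
by move=> A tA; rewrite setTD; exact: tcsetC.
Qed.

(** The indicator of an open half-space is the pointwise limit of the continuous ramps
    [clamp (k (x_i - a))]. Openness matters: all ramps vanish on the boundary hyperplane. *)
Lemma tcset_ray i (a : R) : tcset (rVcoord i @^-1` `]a, +oo[%classic).
Proof.
have mA : measurable (rVcoord i @^-1` `]a, +oo[%classic : set 'rV[R]_n).
  by rewrite -[X in measurable X]setTI; apply: measurable_rVcoord.
split => //.
pose F (k : nat) x := clamp (k%:R * (x ord0 i - a)) * w x.
have cF k : continuous (F k).
  have c1 : continuous (fun x : 'rV[R]_n => k%:R * (x ord0 i - a)).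
    apply: smooth_continuous; apply: smooth_scale.
    by apply: smooth_sub; [exact: smooth_rVcoord|exact: smooth_cst].
  exact: (continuous_mulr (continuous_clamp c1) cw).
have sF k : csupp (F k) by exact: csupp_mull.
apply: (@tc_dominated F _ w) => //.
- by move=> k; exact: bcs_continuous.
- by move=> k; exact: tc_continuous.
- exact: bcs_indic_mul.
- move=> k x; rewrite /F normrM (ger0_norm (w0 x)).
  have /andP[F0 F1] := clamp01 (k%:R * (x ord0 i - a)).
  by rewrite ger0_norm// ler_piMl.
move=> x; apply: cvgMl; rewrite indicE.
have [/set_mem|xU] := boolP (x \in _).
  rewrite /rVcoord /= in_itv/= andbT => ax.
  apply: cvg_near_cst.
  exists (Num.bound (x ord0 i - a)^-1) => // k /= bk.
  have xa : 0 < x ord0 i - a by rewrite subr_gt0.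
  apply: clamp_ge1.
  rewrite -ler_pdivrMr// mul1r; apply: le_trans (ltW (archi_boundP _)) _.
    by rewrite invr_ge0 ltW.
  by rewrite ler_nat.
apply: cvg_near_cst; apply: nearW => k.
move: xU; rewrite notin_setE /rVcoord /= in_itv/= andbT => /negP; rewrite -leNgt => xa.
by apply: clamp_le0; rewrite mulr_ge0_le0// subr_le0.
Qed.

(** Two nested generation arguments: preimages under coordinates generate the sigma-algebra of row
    vectors, and open rays generate that of the line. *)
Lemma tcset_measurable A : measurable A -> tcset A.
Proof.
apply: smallest_sub; first exact: tcset_sigma_algebra.
rewrite -bigcup_seq => B [i _ [Y mY <-]]; rewrite setTI.
suff H : (@ocitv R).-sigma.-measurable `<=` [set Y | tcset (rVcoord i @^-1` Y)] by exact: H.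
rewrite RGenOInfty.measurableE; apply: smallest_sub; last first.
  by move=> _ [a ->] /=; exact: tcset_ray.
split.
- by rewrite /= preimage_set0; exact: tcset0.
- by move=> Z /= tZ; rewrite setTD preimage_setC; exact: tcsetC.
- by move=> Z /= tZ; rewrite preimage_bigcup; exact: tcset_bigcup.
Qed.

End window.

(** Simple functions approximate [f] in L^1 but may lack compact support. Multiplying them by a
    window that equals 1 on the support of [f] restores it and can only lower the error. *)
Lemma tc_bcs f : bcs f -> L1_translation_continuous f.
Proof.
move=> bf; have [mf [C fC] [M fM]] := bf.
pose w x := clamp (`|M| + 1 - `|x|).
have cw : continuous w.
  have c1 : continuous (fun x : 'rV[R]_n => `|M| + 1 - `|x|).
    by move=> x; exact: (cvgB (cvg_cst _) (@norm_continuous _ _ x)).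
  exact: (continuous_clamp c1).
have w01 x : 0 <= w x <= 1 by exact: clamp01.
have w0 x : 0 <= w x by case/andP: (w01 x).
have sw : csupp w.
  exists (`|M| + 1) => x xM; apply: clamp_le0.
  by rewrite subr_le0 ltW.
have fw x : f x * w x = f x.
  have [xM|xM] := leP `|x| M; last by rewrite fM// mul0r.
  have -> : w x = 1; last by rewrite mulr1.
  by apply: clamp_ge1; have := le_trans xM (ler_norm M); lra.
have bw := bcs_continuous cw sw.
apply: tc_approx => // e e0.
have [g_ [_ _ /= Hg]] := approximation_sfun_integrable measurableT (bcs_integrable bf).
have [k gk] : exists k, (\int[leb]_z `|(f z)%:E - (g_ k z)%:E| < e%:E)%E.
  have /fine_cvgP[finH /cvgr_lt ltH] := Hg.
  have [k1 _ Hk1] := finH; have [k2 _ Hk2] := ltH _ e0; exists (maxn k1 k2).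
  by rewrite -[ltLHS](fineK (Hk1 _ (leq_maxl _ _))) lte_fin; exact: (Hk2 _ (leq_maxr _ _)).
pose g := g_ k.
have [D gD] : exists D, forall x, `|g x| <= D.
  have fr : finite_set (range g) by exact: fimfunP.
  exists (\sum_(y <- fset_set (range g)) `|y|) => x.
  have gx : g x \in fset_set (range g) by rewrite in_fset_set// mem_set//; exists x.
  by rewrite (big_rem (g x) gx)/= lerDl sumr_ge0.
have bg : bcs (fun x => g x * w x) by exact: (@bcs_mul_bounded _ _ D).
exists (fun x => g x * w x); split => //.
- rewrite (_ : (fun x => g x * w x) =
     (fun x => \sum_(y <- fset_set (range g)) y * (\1_(g @^-1` [set y]) x * w x))).
    have bI y : bcs (fun x => \1_(g @^-1` [set y]) x * w x) by apply: bcs_indic_mul.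
    apply: tc_sum => y; first exact: bcs_scale.
    apply: tc_scale => //.
    by have [] := tcset_measurable cw sw w0 (measurable_sfunP g (measurable_set1 y)).
  apply/funext => x; rewrite [in LHS]fimfunE fsbig_finite//= mulr_suml.
  by apply: eq_bigr => y _; rewrite [RHS]mulrA.
- rewrite -lee_fin EFin_Int; last by apply: bcs_norm; exact: bcs_sub.
  apply: le_trans (ltW gk); apply: ge0_le_integral => //=.
  + apply/measurable_EFinP; apply: measurableT_comp => //.
    by have [] := bcs_sub bf bg.
  + by apply/measurable_EFinP; apply: measurableT_comp => //; exact: measurable_funB.
  + move=> x _; rewrite lee_fin -[in leLHS](fw x) -mulrBl normrM (ger0_norm (w0 x)).
    by rewrite ler_piMr//; case/andP: (w01 x).
Qed.

Lemma convol_csupp f r : csupp f -> csupp r -> csupp (convol f r).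
Proof.
move=> [M fM] [N rN]; exists (M + N) => x xMN.
rewrite /convol (_ : (fun _ => _) = (fun=> 0)); first exact: Int0.
apply/funext => y; have [yM|yM] := leP `|y| M; last by rewrite fM// mul0r.
rewrite rN ?mulr0// -(ltrD2l M); apply: (lt_le_trans xMN).
have {1}-> : x = y + (x - y) by rewrite addrC subrK.
by rewrite (le_trans (ler_normD _ _))// lerD2r.
Qed.

Lemma measurable_rV_add2 :
  measurable_fun [set: 'rV[R]_n * 'rV[R]_n] (fun p : 'rV[R]_n * 'rV[R]_n => p.1 + p.2).
Proof.
apply: measurable_fun_rVP => i.
apply: (eq_measurable_fun (fun p : 'rV[R]_n * 'rV[R]_n => rVcoord i p.1 + rVcoord i p.2)).
  by move=> p _; rewrite /rVcoord /= !mxE.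
by apply: measurable_funD; apply: measurableT_comp => //; exact: measurable_rVcoord.
Qed.

(** Because [r] has mass 1, Tonelli bounds the L^1 error by an average, over [|z| < d], of the
    translation errors of [f]. The radius depends on [f] and [e] only, so one mollifier can serve
    several functions at once. *)
Lemma convol_L1 f : bcs f -> forall e, 0 < e -> exists2 d, 0 < d &
  forall r, mollifier d r -> Int (fun x => `|convol f r x - f x|) <= e.
Proof.
move=> bf e e0; have [d d0 hd] := tc_bcs bf e0; exists d => // r mr.
have [sr r0 r1 rN rd] := mr; have cr := mollifier_csupp mr.
have bcr := bcs_continuous (smooth_continuous sr) cr.
have [mf _ _] := bf; have [mrr _ _] := bcr.
have bconv : bcs (convol f r).
  apply: bcs_continuous; first by apply: smooth_continuous; exact: convol_smooth.
  by apply: convol_csupp => //; case: bf.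
have [C fC] : exists C, forall x, `|f x| <= C by case: bf.
have bH x : bcs (fun z => `|f (z + x) - f x| * r z).
  apply: (bcs_mul_bounded (C := 2 * `|C|)) bcr.
    apply: measurableT_comp => //; apply: measurable_funB => //.
    by apply: (measurableT_comp mf); exact: measurable_rVadd.
  move=> z; rewrite normr_id (le_trans (ler_normB _ _))// mulr_natl mulr2n.
  by rewrite lerD// (le_trans (fC _))// ler_norm.
have pt x : `|convol f r x - f x| <= Int (fun z => `|f (z + x) - f x| * r z).
  have brx : bcs (fun y => r (x - y)).
    apply: bcs_continuous; last exact: csupp_refl.
    by apply: smooth_continuous; exact: smooth_refl.
  have I1 : Int (fun y => r (x - y)) = 1.
    rewrite -r1 -(Int_shift (- x) bcr); congr Int; apply/funext => y.
    by rewrite -[in LHS]opprB rN.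
  have bfr := convol_bcs x bf (smooth_continuous sr).
  have -> : convol f r x - f x = Int (fun y => (f y - f x) * r (x - y)).
    rewrite (_ : (fun y => (f y - f x) * r (x - y)) =
       (fun y => f y * r (x - y) - f x * r (x - y))).
      by rewrite IntB ?IntZ ?I1 ?mulr1//; exact: bcs_scale.
    by apply/funext => y; rewrite mulrBl.
  have bd : bcs (fun y => (f y - f x) * r (x - y)).
    rewrite (_ : (fun y => (f y - f x) * r (x - y)) =
       (fun y => f y * r (x - y) - f x * r (x - y))).
      by apply: bcs_sub => //; exact: bcs_scale.
    by apply/funext => y; rewrite mulrBl.
  apply: le_trans (Int_norm bd) _.
  rewrite -(Int_shift x (bcs_norm bd)) le_eqVlt; apply/orP; left; apply/eqP.
  congr Int; apply/funext => z; rewrite normrM; congr (_ * _).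
  by rewrite ger0_norm// opprD addrCA subrr addr0 rN.
rewrite -lee_fin EFin_Int; last by apply: bcs_norm; exact: bcs_sub.
pose H (p : 'rV[R]_n * 'rV[R]_n) : \bar R := (`|f (p.2 + p.1) - f p.1| * r p.2)%:E.
have mH : measurable_fun setT H.
  apply/measurable_EFinP; apply: measurable_funM; last exact: measurableT_comp.
  apply: measurableT_comp => //; apply: measurable_funB; last exact: measurableT_comp.
  apply: (measurableT_comp mf).
  apply: (eq_measurable_fun (fun p : 'rV[R]_n * 'rV[R]_n => p.1 + p.2)).
    by move=> p _; rewrite addrC.
  exact: measurable_rV_add2.
have H0 p : (0 <= H p)%E by rewrite lee_fin mulr_ge0.
apply: (@le_trans _ _ (\int[leb]_x \int[leb]_z H (x, z))%E).
  apply: ge0_le_integral => //=.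
  - by apply/measurable_EFinP; apply: measurableT_comp => //; have [] := bcs_sub bconv bf.
  - exact: (@measurable_fun_fubini_tonelli_F _ _ _ _ _ leb H).
  by move=> x _; rewrite /H /= -EFin_Int// lee_fin.
rewrite (fubini_tonelli _ mH H0).
apply: (@le_trans _ _ (\int[leb]_z ((e)%:E * (r z)%:E))%E).
  apply: ge0_le_integral => //=.
  - by move=> x _; apply: integral_ge0 => y _; exact: H0.
  - exact: (@measurable_fun_fubini_tonelli_G _ _ _ _ _ leb H).
  - by apply: measurable_funeM; exact/measurable_EFinP.
  move=> z _; rewrite /H /=.
  under eq_integral do rewrite mulrC EFinM.
  rewrite ge0_integralZl//; last 2 first.
  - rewrite (_ : (fun x => _) = EFin \o (fun x => `|f (x + z) - f x|)).
      by apply/measurable_EFinP; have [] := bcs_tr z bf.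
    by apply/funext => x /=; rewrite (addrC z).
  - by rewrite lee_fin.
  have [zd|zd] := ltP `|z| d; last by rewrite rd// !mul0e mule0.
  rewrite muleC lee_wpmul2r ?lee_fin//.
  rewrite (_ : (\int[leb]_x _)%E = (Int (fun x => `|f (x + z) - f x|))%:E).
    by rewrite lee_fin hd.
  rewrite EFin_Int; last exact: bcs_tr.
  by apply: eq_integral => x _; rewrite (addrC z).
rewrite ge0_integralZl//; last 3 first.
- exact/measurable_EFinP.
- by move=> x _; rewrite lee_fin.
- by rewrite lee_fin ltW.
by rewrite -EFin_Int// r1 mule1.
Qed.

End translation_continuity.

(** * The Carleman inequality *)

(* Locked so that [ring] and unification never unfold second derivatives. *)
HB.lock Definition pd (R : realType) (n : nat) (i : 'I_n) (f : 'rV[R]_n -> R)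
  : 'rV[R]_n -> R := 'D_(evec R i) f.

Section partials.
Variables (R : realType) (n : nat).
Implicit Types (f g : 'rV[R]_n -> R) (x : 'rV[R]_n).

Lemma pdE i f : pd i f = 'D_(evec R i) f.
Proof. by rewrite pd.unlock. Qed.

Lemma smooth_pd i f : smooth f -> smooth (pd i f).
Proof. by rewrite pdE; exact: smooth_D. Qed.

Lemma pdM i f g x : smooth f -> smooth g ->
  pd i (fun y => f y * g y) x = pd i f x * g x + f x * pd i g x.
Proof.
by move=> sf sg; rewrite !pdE derive_mulE 1?addrC//; exact: smooth_diff.
Qed.

Lemma pdD i f g x : smooth f -> smooth g ->
  pd i (fun y => f y + g y) x = pd i f x + pd i g x.
Proof.
by move=> sf sg; rewrite !pdE; apply: deriveD; exact: smooth_derivable.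
Qed.

Lemma pd_cst i (c : R) x : pd i (fun=> c) x = 0.
Proof. by rewrite pdE; exact: derive_cst. Qed.

Lemma pdZ i (c : R) f x : smooth f -> pd i (fun y => c * f y) x = c * pd i f x.
Proof.
by move=> sf; rewrite (@pdM i (fun=> c) f)//; [rewrite pd_cst mul0r add0r|exact: smooth_cst].
Qed.

Lemma pdN i f x : smooth f -> pd i (fun y => - f y) x = - pd i f x.
Proof.
by move=> sf; rewrite !pdE; apply: deriveN; exact: smooth_derivable.
Qed.

Lemma pdB i f g x : smooth f -> smooth g ->
  pd i (fun y => f y - g y) x = pd i f x - pd i g x.
Proof. by move=> sf sg; rewrite pdD ?pdN//; exact: smooth_opp. Qed.

Lemma pd_sum i (F : 'I_n -> 'rV[R]_n -> R) x : (forall j, smooth (F j)) ->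
  pd i (fun y => \sum_(j < n) F j y) x = \sum_(j < n) pd i (F j) x.
Proof.
move=> sF; elim: (index_enum _) => [|j r ih].
  rewrite big_nil (_ : (fun _ => _) = (fun=> 0)) ?pd_cst//.
  by apply/funext => y; rewrite big_nil.
rewrite big_cons (_ : (fun _ => _) = (fun y => F j y + \sum_(j <- r) F j y)).
  by rewrite pdD ?ih//; exact: smooth_sum.
by apply/funext => y; rewrite big_cons.
Qed.

Lemma pd_comm i j f x : smooth f -> pd i (pd j f) x = pd j (pd i f) x.
Proof. by rewrite !pdE; exact: smooth_derive_comm. Qed.

Lemma lapE f x : lap f x = \sum_(i < n) pd i (pd i f) x.
Proof. by apply: eq_bigr => i _; rewrite !pdE. Qed.

Lemma smooth_lap f : smooth f -> smooth (lap f).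
Proof. by move=> sf; apply: smooth_sum => i; do 2 apply: smooth_D. Qed.

End partials.

Opaque lap smooth.

Ltac gring := repeat match goal with
  | |- context [pd ?i ?f ?x] => generalize (pd i f x); intro
  | |- context [lap ?f ?x] => generalize (lap f x); intro
  end; ring.

Section partial_rules.
Variables (R : realType) (n : nat).
Implicit Types (f g : 'rV[R]_n -> R) (x : 'rV[R]_n).

Lemma lapM f g x : smooth f -> smooth g -> lap (fun y => f y * g y) x =
  lap f x * g x + 2 * (\sum_(i < n) pd i f x * pd i g x) + f x * lap g x.
Proof.
move=> sf sg; rewrite !lapE.
rewrite (eq_bigr (fun i => pd i (pd i f) x * g x + 2 * (pd i f x * pd i g x) + f x * pd i (pd i g) x)).
  by rewrite !big_split /= -mulr_suml -!mulr_sumr.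
move=> i _; rewrite (_ : pd i (fun y => f y * g y) = (fun y => pd i f y * g y + f y * pd i g y)).
  have s1 := smooth_pd i sf; have s2 := smooth_pd i sg.
  by rewrite pdD ?pdM//; [gring|exact: smooth_mul..].
by apply/funext => y; rewrite pdM.
Qed.

Lemma pd_exp i f x : smooth f -> pd i (fun y => expR (f y)) x = expR (f x) * pd i f x.
Proof.
move=> sf; rewrite !pdE.
by have [_] := is_derive_comp1 (evec R i) (smooth_diff sf x) (is_derive_expR (f x)).
Qed.

Lemma csupp_pd i f : csupp f -> csupp (pd i f).
Proof. by rewrite pdE; exact: derive_csupp. Qed.

Lemma pd_near i f g x : (\near x, f x = g x) -> pd i f x = pd i g x.
Proof. by rewrite !pdE; exact: near_eq_derive. Qed.

Lemma pd_supp (M : R) i f x : (forall y, M < `|y| -> f y = 0) -> M < `|x| -> pd i f x = 0.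
Proof.
move=> fM Mx; rewrite (@pd_near i f (fun=> 0)) ?pd_cst//.
have : \forall y \near x, M < `|y|.
  by have /cvgr_gt := @norm_continuous _ _ x; apply.
by apply: filterS => y /fM.
Qed.

Lemma smooth_bcs f : smooth f -> csupp f -> bcs f.
Proof. by move=> sf; apply: bcs_continuous; exact: smooth_continuous. Qed.

Lemma Int_div (F : 'I_n -> 'rV[R]_n -> R) :
  (forall i, smooth (F i)) -> (forall i, csupp (F i)) ->
  Int (fun x => \sum_(i < n) pd i (F i) x) = 0.
Proof.
move=> sF cF; rewrite Int_sum; last first.
  by move=> i; apply: smooth_bcs; [exact: smooth_pd|exact: csupp_pd].
rewrite big1// => i _; rewrite pdE; apply: Int_derive0; [exact: smooth_diff| |exact: cF].
by apply: smooth_continuous; exact: smooth_D.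
Qed.

End partial_rules.

Lemma smooth_sqr (R : realType) (n : nat) (f : 'rV[R]_n -> R) :
  smooth f -> smooth (fun x => f x ^+ 2).
Proof.
by move=> sf; rewrite (_ : (fun x => _) = fun x => f x * f x)//; exact: smooth_mul.
Qed.

Ltac smth := repeat match goal with
  | H : smooth ?f |- smooth ?f => exact H
  | |- smooth (pd _ _) => apply: smooth_pd
  | |- smooth (lap _) => apply: smooth_lap
  | |- smooth (fun y => _ + _) => apply: smooth_add
  | |- smooth (fun y => - _) => apply: smooth_opp
  | |- smooth (fun y => _ * _) => apply: smooth_mul
  | |- smooth (fun y => _ ^+ 2) => apply: smooth_sqr
  | |- smooth (fun y => expR _) => apply: smooth_exp
  | |- smooth (fun y => \sum_(_ < _) _) => apply: smooth_sum => ?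
  | |- smooth (fun _ => ?c) => exact: smooth_cst
  end.

Section carleman.
Variables (R : realType) (n : nat).
Variables (phi h v : 'rV[R]_n -> R).
Hypotheses (sphi : smooth phi) (sh : smooth h) (sv : smooth v) (cv : csupp v).

Definition gradsq (f : 'rV[R]_n -> R) x := \sum_(i < n) pd i f x * pd i f x.
Definition gdot (f g : 'rV[R]_n -> R) x := \sum_(i < n) pd i f x * pd i g x.

(* With [S = lap + |grad phi|^2] and [A = -2 grad phi . grad - lap phi], the
   symmetric and antisymmetric parts of the conjugated Laplacian, [carlQ] is what
   integration by parts makes of [2 (S - h) v (A + h) v <= ((S + A) v)^2]. *)
Definition carlQ (x : 'rV[R]_n) : R :=
  4 * (\sum_(i < n) \sum_(j < n) pd i (pd j phi) x * (pd i v x * pd j v x)) -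
  2 * h x * gradsq v x +
  (lap h x - lap (lap phi) x + 2 * (gradsq phi x - h x) * h x +
   2 * gdot (gradsq phi) phi x - 2 * gdot h phi x) * v x ^+ 2.

Lemma smooth_gradsq (f : 'rV[R]_n -> R) : smooth f -> smooth (gradsq f).
Proof. by move=> sf; rewrite /gradsq; smth. Qed.

Lemma smooth_gdot (f g : 'rV[R]_n -> R) : smooth f -> smooth g -> smooth (gdot f g).
Proof. by move=> sf sg; rewrite /gdot; smth. Qed.

Let k x := gradsq phi x - h x.
Let q x := h x - lap phi x.
Let sk : smooth k.
Proof. by apply: smooth_sub => //; exact: smooth_gradsq. Qed.
Let sq : smooth q.
Proof. by apply: smooth_sub => //; exact: smooth_lap. Qed.

(** The flux behind [carlQ], with [(S - h) v = lap v + k v] and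
    [(A + h) v = -2 grad phi . grad v + q v]. The first two terms are the Rellich field for [lap v]
    times [grad phi . grad v]; the next two move the derivatives in [q v lap v] onto [grad v] and
    [lap q]; the last treats [k v grad phi . grad v] as a multiple of [k grad phi . grad (v^2)]. *)
Let F (i : 'I_n) x :=
  -4 * (pd i v x * gdot phi v x) + 2 * (pd i phi x * gradsq v x) +
  2 * (q x * (v x * pd i v x)) - v x * v x * pd i q x
  - 2 * (k x * (pd i phi x * (v x * v x))).

Let sF i : smooth (F i).
Proof.
have s1 := smooth_gdot sphi sv; have s2 := smooth_gradsq sv.
by rewrite /F; smth.
Qed.

Let cF i : csupp (F i).
Proof.
have [M vM] := cv.
have dv j x : M < `|x| -> pd j v x = 0 by exact: pd_supp.
exists M => x Mx; rewrite /F dv// vM// /gradsq big1; last by move=> j _; rewrite dv// mul0r.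
by rewrite !(mul0r, mulr0, addr0, oppr0).
Qed.

Let divF x : \sum_(i < n) pd i (F i) x =
  2 * (lap v x + k x * v x) * (-2 * gdot phi v x + q x * v x) - carlQ x.
Proof.
have s1 := smooth_gdot sphi sv; have s2 := smooth_gradsq sv.
have s3 := smooth_gradsq sphi.
have E i : pd i (F i) x =
  (-4 * gdot phi v x) * pd i (pd i v) x +
  -4 * \sum_(j < n) pd i (pd j phi) x * (pd i v x * pd j v x) +
  -4 * \sum_(j < n) pd i (pd j v) x * (pd i v x * pd j phi x) +
  (2 * gradsq v x) * pd i (pd i phi) x +
  4 * \sum_(j < n) pd i (pd j v) x * (pd j v x * pd i phi x) +
  (2 * q x) * (pd i v x * pd i v x) + (2 * q x * v x) * pd i (pd i v) x
  + (- v x ^+ 2) * (pd i (pd i h) x - pd i (pd i (lap phi)) x)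
  + (-2 * v x ^+ 2) * (pd i (gradsq phi) x * pd i phi x)
  + (2 * v x ^+ 2) * (pd i h x * pd i phi x)
  + (- 2 * k x * v x ^+ 2) * pd i (pd i phi) x
  + (-4 * k x * v x) * (pd i phi x * pd i v x).
  rewrite /F.
  rewrite pdB; [|by smth..].
  rewrite pdB; [|by smth..].
  rewrite pdD; [|by smth..].
  rewrite pdD; [|by smth..].
  rewrite !pdZ; [|by smth..].
  rewrite !pdM; [|by smth..].
  have -> : pd i (gdot phi v) x = \sum_(j < n) pd i (pd j phi) x * pd j v x +
     \sum_(j < n) pd i (pd j v) x * pd j phi x.
    rewrite /gdot pd_sum; last by move=> j; smth.
    rewrite -big_split; apply: eq_bigr => j _ /=.
    by rewrite pdM; [gring|smth..].
  have -> : pd i (gradsq v) x = 2 * \sum_(j < n) pd i (pd j v) x * pd j v x.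
    rewrite /gradsq pd_sum; last by move=> j; smth.
    rewrite mulr_sumr; apply: eq_bigr => j _ /=.
    by rewrite pdM; [gring|smth..].
  have -> : pd i (pd i q) x = pd i (pd i h) x - pd i (pd i (lap phi)) x.
    rewrite (_ : pd i q = fun y => pd i h y - pd i (lap phi) y).
      by rewrite pdB//; smth.
    by apply/funext => y; rewrite /q pdB//; smth.
  have -> : pd i k x = pd i (gradsq phi) x - pd i h x by rewrite /k pdB//; smth.
  have -> : \sum_(j < n) pd i (pd j phi) x * (pd i v x * pd j v x) =
     pd i v x * \sum_(j < n) pd i (pd j phi) x * pd j v x.
    by rewrite mulr_sumr; apply: eq_bigr => j _; gring.
  have -> : \sum_(j < n) pd i (pd j v) x * (pd i v x * pd j phi x) =
     pd i v x * \sum_(j < n) pd i (pd j v) x * pd j phi x.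
    by rewrite mulr_sumr; apply: eq_bigr => j _; gring.
  have -> : \sum_(j < n) pd i (pd j v) x * (pd j v x * pd i phi x) =
     pd i phi x * \sum_(j < n) pd i (pd j v) x * pd j v x.
    by rewrite mulr_sumr; apply: eq_bigr => j _; gring.
  move: (\sum_(j < n) pd i (pd j phi) x * pd j v x) (\sum_(j < n) pd i (pd j v) x * pd j phi x)
    (\sum_(j < n) pd i (pd j v) x * pd j v x) (gdot phi v x) (gradsq v x) => *.
  by move: (v x) (q x) (k x) => *; gring.
rewrite (eq_bigr _ (fun i _ => E i)) !big_split /= -!mulr_sumr.
(* Since second derivatives commute, exchanging the indices turns one of the sums containing the
   Hessian of [v] into the other, and the two cancel. *)
have -> : \sum_(i < n) \sum_(j < n) pd i (pd j v) x * (pd i v x * pd j phi x) =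
   \sum_(i < n) \sum_(j < n) pd i (pd j v) x * (pd j v x * pd i phi x).
  rewrite exchange_big; apply: eq_bigr => i _; apply: eq_bigr => j _.
  by rewrite pd_comm.
have -> : \sum_(i < n) (pd i (pd i h) x - pd i (pd i (lap phi)) x) =
   lap h x - lap (lap phi) x by rewrite !lapE big_split /= sumrN.
rewrite -!lapE -/(gradsq v x) -/(gdot h phi x) -/(gdot phi v x) -/(gdot (gradsq phi) phi x).
rewrite /carlQ /k /q.
move: (\sum_(i < n) \sum_(j < n) pd i (pd j v) x * _) (\sum_(i < n) \sum_(j < n) _) (v x) (h x) => *.
move: (gdot _ _ x) (gdot _ _ x) (gdot _ _ x) (gradsq _ x) (gradsq _ x) (lap h x) (lap (lap _) x) (lap _ x) (lap _ x) => *.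
by gring.
Qed.

Lemma bcs_carlQ : bcs carlQ.
Proof.
clear - sphi sh sv cv.
have s1 := smooth_gradsq sphi; have s2 := smooth_gradsq sv.
have s3 := smooth_gdot s1 sphi; have s4 := smooth_gdot sh sphi.
have [M vM] := cv.
have dv j x : M < `|x| -> pd j v x = 0 by exact: pd_supp.
apply: smooth_bcs.
  rewrite (_ : carlQ = (fun x => 4 * (\sum_(i < n) \sum_(j < n) pd i (pd j phi) x * (pd i v x * pd j v x)) -
    2 * h x * gradsq v x +
    (lap h x - lap (lap phi) x + 2 * (gradsq phi x - h x) * h x +
     2 * gdot (gradsq phi) phi x - 2 * gdot h phi x) * (v x * v x)))//.
  by smth.
exists M => x Mx; rewrite /carlQ vM// /gradsq.
rewrite big1; last by move=> i _; rewrite big1// => j _; rewrite dv// mul0r mulr0.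
rewrite [X in 2 * _ * X]big1; last by move=> j _; rewrite dv// mul0r.
by rewrite !(mul0r, mulr0, addr0, oppr0, expr0n).
Qed.

(** Moving [h] from one part to the other does not change the sum: [S + A = (S - h) + (A + h)]. The
    square of the sum exceeds twice the product by two squares, which are dropped, and the product
    differs from [carlQ] by a divergence. *)
Lemma carleman : Int carlQ <= Int (fun x =>
  (lap v x + gradsq phi x * v x - 2 * gdot phi v x - lap phi x * v x) ^+ 2).
Proof.
have s1 := smooth_gradsq sphi; have s2 := smooth_gdot sphi sv.
have bDF : bcs (fun x => \sum_(i < n) pd i (F i) x).
  by apply: bcs_sum => i; apply: smooth_bcs; [exact: smooth_pd|exact: csupp_pd].
rewrite -[leLHS]add0r -(Int_div sF cF) -IntD//; last exact: bcs_carlQ.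
apply: Int_le.
- by apply: bcs_add => //; exact: bcs_carlQ.
- apply: smooth_bcs.
    rewrite (_ : (fun x => _ ^+ 2) = (fun x => (lap v x + gradsq phi x * v x - 2 * gdot phi v x - lap phi x * v x) *
      (lap v x + gradsq phi x * v x - 2 * gdot phi v x - lap phi x * v x)))//.
    by smth.
  have [M vM] := cv.
  have dv j x : M < `|x| -> pd j v x = 0 by exact: pd_supp.
  exists M => x Mx; rewrite vM// lapE big1; last first.
    by move=> j _; apply: pd_supp Mx => y; exact: dv.
  rewrite /gdot big1; last by move=> j _; rewrite dv// mulr0.
  by rewrite !(mulr0, addr0, oppr0) expr0n.
move=> x; rewrite divF subrK /k /q.
move: (lap v x) (gdot phi v x) (gradsq phi x) (v x) (lap phi x) (h x) => a b g y l z.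
rewrite -subr_ge0.
have -> : (a + g * y - 2 * b - l * y) ^+ 2 -
   2 * (a + (g - z) * y) * (- 2 * b + (z - l) * y) =
   (a + (g - z) * y) ^+ 2 + (- 2 * b + (z - l) * y) ^+ 2 by ring.
by rewrite addr_ge0// sqr_ge0.
Qed.

End carleman.

Section conjugation.
Variables (R : realType) (n : nat).
Variables (phi f : 'rV[R]_n -> R).
Hypotheses (sphi : smooth phi) (sf : smooth f) (cf : csupp f).

Lemma lap_exp x : lap (fun y => expR (phi y)) x =
  expR (phi x) * (gradsq phi x + lap phi x).
Proof.
rewrite !lapE /gradsq -big_split mulr_sumr; apply: eq_bigr => i _ /=.
rewrite (_ : pd i (fun y => expR (phi y)) = fun y => expR (phi y) * pd i phi y).
  by rewrite pdM ?pd_exp//; [ring|smth..].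
by apply/funext => y; rewrite pd_exp.
Qed.

(** The left side is [e^phi lap (e^-phi v)] expanded, the operator to which the inequality for [v]
    applies. *)
Lemma lap_conj x (v := fun y => expR (phi y) * f y) :
  lap v x + gradsq phi x * v x - 2 * gdot phi v x - lap phi x * v x =
  expR (phi x) * lap f x.
Proof.
have se : smooth (fun y => expR (phi y)) by smth.
have -> : gdot phi v x = expR (phi x) * (gradsq phi x * f x + gdot phi f x).
  rewrite /gdot /gradsq mulr_suml -big_split mulr_sumr; apply: eq_bigr => i _ /=.
  by rewrite /v pdM// pd_exp//; ring.
rewrite /v lapM// lap_exp (_ : \sum_(i < n) _ = expR (phi x) * gdot phi f x); last first.
  by rewrite /gdot mulr_sumr; apply: eq_bigr => i _ /=; rewrite pd_exp//; ring.
by move: (lap f x) (lap phi x) (gradsq phi x) (gdot phi f x) => *; ring.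
Qed.

Lemma carleman_conj (h : 'rV[R]_n -> R) : smooth h ->
  Int (carlQ phi h (fun y => expR (phi y) * f y)) <=
  Int (fun x => (expR (phi x) * lap f x) ^+ 2).
Proof.
move=> sh; set v := fun y => _.
rewrite (_ : (fun x => (expR (phi x) * lap f x) ^+ 2) = (fun x =>
  (lap v x + gradsq phi x * v x - 2 * gdot phi v x - lap phi x * v x) ^+ 2)).
  apply: carleman => //; first by rewrite /v; smth.
  by have [M fM] := cf; exists M => x Mx; rewrite /v fM// mulr0.
by apply/funext => x; rewrite -lap_conj.
Qed.

End conjugation.

(** * The radial weight and the positivity of its quadratic form *)

Section weight.
Variables (R : realType) (n : nat) (x0 : 'rV[R]_n).
Implicit Types (x : 'rV[R]_n) (i j : 'I_n).

Definition ycoord i x : R := x ord0 i - x0 ord0 i.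
Definition sqdist x : R := \sum_(i < n) ycoord i x * ycoord i x.

Lemma smooth_ycoord i : smooth (ycoord i).
Proof. by apply: smooth_sub; [exact: smooth_rVcoord|exact: smooth_cst]. Qed.

Lemma pd_ycoord i j x : pd i (ycoord j) x = (i == j)%:R.
Proof.
rewrite pdB; [|exact: smooth_rVcoord|exact: smooth_cst].
by rewrite pd_cst subr0 pdE derive_rVcoord /evec mxE eqxx eq_sym.
Qed.

Lemma sum_delta i (c : R) (F : 'I_n -> R) : \sum_(j < n) c * F j * (i == j)%:R = c * F i.
Proof.
rewrite (bigD1 i)//= eqxx mulr1 big1 ?addr0// => j ji.
by rewrite eq_sym (negbTE ji) mulr0.
Qed.

Lemma smooth_sqdist : smooth sqdist.
Proof.
by apply: smooth_sum => i; apply: smooth_mul; exact: smooth_ycoord.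
Qed.

Lemma pd_sqdist i x : pd i sqdist x = 2 * ycoord i x.
Proof.
rewrite pd_sum; last by move=> j; apply: smooth_mul; exact: smooth_ycoord.
rewrite -(sum_delta i 2 (fun j => ycoord j x)); apply: eq_bigr => j _.
by rewrite pdM ?pd_ycoord; [ring|exact: smooth_ycoord..].
Qed.

(* Equal to the squared distance off a small ball, but positive everywhere, so that its logarithm is smooth. *)
Definition sreg x : R := sqdist x + ebump (32^-1 - sqdist x).
Definition sinv x : R := (sreg x)^-1.

Lemma sreg_gt0 x : 0 < sreg x.
Proof.
have s0 : 0 <= sqdist x by apply: sumr_ge0 => i _; rewrite -expr2 sqr_ge0.
rewrite /sreg; have [sle|slt] := leP (32^-1) (sqdist x).
  by apply: ltr_pwDl; [apply: lt_le_trans sle; rewrite invr_gt0|exact: bump_ge0].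
by apply: ltr_wpDl => //; apply: bump_gt0; rewrite subr_gt0.
Qed.

Lemma sregE x : 32^-1 <= sqdist x -> sreg x = sqdist x.
Proof. by move=> sx; rewrite /sreg bump_le0 ?addr0// subr_le0. Qed.

Lemma near_sregE (t : R) x : t < sqdist x -> \forall y \near x, t < sqdist y.
Proof.
move=> sx; have cs : {for x, continuous sqdist} by exact: smooth_continuous smooth_sqdist _.
by have /cvgr_gt := cs; apply.
Qed.

Lemma smooth_sreg : smooth sreg.
Proof.
have s1 := smooth_sqdist.
apply: smooth_add => //; apply: smooth_bump; apply: smooth_sub => //; exact: smooth_cst.
Qed.

Lemma smooth_sinv : smooth sinv.
Proof. by apply: smooth_inv smooth_sreg => x; rewrite gt_eqF// sreg_gt0. Qed.

Lemma pd_sreg i x : 32^-1 < sqdist x -> pd i sreg x = 2 * ycoord i x.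
Proof.
move=> sx; rewrite -pd_sqdist; apply: pd_near.
by apply: filterS (near_sregE sx) => y /ltW; exact: sregE.
Qed.

Lemma pd_sinv i x : 32^-1 < sqdist x -> pd i sinv x = - 2 * (sinv x ^+ 2 * ycoord i x).
Proof.
move=> sx; have -> : pd i sinv x = - (sreg x)^-1 ^+ 2 * pd i sreg x.
  rewrite !pdE; have [|_] := derive_invE (evec R i) (smooth_diff smooth_sreg x).
    by rewrite gt_eqF// sreg_gt0.
  exact.
by rewrite pd_sreg// /sinv; ring.
Qed.

Lemma sinv_sqdist x : 32^-1 < sqdist x -> sinv x * sqdist x = 1.
Proof. by move=> sx; rewrite -sregE ?ltW// mulVf// gt_eqF// sreg_gt0. Qed.

Lemma lap_sinv x : 32^-1 < sqdist x -> lap sinv x = (8 - 2 * n%:R) * sinv x ^+ 2.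
Proof.
move=> sx; rewrite lapE.
have s1 := smooth_sinv.
have E i : pd i (pd i sinv) x = 8 * sinv x ^+ 3 * (ycoord i x * ycoord i x) - 2 * sinv x ^+ 2.
  rewrite (@pd_near _ _ _ _ (fun y => - 2 * (sinv y * sinv y * ycoord i y))); last first.
    by apply: filterS (near_sregE sx) => y sy; rewrite pd_sinv// expr2.
  have s2 := smooth_ycoord i.
  rewrite pdZ; last by smth.
  rewrite pdM//; last by smth.
  by rewrite pdM// pd_sinv// pd_ycoord eqxx /=; ring.
rewrite (eq_bigr _ (fun i _ => E i)) big_split /= -mulr_sumr -/(sqdist x) sumr_const card_ord.
by rewrite exprSr -!mulrA sinv_sqdist// -[X in _ + X]mulr_natl; ring.
Qed.

Variables (tau b : R).

Definition cphi x : R := - (tau / 2) * ln (sreg x) + (tau * b / 2) * sqdist x.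
(* The gradient of [cphi] is [ck y]; its Hessian is [ck] times the identity plus
   a nonnegative radial part, and the choice [h = 2 ck] cancels the former in [carlQ]. *)
Definition ck x : R := tau * b - tau * sinv x.

Lemma smooth_cphi : smooth cphi.
Proof.
have s1 := smooth_sqdist.
have s2 : smooth (fun x => ln (sreg x)) by apply: smooth_ln smooth_sreg => x; exact: sreg_gt0.
by apply: smooth_add; apply: smooth_mul => //; exact: smooth_cst.
Qed.

Lemma smooth_ck : smooth ck.
Proof.
by have s1 := smooth_sinv; rewrite /ck; smth.
Qed.

Lemma pd_cphi i x : 32^-1 < sqdist x -> pd i cphi x = ck x * ycoord i x.
Proof.
move=> sx; have s1 := smooth_sqdist.
have s2 : smooth (fun x => ln (sreg x)) by apply: smooth_ln smooth_sreg => y; exact: sreg_gt0.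
rewrite pdD; [|by smth..].
rewrite !pdZ// pd_sqdist.
have -> : pd i (fun y => ln (sreg y)) x = sinv x * pd i sreg x.
  by rewrite !pdE; have [_] := derive_lnE (evec R i) (smooth_diff smooth_sreg x) (sreg_gt0 x).
by rewrite pd_sreg// /ck; field.
Qed.

Lemma pd_ck i x : 32^-1 < sqdist x -> pd i ck x = 2 * tau * (sinv x ^+ 2 * ycoord i x).
Proof.
move=> sx; have s1 := smooth_sinv.
rewrite pdB; [|by smth..].
by rewrite pd_cst pdZ// pd_sinv//; ring.
Qed.

Lemma pd2_cphi i j x : 32^-1 < sqdist x -> pd i (pd j cphi) x =
  2 * tau * sinv x ^+ 2 * (ycoord i x * ycoord j x) + ck x * (i == j)%:R.
Proof.
move=> sx; rewrite (@pd_near _ _ _ _ (fun y => ck y * ycoord j y)); last first.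
  by apply: filterS (near_sregE sx) => y sy; rewrite pd_cphi.
rewrite pdM; [|exact: smooth_ck|exact: smooth_ycoord].
by rewrite pd_ck// pd_ycoord; ring.
Qed.

Lemma lap_cphi x : 32^-1 < sqdist x ->
  lap cphi x = n%:R * tau * b + (2 - n%:R) * tau * sinv x.
Proof.
move=> sx; rewrite lapE (eq_bigr _ (fun i _ => pd2_cphi i i sx)) big_split /=.
rewrite -mulr_sumr -/(sqdist x) (eq_bigr (fun=> ck x)); last by move=> i _; rewrite eqxx mulr1.
rewrite sumr_const card_ord -mulr_natl expr2 -!mulrA sinv_sqdist// /ck; ring.
Qed.

Lemma lap_near f g x : (\near x, f x = g x) -> lap f x = lap (g : 'rV[R]_n -> R) x.
Proof.
move=> fg; rewrite !lapE; apply: eq_bigr => i _; apply: pd_near.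
by apply: filterS (near_join fg) => y yfg; exact: pd_near.
Qed.

(** The gradient survives only in a radial square. The factor [(n - 4)^2] collects [lap h] and
    [lap (lap cphi)], both multiples of [lap |y|^-2]. The terms cubic in [ck] cancel up to the
    multiple [8 tau b ck^2 |y|^2], the source of all positivity, obtained by substituting
    [ck |y|^2 = tau b |y|^2 - tau]. *)
Lemma carlQ_weight v x : 32^-1 < sqdist x ->
  carlQ cphi (fun y => 2 * ck y) v x =
  8 * tau * (sinv x * \sum_(i < n) ycoord i x * pd i v x) ^+ 2 +
  (8 * tau * b * ck x ^+ 2 * sqdist x - 8 * ck x * tau * b
   - 2 * (n%:R - 4) ^+ 2 * tau * sinv x ^+ 2) * v x ^+ 2.
Proof.
move=> sx; have sk := smooth_ck; have ss := smooth_sinv.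
have E1 : \sum_(i < n) \sum_(j < n) pd i (pd j cphi) x * (pd i v x * pd j v x) =
  2 * tau * (sinv x * \sum_(i < n) ycoord i x * pd i v x) ^+ 2 + ck x * gradsq v x.
  set Y := \sum_(i < n) _ * _.
  transitivity (\sum_(i < n) (2 * tau * sinv x ^+ 2 * Y * (ycoord i x * pd i v x) +
     ck x * (pd i v x * pd i v x))).
    apply: eq_bigr => i _.
    transitivity (\sum_(j < n) (2 * tau * sinv x ^+ 2 * (ycoord i x * pd i v x) * (ycoord j x * pd j v x) +
       ck x * pd i v x * pd j v x * (i == j)%:R)).
      by apply: eq_bigr => j _; rewrite pd2_cphi//; ring.
    by rewrite big_split /= -mulr_sumr -/Y (sum_delta i (ck x * pd i v x) (fun j => pd j v x)); ring.
  by rewrite big_split /= -!mulr_sumr -/Y /gradsq; ring.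
have E2 : lap (fun y => 2 * ck y) x = - 2 * tau * ((8 - 2 * n%:R) * sinv x ^+ 2).
  rewrite -lap_sinv// !lapE mulr_sumr; apply: eq_bigr => i _.
  rewrite (_ : pd i (fun y => 2 * ck y) = fun y => - 2 * tau * pd i sinv y).
    by rewrite pdZ//; smth.
  apply/funext => y; rewrite pdZ// pdB; [|by smth..].
  by rewrite pd_cst pdZ//; ring.
have E3 : lap (lap cphi) x = (2 - n%:R) * tau * ((8 - 2 * n%:R) * sinv x ^+ 2).
  rewrite (@lap_near _ (fun y => n%:R * tau * b + (2 - n%:R) * tau * sinv y)); last first.
    by apply: filterS (near_sregE sx) => y sy; rewrite lap_cphi.
  rewrite -lap_sinv// !lapE mulr_sumr; apply: eq_bigr => i _.
  transitivity (pd i (fun y => (2 - n%:R) * tau * pd i sinv y) x); last by apply: pdZ; smth.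
  congr (pd i _ x); apply/funext => y; rewrite pdD; [|by smth..].
  by rewrite pd_cst pdZ// add0r.
have G y : 32^-1 < sqdist y -> gradsq cphi y = ck y * ck y * sqdist y.
  move=> sy; rewrite /gradsq /sqdist mulr_sumr; apply: eq_bigr => i _.
  by rewrite pd_cphi//; ring.
have E4 : gdot (gradsq cphi) cphi x = 4 * ck x ^+ 2 * tau + 2 * ck x ^+ 3 * sqdist x.
  transitivity (\sum_(i < n) (4 * ck x ^+ 2 * tau * sinv x + 2 * ck x ^+ 3) * (ycoord i x * ycoord i x)).
    apply: eq_bigr => i _; rewrite (@pd_near _ _ _ _ (fun y => ck y * ck y * sqdist y)); last first.
      by apply: filterS (near_sregE sx) => y sy; rewrite G.
    have s1 := smooth_sqdist.
    rewrite pdM//; last by smth.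
    rewrite pdM// pd_ck// pd_sqdist pd_cphi//.
    rewrite (_ : ck x ^+ 3 = ck x * ck x * ck x); last by ring.
    transitivity (4 * ck x ^+ 2 * tau * sinv x * (sinv x * sqdist x) * (ycoord i x * ycoord i x) + 2 * (ck x * ck x * ck x) * (ycoord i x * ycoord i x)); first by ring.
    by rewrite sinv_sqdist//; ring.
  rewrite -mulr_sumr -/(sqdist x).
  transitivity (4 * ck x ^+ 2 * tau * (sinv x * sqdist x) + 2 * ck x ^+ 3 * sqdist x); first by ring.
  by rewrite sinv_sqdist// mulr1.
have E5 : gdot (fun y => 2 * ck y) cphi x = 4 * tau * sinv x * ck x.
  transitivity (\sum_(i < n) (4 * tau * sinv x ^+ 2 * ck x) * (ycoord i x * ycoord i x)).
    apply: eq_bigr => i _; rewrite pdZ// pd_ck// pd_cphi//; ring.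
  rewrite -mulr_sumr -/(sqdist x).
  transitivity (4 * tau * sinv x * ck x * (sinv x * sqdist x)); first by ring.
  by rewrite sinv_sqdist// mulr1.
rewrite /carlQ E1 E2 E3 E4 E5 G//.
have : ck x * sqdist x = tau * b * sqdist x - tau.
  by rewrite mulrBl -[tau * sinv x * _]mulrA sinv_sqdist// mulr1.
have : ck x = tau * b - tau * sinv x by [].
move: (gradsq v x) (\sum_(i < n) _ * _) (ck x) (sqdist x) (sinv x) (v x) => g Y k s r w kE ksE.
have E6 : k ^+ 3 * s = k ^+ 2 * (tau * b * s - tau) by rewrite -ksE; ring.
rewrite (_ : k * k * s = k * (tau * b * s - tau)); last by rewrite -ksE; ring.
transitivity (8 * tau * (r * Y) ^+ 2 + (4 * (k ^+ 3 * s) + 4 * k * (k * (tau * b * s - tau)) - 8 * k ^+ 2 + 8 * k ^+ 2 * tau - 8 * tau * r * k - 2 * (n%:R - 4) ^+ 2 * tau * r ^+ 2) * w ^+ 2).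
  by ring.
rewrite E6 (_ : 8 * tau * r * k = 8 * (tau * b - k) * k); last by rewrite kE; ring.
by ring.
Qed.

(** The 32 in [b] gives [b <= r / 2] for [r = |y|^-2] up to [|y| = 4 Rad]; thus [ck] is negative, of
    size at least [tau r / 2], and the main term is at least [2 tau^3 b r]. The first condition on
    [tau] lets half of it pay for the [(n - 4)^2] term. The other half is at least 4 by the second,
    as [b r >= 1 / (512 Rad^4)]. *)
Lemma carlQ_lower (Rad : R) v x : 0 < Rad -> 0 < tau -> b = (32 * Rad ^+ 2)^-1 ->
  1024 * (n%:R - 4) ^+ 2 * Rad ^+ 2 <= tau ^+ 2 -> 2048 * Rad ^+ 4 <= tau ^+ 3 ->
  16^-1 <= sqdist x <= 16 * Rad ^+ 2 ->
  4 * v x ^+ 2 <= carlQ cphi (fun y => 2 * ck y) v x.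
Proof.
move=> R0 t0 bE h1 h2 /andP[s1 s2].
have sx : 32^-1 < sqdist x by lra.
rewrite carlQ_weight//.
apply: (@le_trans _ _ (0 + 4 * v x ^+ 2)); first by rewrite add0r.
apply: lerD; first by apply: mulr_ge0; [apply: mulr_ge0 => //; exact: ltW|exact: sqr_ge0].
apply: ler_wpM2r; first exact: sqr_ge0.
have rs := sinv_sqdist sx.
have kE : ck x = tau * b - tau * sinv x by [].
move: (sinv x) (sqdist x) (ck x) s1 s2 sx rs kE => r s k s1 s2 sx rs kE.
have s0 : 0 < s by lra.
have rE : r = s^-1 by rewrite -[LHS]mulr1 -(divff (lt0r_neq0 s0)) mulrA rs mul1r.
have r16 : r <= 16 by rewrite rE -[leRHS]invrK lef_pV2// posrE invr_gt0.
have R20 : 0 < Rad ^+ 2 by rewrite exprn_gt0.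
have b0 : 0 < b by rewrite bE invr_gt0 mulr_gt0.
have bR : b * Rad ^+ 2 = 32^-1 by rewrite bE invfM mulfVK// gt_eqF.
have r0 : 0 < r by rewrite rE invr_gt0.
have rR : 1 <= r * (16 * Rad ^+ 2) by rewrite -[leLHS]rs ler_wpM2l// ltW.
have br : b <= r / 2.
  rewrite -(@ler_pM2r _ (16 * Rad ^+ 2)) ?mulr_gt0//; lra.
have A1 : 2 * tau ^+ 3 * b * r <= 8 * tau * b * k ^+ 2 * s.
  have -> : 8 * tau * b * k ^+ 2 * s = 8 * tau ^+ 3 * b * ((r - b) ^+ 2 * s) by rewrite kE; ring.
  have -> : 2 * tau ^+ 3 * b * r = 8 * tau ^+ 3 * b * (r / 4) by field.
  rewrite ler_pM2l ?mulr_gt0 ?exprn_gt0//.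
  have -> : r / 4 = (r / 2) ^+ 2 * s.
    by transitivity (r / 4 * (r * s)); [rewrite rs mulr1|field].
  rewrite ler_pM2r// ler_sqr ?nnegrE; lra.
have A2 : 0 <= - (8 * k * tau * b).
  have -> : - (8 * k * tau * b) = 8 * tau ^+ 2 * b * (r - b) by rewrite kE; ring.
  by rewrite !mulr_ge0 ?sqr_ge0// ?(ltW b0)//; lra.
have A3 : 2 * (n%:R - 4) ^+ 2 * tau * r ^+ 2 <= tau ^+ 3 * b * r.
  have -> : 2 * (n%:R - 4) ^+ 2 * tau * r ^+ 2 = (2 * (n%:R - 4) ^+ 2 * r) * (tau * r) by ring.
  have -> : tau ^+ 3 * b * r = (tau ^+ 2 * b) * (tau * r) by ring.
  rewrite ler_pM2r ?mulr_gt0//.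
  apply: (@le_trans _ _ (2 * (n%:R - 4) ^+ 2 * 16)).
    by rewrite ler_wpM2l// mulr_ge0// sqr_ge0.
  apply: (@le_trans _ _ (1024 * (n%:R - 4) ^+ 2 * Rad ^+ 2 * b)).
    rewrite -(mulrA _ _ b) [Rad ^+ 2 * b]mulrC bR; have := sqr_ge0 (n%:R - 4 : R); lra.
  by rewrite ler_pM2r.
have A4 : 4 <= tau ^+ 3 * b * r.
  apply: (@le_trans _ _ (2048 * Rad ^+ 4 * b * r)); last first.
    by rewrite ler_pM2r// ler_pM2r.
  have -> : 2048 * Rad ^+ 4 * b * r = 2048 * (b * Rad ^+ 2) * (Rad ^+ 2 * r) by ring.
  by rewrite bR; lra.
lra.
Qed.

Lemma carleman_weight (Rad : R) f : 0 < Rad -> 0 < tau -> b = (32 * Rad ^+ 2)^-1 ->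
  1024 * (n%:R - 4) ^+ 2 * Rad ^+ 2 <= tau ^+ 2 -> 2048 * Rad ^+ 4 <= tau ^+ 3 ->
  smooth f -> csupp f -> (forall x, sqdist x < 16^-1 -> f x = 0) ->
  (forall x, 16 * Rad ^+ 2 < sqdist x -> f x = 0) ->
  4 * Int (fun x => (expR (cphi x) * f x) ^+ 2) <=
  Int (fun x => (expR (cphi x) * lap f x) ^+ 2).
Proof.
move=> R0 t0 bE h1 h2 sf cf f1 f2.
have sp := smooth_cphi; have sk := smooth_ck.
set v := fun x => expR (cphi x) * f x.
have sv : smooth v by rewrite /v; smth.
have cv : csupp v by have [M fM] := cf; exists M => x Mx; rewrite /v fM// mulr0.
have bv : bcs (fun x => v x ^+ 2).
  apply: smooth_bcs; first by rewrite (_ : (fun x => _) = fun x => v x * v x)//; smth.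
  by have [M vM] := cv; exists M => x Mx; rewrite vM// expr0n.
apply: le_trans (carleman_conj sp sf cf (_ : smooth (fun y => 2 * ck y))); last by smth.
rewrite -IntZ//; apply: Int_le; [exact: bcs_scale|by apply: bcs_carlQ => //; smth|].
(* Off the closed annulus [f] vanishes in a neighbourhood of [x], so that the derivatives in [carlQ]
   vanish too. *)
move=> x; have Z : (\forall y \near x, v y = 0) ->
   4 * v x ^+ 2 <= carlQ cphi (fun y => 2 * ck y) v x.
  move=> v0; have px i : pd i v x = 0 by rewrite (pd_near i v0) pd_cst.
  rewrite /carlQ /gradsq (nbhs_singleton v0) big1; last first.
    by move=> i _; rewrite big1// => j _; rewrite px mul0r mulr0.
  rewrite [X in _ * _ * X]big1 ?expr0n ?(mulr0,subr0,addr0)//.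
  by move=> i _; rewrite px mulr0.
have [l1|g1] := ltP (sqdist x) 16^-1.
  apply: Z; have cs : {for x, continuous sqdist} by exact: smooth_continuous smooth_sqdist _.
  by have /cvgr_lt /(_ _ l1) := cs; apply: filterS => y /f1 fy; rewrite /v fy mulr0.
have [l2|g2] := ltP (16 * Rad ^+ 2) (sqdist x).
  by apply: Z; apply: filterS (near_sregE l2) => y /f2 fy; rewrite /v fy mulr0.
by apply: (@carlQ_lower Rad); rewrite ?g1.
Qed.

End weight.

(** * Cutting off, and Caccioppoli absorption of the first order errors *)

Section energy.
Variables (R : realType) (n : nat).
Implicit Types (f g : 'rV[R]_n -> R).

(** Cauchy-Schwarz by Lagrange's identity; summing over all ordered pairs counts each square twice,
    hence the factor 2. *)
Lemma sum_sqr_le (x y : 'I_n -> R) :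
  (\sum_(i < n) x i * y i) ^+ 2 <= (\sum_(i < n) x i * x i) * (\sum_(i < n) y i * y i).
Proof.
rewrite -subr_ge0 -(@pmulr_rge0 _ 2)//.
set A := \sum_(i < n) x i * x i; set B := \sum_(i < n) y i * y i; set G := \sum_(i < n) x i * y i.
suff -> : 2 * (A * B - G ^+ 2) =
    \sum_(i < n) \sum_(j < n) (x i * y j - x j * y i) ^+ 2.
  by apply: sumr_ge0 => i _; apply: sumr_ge0 => j _; exact: sqr_ge0.
transitivity (\sum_(i < n) (x i * x i * B + A * (y i * y i) + (-2 * G) * (x i * y i))).
  by rewrite !big_split /= -mulr_suml -!mulr_sumr -/A -/B -/G; ring.
apply: eq_bigr => i _; rewrite /A /B /G mulr_suml !mulr_sumr mulr_suml -!big_split /=.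
by apply: eq_bigr => j _; ring.
Qed.

Lemma gdot_sqr_le f g x : gdot f g x ^+ 2 <= gradsq f x * gradsq g x.
Proof. exact: sum_sqr_le. Qed.

Lemma csupp_eq0 f g : csupp f -> (forall x, f x = 0 -> g x = 0) -> csupp g.
Proof. by move=> [M fM] fg; exists M => x /fM /fg. Qed.

Variables (x0 : 'rV[R]_n) (tau b Rad : R) (chi eta : 'rV[R]_n -> R).
Hypotheses (R0 : 0 < Rad) (t0 : 0 < tau) (bE : b = (32 * Rad ^+ 2)^-1).
Hypotheses (h1 : 1024 * (n%:R - 4) ^+ 2 * Rad ^+ 2 <= tau ^+ 2)
  (h2 : 2048 * Rad ^+ 4 <= tau ^+ 3).
Let e x := expR (cphi x0 tau b x).
Hypotheses (schi : smooth chi) (seta : smooth eta) (cchi : csupp chi) (ceta : csupp eta).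
Hypotheses (chi_in : forall x, sqdist x0 x < 16^-1 -> chi x = 0)
  (chi_out : forall x, 16 * Rad ^+ 2 < sqdist x0 x -> chi x = 0).
Hypothesis eta_ge : forall x, e x ^+ 2 * gradsq chi x <= eta x.

Let sphi : smooth (cphi x0 tau b).
Proof. exact: smooth_cphi. Qed.
Let se : smooth e.
Proof. exact: smooth_exp. Qed.

(* [eta] dominates the weight in front of [|grad w|^2], which Caccioppoli's
   identity then trades for [w^2] and [w lap w]. *)
Definition enP x := 2 * (e x * chi x) ^+ 2 + 8 * eta x.
Definition enQ x := 4 * (e x * lap chi x) ^+ 2 + 8 * lap eta x + 8 * eta x.

Lemma csupp_lap f : csupp f -> csupp (lap f).
Proof.
move=> [M fM]; exists M => x Mx; rewrite lapE big1// => i _.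
by apply: (@pd_supp _ _ M) Mx => y; exact: pd_supp.
Qed.

Lemma smooth_enP : smooth enP. Proof. by rewrite /enP; smth. Qed.
Lemma smooth_enQ : smooth enQ. Proof. by rewrite /enQ; smth. Qed.

Lemma csupp_enP : csupp enP.
Proof.
apply: csupp_add; [apply: csupp_eq0 cchi _|apply: csupp_eq0 ceta _] => x ->; last by rewrite mulr0.
by rewrite mulr0 expr0n mulr0.
Qed.

Lemma csupp_enQ : csupp enQ.
Proof.
apply: csupp_add; last by apply: csupp_eq0 ceta _ => x ->; rewrite mulr0.
apply: csupp_add; last by apply: csupp_eq0 (csupp_lap ceta) _ => x ->; rewrite mulr0.
by apply: csupp_eq0 (csupp_lap cchi) _ => x ->; rewrite mulr0 expr0n mulr0.
Qed.

(** Applied to [chi w], the Carleman inequality produces [grad chi . grad w], which is integrated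
    away. Neither side then contains a gradient of [w], so the inequality survives a limit in which
    only [w] and [lap w] converge. *)
Lemma energy (w : 'rV[R]_n -> R) : smooth w ->
  4 * Int (fun x => (e x * chi x * w x) ^+ 2) <=
  Int (fun x => enP x * lap w x ^+ 2 + enQ x * w x ^+ 2).
Proof.
move=> sw.
have sf : smooth (fun x => chi x * w x) by smth.
have cf : csupp (fun x => chi x * w x) by apply: csupp_eq0 cchi _ => x ->; rewrite mul0r.
have := @carleman_weight R n x0 tau b Rad _ R0 t0 bE h1 h2 sf cf.
rewrite (_ : (fun x => (expR (cphi x0 tau b x) * (chi x * w x)) ^+ 2) =
   (fun x => (e x * chi x * w x) ^+ 2)); last by apply/funext => x; rewrite mulrA.
move=> H; apply: le_trans (H _ _) _.
- by move=> x /chi_in ->; rewrite mul0r.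
- by move=> x /chi_out ->; rewrite mul0r.
(* Caccioppoli's field: its divergence contains [eta |grad w|^2], and otherwise only [w], [lap w]
   and [lap eta]. *)
pose F (i : 'I_n) x := eta x * (w x * pd i w x) - 2^-1 * (w x * w x * pd i eta x).
have sF i : smooth (F i) by rewrite /F; smth.
have cF i : csupp (F i).
  apply: csupp_add; first by apply: csupp_eq0 ceta _ => x ->; rewrite mul0r.
  by apply: csupp_eq0 (csupp_pd i ceta) _ => x ->; rewrite !mulr0 oppr0.
have divF x : \sum_(i < n) pd i (F i) x =
    eta x * gradsq w x + eta x * w x * lap w x - 2^-1 * w x ^+ 2 * lap eta x.
  transitivity (\sum_(i < n) (eta x * (pd i w x * pd i w x) + eta x * w x * pd i (pd i w) x
     + (- 2^-1 * w x ^+ 2) * pd i (pd i eta) x)).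
    apply: eq_bigr => i _; rewrite /F pdB; [|by smth..].
    rewrite pdZ; last by smth.
    rewrite !pdM; [|by smth..].
    by field.
  by rewrite !big_split /= -!mulr_sumr -!lapE -/(gradsq w x);
    move: (lap w x) (lap eta x) (gradsq w x) => *; ring.
have sP := smooth_enP; have sQ := smooth_enQ.
have bF : bcs (fun x => \sum_(i < n) pd i (F i) x).
  by apply: bcs_sum => i; apply: smooth_bcs; [exact: smooth_pd|exact: csupp_pd].
have bR : bcs (fun x => enP x * lap w x ^+ 2 + enQ x * w x ^+ 2).
  apply: smooth_bcs; first by smth.
  apply: csupp_add; first by apply: csupp_eq0 csupp_enP _ => x ->; rewrite mul0r.
  by apply: csupp_eq0 csupp_enQ _ => x ->; rewrite mul0r.
(* Sixteen copies of the divergence supply [16 eta |grad w|^2]. Their cross term [16 eta w lap w] is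
   completed to [8 eta (lap w + w)^2] by the terms [8 eta] in [enP] and [enQ]. *)
rewrite -[leRHS]addr0 -(mulr0 16) -(Int_div sF cF) -IntZ// -IntD//; last exact: bcs_scale.
apply: Int_le.
- apply: smooth_bcs; first by smth.
  by apply: csupp_eq0 (csupp_lap cf) _ => x ->; rewrite mulr0 expr0n.
- by apply: bcs_add => //; exact: bcs_scale.
move=> x; rewrite divF lapM// /enP /enQ -/(gdot chi w x) -/(e x).
have := gdot_sqr_le chi w x; have := eta_ge x.
have gw0 : 0 <= gradsq w x by apply: sumr_ge0 => i _; rewrite -expr2 sqr_ge0.
have gc0 : 0 <= gradsq chi x by apply: sumr_ge0 => i _; rewrite -expr2 sqr_ge0.
move: (gdot chi w x) (gradsq w x) (gradsq chi x) (e x) (chi x) (lap w x) (lap chi x) (lap eta x) (eta x) (w x) gw0 gc0.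
move=> d gw gc a c lw lc le et y gw0 gc0 H1 H2.
have et0 : 0 <= et by apply: le_trans H1; rewrite mulr_ge0// sqr_ge0.
have H3 : (a * d) ^+ 2 <= et * gw.
  apply: (@le_trans _ _ (a ^+ 2 * gc * gw)); last by rewrite ler_wpM2r.
  by rewrite exprMn -mulrA ler_wpM2l// sqr_ge0.
(* The weights 2, 16 and 4 come from applying [(p + q)^2 <= 2 p^2 + 2 q^2] twice, splitting off the
   term with [lap w] first. *)
have H4 : (a * (lc * y + 2 * d + c * lw)) ^+ 2 <=
    2 * (a * c) ^+ 2 * lw ^+ 2 + 16 * (a * d) ^+ 2 + 4 * (a * lc) ^+ 2 * y ^+ 2.
  rewrite -subr_ge0.
  have -> : 2 * (a * c) ^+ 2 * lw ^+ 2 + 16 * (a * d) ^+ 2 + 4 * (a * lc) ^+ 2 * y ^+ 2 -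
    (a * (lc * y + 2 * d + c * lw)) ^+ 2 = (a * c * lw - (a * lc * y + 2 * a * d)) ^+ 2 +
     2 * (a * lc * y - 2 * a * d) ^+ 2 by ring.
  by apply: addr_ge0; [exact: sqr_ge0|apply: mulr_ge0 => //; exact: sqr_ge0].
have H5 : 0 <= 8 * (et * (lw + y) ^+ 2).
  by apply: mulr_ge0 => //; apply: mulr_ge0 => //; exact: sqr_ge0.
have H6 := ler_wpM2l (ler0n R 16) H3.
rewrite -subr_ge0; apply: le_trans (_ : _ <= 8 * (et * (lw + y) ^+ 2) + (16 * (et * gw) - 16 * (a * d) ^+ 2) + (2 * (a * c) ^+ 2 * lw ^+ 2 + 16 * (a * d) ^+ 2 + 4 * (a * lc) ^+ 2 * y ^+ 2 - (a * (lc * y + 2 * d + c * lw)) ^+ 2)) _.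
  by apply: addr_ge0; [apply: addr_ge0 => //; rewrite subr_ge0|rewrite subr_ge0].
by rewrite le_eqVlt; apply/orP; left; apply/eqP; field.
Qed.

End energy.

(** * Cutoff functions *)

Section step.
Variable R : realType.

(** It will be applied to multiples of the squared distance. The upper threshold 9/40 is a little
    below 1/4, so that [chi] is 1 near squared distance 1/4 and the fourfold dilation in [cutD] dies
    at 9/10, strictly before 1. *)
Definition step (t : R) : R := ebump (t - 16^-1) / (ebump (t - 16^-1) + ebump (9 / 40 - t)).

Lemma step_den_gt0 t : 0 < ebump (t - 16^-1) + ebump (9 / 40 - t) :> R.
Proof.
have [h|h] := ltP (16^-1) t.
  by apply: ltr_pwDl; [apply: bump_gt0; rewrite subr_gt0|exact: bump_ge0].
by apply: ltr_wpDl; [exact: bump_ge0|apply: bump_gt0; lra].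
Qed.

Lemma step_ge0 t : 0 <= step t.
Proof. by rewrite divr_ge0 ?bump_ge0// ltW// step_den_gt0. Qed.

Lemma step_le1 t : step t <= 1.
Proof. by rewrite ler_pdivrMr ?step_den_gt0// mul1r lerDl bump_ge0. Qed.

Lemma step_eq0 t : t <= 16^-1 -> step t = 0.
Proof. by move=> h; rewrite /step bump_le0 ?mul0r// subr_le0. Qed.

Lemma step_eq1 t : 9 / 40 <= t -> step t = 1.
Proof.
move=> h; have := step_den_gt0 t; rewrite /step (bump_le0 (_ : 9 / 40 - t <= 0)) ?subr_le0//.
by rewrite addr0 => h'; rewrite divff// gt_eqF.
Qed.

Lemma smooth_step n (f : 'rV[R]_n -> R) : smooth f -> smooth (fun y => step (f y)).
Proof.
move=> sf; have s1 : smooth (fun y => ebump (f y - 16^-1)) by apply: smooth_bump; smth.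
have s2 : smooth (fun y => ebump (9 / 40 - f y)) by apply: smooth_bump; smth.
apply: smooth_mul => //; apply: smooth_inv; last by smth.
by move=> x; rewrite gt_eqF// step_den_gt0.
Qed.

End step.

Section cutoffs.
Variables (R : realType) (n : nat).
Implicit Types (f g : 'rV[R]_n -> R) (x z : 'rV[R]_n) (c : R).

Lemma sqdist_ge0 x0 x : 0 <= sqdist x0 x.
Proof. by apply: sumr_ge0 => i _; rewrite -expr2 sqr_ge0. Qed.

Lemma norm_sqdist x0 x : `|x - x0| ^+ 2 <= sqdist x0 x.
Proof.
rewrite -(sqr_sqrtr (sqdist_ge0 x0 x)) ler_sqr ?nnegrE ?sqrtr_ge0//.
apply: rV_norm_le => [|i]; first exact: sqrtr_ge0.
rewrite -ler_sqr ?nnegrE ?sqrtr_ge0// sqr_sqrtr ?sqdist_ge0// real_normK ?num_real// expr2.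
rewrite /sqdist (bigD1 i)//= /ycoord !mxE lerDl.
by apply: sumr_ge0 => j _; rewrite -expr2 sqr_ge0.
Qed.

Lemma csupp_sqdist x0 (K : R) f : (forall x, K < sqdist x0 x -> f x = 0) -> csupp f.
Proof.
move=> fK; exists (`|x0| + (1 + `|K|)) => x xM; apply: fK; apply: lt_le_trans (norm_sqdist x0 x).
have h : 1 + `|K| < `|x - x0|.
  by rewrite -(ltrD2l `|x0|); apply: lt_le_trans xM _; rewrite -{1}(subrKC x0 x) ler_normD.
apply: (@le_lt_trans _ _ ((1 + `|K|) ^+ 2)); last by rewrite ltr_pXn2r ?nnegrE// addr_ge0.
by have := ler_norm K; have := sqr_ge0 (`|K| : R); have := normr_ge0 K; nra.
Qed.

Definition zoom x0 c f x := f (- c *: x0 + c *: x).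

Lemma sqdist_zoom x0 c x : sqdist 0 (- c *: x0 + c *: x) = c ^+ 2 * sqdist x0 x.
Proof.
by rewrite /sqdist mulr_sumr; apply: eq_bigr => i _; rewrite /ycoord !mxE; ring.
Qed.

Lemma smooth_zoom x0 c f : smooth f -> smooth (zoom x0 c f).
Proof. exact: smooth_affine. Qed.

Lemma pd_zoom i x0 c f x : smooth f -> pd i (zoom x0 c f) x = c * zoom x0 c (pd i f) x.
Proof.
move=> sf; rewrite /zoom !pdE; have [_] := derive_affine (- c *: x0) c x (evec R i) (smooth_diff sf).
exact.
Qed.

Lemma lap_zoom x0 c f x : smooth f -> lap (zoom x0 c f) x = c ^+ 2 * zoom x0 c (lap f) x.
Proof.
move=> sf; rewrite /zoom !lapE mulr_sumr; apply: eq_bigr => i _.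
have s1 := smooth_pd i sf; transitivity (pd i (fun y => c * zoom x0 c (pd i f) y) x).
  by congr (pd i _ x); apply/funext => y; rewrite -pd_zoom.
rewrite pdZ; last exact: smooth_zoom.
by rewrite pd_zoom// mulrA -expr2.
Qed.

Lemma gradsq_zoom x0 c f x : smooth f ->
  gradsq (zoom x0 c f) x = c ^+ 2 * zoom x0 c (gradsq f) x.
Proof.
move=> sf; rewrite /zoom /gradsq mulr_sumr; apply: eq_bigr => i _.
by rewrite pd_zoom// /zoom; ring.
Qed.

Lemma gradsq_near f g x : (\near x, f x = g x) -> gradsq f x = gradsq g x.
Proof. by move=> fg; apply: eq_bigr => i _; rewrite (pd_near i fg). Qed.

Lemma gradsq_cst c x : gradsq (fun=> c) x = 0.
Proof. by rewrite /gradsq big1// => i _; rewrite pd_cst mul0r. Qed.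

Lemma lap_cst c x : lap (fun=> c) x = 0.
Proof.
rewrite lapE big1// => i _; rewrite (_ : pd i (fun=> c) = fun=> 0) ?pd_cst//.
by apply/funext => y; rewrite pd_cst.
Qed.

Lemma near_sqdist_lt x0 (t : R) x : sqdist x0 x < t -> \forall y \near x, sqdist x0 y < t.
Proof.
move=> sx; have cs : {for x, continuous (sqdist x0)} by exact: smooth_continuous (smooth_sqdist x0) _.
by have /cvgr_lt := cs; apply.
Qed.

Lemma gradsq_ge0 f x : 0 <= gradsq f x.
Proof. by apply: sumr_ge0 => i _; rewrite -expr2 sqr_ge0. Qed.

Lemma gradsq_1sub f x : smooth f -> gradsq (fun y => 1 - f y) x = gradsq f x.
Proof.
move=> sf; apply: eq_bigr => i _; rewrite pdB; [|by smth..].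
by rewrite pd_cst; ring.
Qed.

Lemma lapD f g x : smooth f -> smooth g -> lap (fun y => f y + g y) x = lap f x + lap g x.
Proof.
move=> sf sg; rewrite !lapE -big_split; apply: eq_bigr => i _ /=.
transitivity (pd i (fun y => pd i f y + pd i g y) x); last by apply: pdD; smth.
by congr (pd i _ x); apply/funext => y; rewrite pdD.
Qed.

Lemma lapZ c f x : smooth f -> lap (fun y => c * f y) x = c * lap f x.
Proof.
move=> sf; rewrite !lapE mulr_sumr; apply: eq_bigr => i _ /=.
transitivity (pd i (fun y => c * pd i f y) x); last by apply: pdZ; smth.
by congr (pd i _ x); apply/funext => y; rewrite pdZ.
Qed.

Lemma lap_comb c a b f g x : smooth f -> smooth g ->
  lap (fun y => c * (a * f y + b * g y)) x = c * (a * lap f x + b * lap g x).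
Proof. by move=> sf sg; rewrite lapZ ?lapD ?lapZ//; smth. Qed.

Lemma lap_1sub f x : smooth f -> lap (fun y => 1 - f y) x = - lap f x.
Proof.
move=> sf; rewrite (_ : (fun y => _) = fun y => 1 + -1 * f y).
  by rewrite lapD ?lapZ ?lap_cst ?add0r ?mulN1r//; smth.
by apply/funext => y; rewrite mulN1r.
Qed.

Definition cutA z := step (sqdist 0 z).
(* Equal to 1 wherever the gradient of [cutA] does not vanish. *)
Definition cutD z := step (4 * sqdist 0 z) * (1 - step (4^-1 * sqdist 0 z)).

Lemma smooth_cutA : smooth cutA.
Proof. exact/smooth_step/smooth_sqdist. Qed.

Lemma smooth_cutD : smooth cutD.
Proof.
have s1 := @smooth_sqdist R n 0.
have s2 : smooth (fun z => step (4 * sqdist 0 z)) by apply: smooth_step; smth.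
have s3 : smooth (fun z => step (4^-1 * sqdist 0 z)) by apply: smooth_step; smth.
by rewrite /cutD; smth.
Qed.

Lemma cutD01 z : 0 <= cutD z <= 1.
Proof.
have := step_ge0 (4 * sqdist 0 z); have := step_le1 (4 * sqdist 0 z).
have := step_ge0 (4^-1 * sqdist 0 z); have := step_le1 (4^-1 * sqdist 0 z).
by rewrite /cutD => *; nra.
Qed.

Lemma cutD_eq1 z : 16^-1 <= sqdist 0 z <= 4^-1 -> cutD z = 1.
Proof.
by move=> /andP[h1 h2]; rewrite /cutD step_eq1 ?step_eq0 ?subr0 ?mulr1//; lra.
Qed.

Lemma cutD_eq0 z : 9 / 10 <= sqdist 0 z -> cutD z = 0.
Proof. by move=> h; rewrite /cutD (@step_eq1 _ (4^-1 * _)) ?subrr ?mulr0//; lra. Qed.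

Lemma lap_cutD_eq0 z : 9 / 10 < sqdist 0 z -> lap cutD z = 0.
Proof.
move=> h; rewrite (@lap_near _ _ _ (fun=> 0)) ?lap_cst//.
by apply: filterS (near_sregE h) => y /ltW; exact: cutD_eq0.
Qed.

(** One constant for all centres and scales, because every cutoff is a rescaling of one of two fixed
    functions whose derivatives have compact support. *)
Lemma cut_bounds : exists2 C, 0 <= C & forall x0 c z,
  [/\ 0 <= zoom x0 c (gradsq cutA) z <= C, `|zoom x0 c (lap cutA) z| <= C &
    `|zoom x0 c (lap cutD) z| <= C].
Proof.
have sA := smooth_cutA; have sD := smooth_cutD.
have A1 z : 9 / 40 < sqdist 0 z -> \forall y \near z, cutA y = 1.
  by move=> h; apply: filterS (near_sregE h) => y /ltW; exact: step_eq1.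
have [|C1 h1] := continuous_csupp_bounded (smooth_continuous (smooth_gradsq sA)).
  by apply: (@csupp_sqdist 0 (9 / 40)) => z /A1 /gradsq_near ->; rewrite gradsq_cst.
have [|C2 h2] := continuous_csupp_bounded (smooth_continuous (smooth_lap sA)).
  by apply: (@csupp_sqdist 0 (9 / 40)) => z /A1 /lap_near ->; rewrite lap_cst.
have [|C3 h3] := continuous_csupp_bounded (smooth_continuous (smooth_lap sD)).
  by apply: (@csupp_sqdist 0 (9 / 10)) => z; exact: lap_cutD_eq0.
have p1 := le_trans (normr_ge0 _) (h1 0); have p2 := le_trans (normr_ge0 _) (h2 0).
have p3 := le_trans (normr_ge0 _) (h3 0).
exists (C1 + C2 + C3) => [|x0 c z]; first by rewrite !addr_ge0.
split; rewrite /zoom.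
- by rewrite gradsq_ge0; apply: le_trans (ler_norm _) (le_trans (h1 _) _); lra.
- by apply: le_trans (h2 _) _; lra.
- by apply: le_trans (h3 _) _; lra.
Qed.

Lemma zoom_cutA x0 c x : zoom x0 c cutA x = step (c ^+ 2 * sqdist x0 x).
Proof. by rewrite /zoom /cutA sqdist_zoom. Qed.

Lemma zoom_cutD01 x0 c x : 0 <= zoom x0 c cutD x <= 1.
Proof. exact: cutD01. Qed.

Lemma zoom_cutD1 x0 c x : 16^-1 <= c ^+ 2 * sqdist x0 x <= 4^-1 -> zoom x0 c cutD x = 1.
Proof. by move=> h; rewrite /zoom cutD_eq1// sqdist_zoom. Qed.

Lemma zoom_cutD0 x0 c x : 9 / 10 <= c ^+ 2 * sqdist x0 x -> zoom x0 c cutD x = 0.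
Proof. by move=> h; rewrite /zoom cutD_eq0// sqdist_zoom. Qed.

Lemma zoom_lap_cutD0 x0 c x : 9 / 10 < c ^+ 2 * sqdist x0 x -> zoom x0 c (lap cutD) x = 0.
Proof. by move=> h; rewrite /zoom lap_cutD_eq0// sqdist_zoom. Qed.

Opaque cutA cutD zoom gradsq step.

(** [E1] and [E2] bound the squared weight on the two annuli where [chi] varies. The majorant [eta]
    is built from these constants rather than from the weight, so that [lap eta] involves no
    derivative of the weight and [C] does not depend on [tau], [Rad] or [x0]. *)
Lemma cutoffs : exists2 C, 0 < C & forall x0 (Rad E1 E2 : R) (e : 'rV[R]_n -> R),
  1 <= Rad -> 0 <= E1 -> 0 <= E2 ->
  (forall x, 16^-1 <= sqdist x0 x <= 9 / 40 -> e x ^+ 2 <= E1) ->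
  (forall x, 4 * Rad ^+ 2 <= sqdist x0 x <= 16 * Rad ^+ 2 -> e x ^+ 2 <= E2) ->
  exists chi eta : 'rV[R]_n -> R,
  [/\ [/\ smooth chi, smooth eta, csupp chi & csupp eta],
    (forall x, sqdist x0 x < 16^-1 -> chi x = 0),
    (forall x, 16 * Rad ^+ 2 < sqdist x0 x -> chi x = 0),
    (forall x, 4^-1 <= sqdist x0 x <= 4 * Rad ^+ 2 -> chi x = 1) &
    (forall x, e x ^+ 2 * gradsq chi x <= eta x /\
      4 * (e x * lap chi x) ^+ 2 + 8 * lap eta x + 16 * eta x <=
      C * (E1 * (sqdist x0 x < 1)%R%:R + E2 * (sqdist x0 x < 64 * Rad ^+ 2)%R%:R))].
Proof.
have [C C0 Cb] := cut_bounds.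
(* [4 C^2] pays for [lap chi], [8 C^2] for [lap eta] and [16 C] for [eta]; the 1 makes the constant
   positive. *)
exists (4 * C ^+ 2 + C * (8 * C + 16) + 1).
  by rewrite ltr_wpDl// addr_ge0 ?mulr_ge0 ?sqr_ge0// addr_ge0 ?mulr_ge0.
move=> x0 Rad E1 E2 e R1 E10 E20 he1 he2.
have sA := smooth_cutA; have sD := smooth_cutD.
have R21 : 1 <= Rad ^+ 2 by rewrite exprn_ege1.
(* At this scale the step starts at squared distance [4 Rad^2] and ends at [72/5 Rad^2], before
   [16 Rad^2]. *)
pose c := (8 * Rad)^-1.
have cE : c ^+ 2 = 64^-1 / Rad ^+ 2 by rewrite /c; field; rewrite lt0r_neq0//; lra.
have cR : c ^+ 2 * Rad ^+ 2 = 64^-1 by rewrite cE mulfVK// lt0r_neq0//; lra.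
have c20 : 0 < c ^+ 2 by rewrite cE divr_gt0//; lra.
have c21 : c ^+ 2 <= 1 by nra.
pose A1 := zoom x0 1 cutA; pose A2 := zoom x0 c cutA.
have A1E x : A1 x = step (sqdist x0 x) by rewrite /A1 zoom_cutA expr1n mul1r.
have A2E x : A2 x = step (c ^+ 2 * sqdist x0 x) by rewrite /A2 zoom_cutA.
have sA1 : smooth A1 by exact: smooth_zoom.
have sA2 : smooth A2 by exact: smooth_zoom.
pose chi x := A1 x * (1 - A2 x).
pose eta x := C * (E1 * zoom x0 1 cutD x + E2 * zoom x0 c cutD x).
have sD1 : smooth (zoom x0 1 cutD) by exact: smooth_zoom.
have sD2 : smooth (zoom x0 c cutD) by exact: smooth_zoom.
have schi : smooth chi.
  by apply: smooth_mul; [exact: sA1|apply: smooth_sub; [exact: smooth_cst|exact: sA2]].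
have seta : smooth eta.
  apply: smooth_mul; first exact: smooth_cst.
  by apply: smooth_add; apply: smooth_mul; [exact: smooth_cst|exact: sD1|exact: smooth_cst|exact: sD2].
have chi_in x : sqdist x0 x < 16^-1 -> chi x = 0.
  by move=> h; rewrite /chi A1E step_eq0 ?mul0r// ltW.
have chi_out x : 16 * Rad ^+ 2 < sqdist x0 x -> chi x = 0.
  move=> h; rewrite /chi A2E step_eq1 ?subrr ?mulr0//.
  have : c ^+ 2 * (16 * Rad ^+ 2) <= c ^+ 2 * sqdist x0 x by rewrite ler_wpM2l// ltW.
  by rewrite mulrCA cR; lra.
have A1_1 x : 9 / 40 <= sqdist x0 x -> A1 x = 1 by rewrite A1E => /step_eq1.
have A2_0 x : sqdist x0 x <= 4 * Rad ^+ 2 -> A2 x = 0.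
  move=> h; rewrite A2E step_eq0//.
  have : c ^+ 2 * sqdist x0 x <= c ^+ 2 * (4 * Rad ^+ 2) by rewrite ler_wpM2l// ltW.
  by rewrite (mulrCA _ 4) cR; lra.
have cases x : [\/ 16^-1 <= sqdist x0 x <= 9 / 40 /\ (gradsq chi x <= C /\ `|lap chi x| <= C),
     4 * Rad ^+ 2 <= sqdist x0 x <= 16 * Rad ^+ 2 /\ (gradsq chi x <= C /\ `|lap chi x| <= C) |
     gradsq chi x = 0 /\ lap chi x = 0].
  have near_cst a : (\near x, chi x = a) -> gradsq chi x = 0 /\ lap chi x = 0.
    by move=> h; rewrite (gradsq_near h) (lap_near h) gradsq_cst lap_cst.
  have [l1|g1] := ltP (sqdist x0 x) 16^-1.
    by apply/Or33/(near_cst 0); apply: filterS (near_sqdist_lt l1) => y; exact: chi_in.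
  have [l2|g2] := leP (sqdist x0 x) (9 / 40).
    apply: Or31; split => //.
    have h : \near x, chi x = A1 x.
      have : sqdist x0 x < 4 * Rad ^+ 2 by lra.
      move=> /near_sqdist_lt; apply: filterS => y /ltW /A2_0.
      rewrite /chi; move: (A1 y) (A2 y) => p q ->.
      by rewrite subr0 mulr1.
    rewrite (gradsq_near h) (lap_near h) gradsq_zoom// lap_zoom// expr1n !mul1r.
    by have [/andP[_ ? ?] _] := Cb x0 1 x.
  have [l3|g3] := ltP (sqdist x0 x) (4 * Rad ^+ 2).
    apply/Or33/(near_cst 1).
    apply: filterS2 (near_sqdist_lt l3) (near_sregE g2) => y /ltW /A2_0 h1 /ltW /A1_1 h2.
    by rewrite /chi h1 h2 subr0 mulr1.
  have [l4|g4] := leP (sqdist x0 x) (16 * Rad ^+ 2).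
    apply: Or32; split => //.
    have h : \near x, chi x = 1 - A2 x.
      apply: filterS (near_sregE g2) => y /ltW /A1_1.
      by rewrite /chi => ->; rewrite mul1r.
    rewrite (gradsq_near h) (lap_near h) gradsq_1sub// lap_1sub//.
    rewrite normrN gradsq_zoom// lap_zoom// normrM (ger0_norm (ltW c20)).
    have [/andP[g0 b1] b2 _] := Cb x0 c x.
    by split; [apply: le_trans b1|apply: le_trans b2]; rewrite ler_piMl.
  by apply/Or33/(near_cst 0); apply: filterS (near_sregE g4) => y; exact: chi_out.
have D1_0 x : 0 <= zoom x0 1 cutD x <= (sqdist x0 x < 1)%R%:R.
  have /andP[-> h] := zoom_cutD01 x0 1 x => /=.
  have [l1//|g1] := ltP (sqdist x0 x) 1.
  by rewrite zoom_cutD0// expr1n mul1r; lra.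
have D2_0 x : 0 <= zoom x0 c cutD x <= (sqdist x0 x < 64 * Rad ^+ 2)%R%:R.
  have /andP[-> h] := zoom_cutD01 x0 c x => /=.
  have [l1//|g1] := ltP (sqdist x0 x) (64 * Rad ^+ 2).
  rewrite zoom_cutD0//.
  have : c ^+ 2 * (64 * Rad ^+ 2) <= c ^+ 2 * sqdist x0 x by rewrite ler_wpM2l// ltW.
  by rewrite mulrCA cR; lra.
exists chi, eta; split => //.
- split => //; first by apply: csupp_sqdist chi_out.
  apply: (@csupp_sqdist x0 (64 * Rad ^+ 2)) => x h.
  have := D1_0 x; have := D2_0 x; rewrite !ltNge (ltW h) /=.
  rewrite (_ : (1 <= sqdist x0 x)) /=; last by lra.
  by move=> /le_anti h1 /le_anti h2; rewrite /eta -h1 -h2 !mulr0 addr0 mulr0.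
- move=> x /andP[h1 h2]; rewrite /chi A1_1 ?A2_0 ?subr0 ?mulr1//; lra.
move=> x.
have eta0 : 0 <= eta x.
  have /andP[p1 _] := D1_0 x; have /andP[p2 _] := D2_0 x.
  exact: (mulr_ge0 C0 (addr_ge0 (mulr_ge0 E10 p1) (mulr_ge0 E20 p2))).
have etaU : eta x <= C * (E1 * (sqdist x0 x < 1)%R%:R + E2 * (sqdist x0 x < 64 * Rad ^+ 2)%R%:R).
  have /andP[_ ?] := D1_0 x; have /andP[_ ?] := D2_0 x.
  by rewrite ler_wpM2l// lerD// ler_wpM2l.
have lapeta : lap eta x <= C * (C * (E1 * (sqdist x0 x < 1)%R%:R + E2 * (sqdist x0 x < 64 * Rad ^+ 2)%R%:R)).
  have -> : lap eta x = C * (E1 * lap (zoom x0 1 cutD) x + E2 * lap (zoom x0 c cutD) x).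
    exact: (lap_comb C E1 E2 x sD1 sD2).
  rewrite ler_wpM2l// mulrDr lerD// mulrCA ler_wpM2l// lap_zoom//.
    rewrite expr1n mul1r; have [_ _ b3] := Cb x0 1 x.
    have [l1|g1] := ltP (sqdist x0 x) 1; first by rewrite mulr1; apply: le_trans b3; exact: ler_norm.
    by rewrite zoom_lap_cutD0 ?mulr0// expr1n mul1r; lra.
  have [_ _ b3] := Cb x0 c x.
  have [l1|g1] := ltP (sqdist x0 x) (64 * Rad ^+ 2).
    rewrite mulr1; apply: le_trans (ler_norm _) _; rewrite normrM (ger0_norm (ltW c20)).
    by apply: le_trans b3; rewrite ler_piMl.
  rewrite zoom_lap_cutD0 ?mulr0//.
  have : c ^+ 2 * (64 * Rad ^+ 2) <= c ^+ 2 * sqdist x0 x by rewrite ler_wpM2l// ltW.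
  by rewrite mulrCA cR; lra.
set S := E1 * _ + E2 * _ in etaU lapeta *.
have S0 : 0 <= S by rewrite /S addr_ge0 ?mulr_ge0 ?ler0n.
have main E : 0 <= E -> E <= S -> e x ^+ 2 <= E -> `|lap chi x| <= C ->
   4 * (e x * lap chi x) ^+ 2 <= 4 * C ^+ 2 * S.
  move=> E0 ES eE lC; rewrite -mulrA ler_wpM2l// exprMn mulrC ler_pM ?sqr_ge0//.
    by rewrite -real_normK ?num_real// ler_sqr ?nnegrE.
  exact: le_trans ES.
suff [K1 K2] : e x ^+ 2 * gradsq chi x <= eta x /\ 4 * (e x * lap chi x) ^+ 2 <= 4 * C ^+ 2 * S.
  split; first exact: K1.
  by move: (lap eta x) (eta x) (4 * _) lapeta etaU K2 => *; lra.
have [[/andP[h1 h2] [g l]]|[/andP[h1 h2] [g l]]|[-> ->]] := cases x.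
- have ex : e x ^+ 2 <= E1 by apply: he1; rewrite h1.
  split.
    apply: (@le_trans _ _ (C * E1)); first by rewrite mulrC ler_pM ?sqr_ge0// gradsq_ge0.
    have /andP[d2 _] := D2_0 x.
    rewrite ler_wpM2l// (@zoom_cutD1 x0 1); first by rewrite mulr1 lerDl; exact: mulr_ge0.
    by rewrite expr1n mul1r; lra.
  apply: (main E1) => //; rewrite /S (_ : sqdist x0 x < 1); last by lra.
  by rewrite mulr1 lerDl mulr_ge0.
- have ex : e x ^+ 2 <= E2 by apply: he2; rewrite h1.
  split.
    apply: (@le_trans _ _ (C * E2)); first by rewrite mulrC ler_pM ?sqr_ge0// gradsq_ge0.
    have /andP[d1 _] := D1_0 x.
    rewrite ler_wpM2l// (@zoom_cutD1 x0 c); first by rewrite mulr1 lerDr; exact: mulr_ge0.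
    have : c ^+ 2 * (4 * Rad ^+ 2) <= c ^+ 2 * sqdist x0 x by rewrite ler_wpM2l// ltW.
    have : c ^+ 2 * sqdist x0 x <= c ^+ 2 * (16 * Rad ^+ 2) by rewrite ler_wpM2l// ltW.
    by rewrite (mulrCA _ 16) (mulrCA _ 4) cR; lra.
  apply: (main E2) => //; rewrite /S (_ : sqdist x0 x < 64 * Rad ^+ 2); last by lra.
  by rewrite mulr1 lerDr mulr_ge0.
by rewrite mulr0 mulr0 expr0n mulr0; split => //; rewrite !mulr_ge0// sqr_ge0.
Qed.

End cutoffs.

Lemma enorm_le_norm (R : realType) (n : nat) (x : 'rV[R]_n) (M : R) : `|x| <= M -> enorm x <= Num.sqrt (n%:R * M ^+ 2).
Proof.
move=> xM; rewrite /enorm ler_wsqrtr//.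
have -> : n%:R * M ^+ 2 = \sum_(i < n) M ^+ 2 by rewrite sumr_const card_ord mulr_natl.
apply: ler_sum => i _; rewrite -(real_normK (num_real (x ord0 i))) ler_sqr ?nnegrE//.
  exact: le_trans (rV_coord_le x i) xM.
by apply: le_trans xM.
Qed.

(** * Mollifying the equation and passing to the limit *)

Section regularization.
Variables (R : realType) (n : nat).
Implicit Types (f r P : 'rV[R]_n -> R).
Local Notation leb := (rVlebesgue R n).

Lemma smooth_bcs_mollifier d r : mollifier d r -> bcs r.
Proof.
by move=> mr; apply: smooth_bcs; [have [] := mr|exact: mollifier_csupp mr].
Qed.

Lemma convol_norm_le f r (d K : R) x : bcs f -> mollifier d r -> (forall y, `|f y| <= K) ->
  `|convol f r x| <= K.
Proof.
move=> bf mr fK; have [sr r0 r1 re rd] := mr; have cr := mollifier_csupp mr.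
have K0 : 0 <= K by apply: le_trans (fK 0).
have bfr := convol_bcs x bf (smooth_continuous sr).
have brx : bcs (fun y => r (x - y)).
  by apply: smooth_bcs; [exact: smooth_refl|exact: csupp_refl].
apply: le_trans (Int_norm bfr) _.
apply: (@le_trans _ _ (Int (fun y => K * r (x - y)))).
  apply: Int_le; [exact: bcs_norm|exact: bcs_scale|] => y.
  by rewrite normrM (ger0_norm (r0 _)) ler_wpM2r.
rewrite IntZ// (_ : (fun y => r (x - y)) = fun y => r (y + - x)).
  by rewrite Int_shift ?r1 ?mulr1//; exact: smooth_bcs_mollifier mr.
by apply/funext => y; rewrite -re opprB.
Qed.

(** Factor [a^2 - b^2 = (a + b)(a - b)] with [a] and [b] bounded by [K]: closeness in L^1 suffices
    for quadratic integrals with a bounded weight. *)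
Lemma convol_sqr_close P f r (d K B : R) : bcs P -> bcs f -> mollifier d r ->
  (forall x, `|f x| <= K) -> (forall x, `|P x| <= B) ->
  `|Int (fun x => P x * convol f r x ^+ 2) - Int (fun x => P x * f x ^+ 2)| <=
  B * (2 * K) * Int (fun x => `|convol f r x - f x|).
Proof.
move=> bP bf mr fK PB; have [sr _ _ _ _] := mr; have cr := mollifier_csupp mr.
have scv := convol_smooth bf sr cr.
have bcv : bcs (convol f r).
  by apply: smooth_bcs scv _; apply: convol_csupp => //; have [] := bf.
have cK x := @convol_norm_le f r d K x bf mr fK.
have K0 : 0 <= K by apply: le_trans (fK 0).
have B0 : 0 <= B by apply: le_trans (PB 0).
have b1 : bcs (fun x => P x * convol f r x ^+ 2) by apply: bcs_mul => //; exact: bcs_mul.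
have b2 : bcs (fun x => P x * f x ^+ 2) by apply: bcs_mul => //; exact: bcs_mul.
have b3 : bcs (fun x => `|convol f r x - f x|) by apply: bcs_norm; exact: bcs_sub.
rewrite -IntB// -IntZ//; apply: le_trans (Int_norm (bcs_sub b1 b2)) _.
apply: Int_le; [by apply: bcs_norm; exact: bcs_sub|exact: bcs_scale|] => x.
rewrite (_ : _ - _ = P x * ((convol f r x + f x) * (convol f r x - f x))); last by ring.
rewrite !normrM mulrA ler_wpM2r// ler_pM//.
by rewrite (le_trans (ler_normD _ _))//; have := cK x; have := fK x; lra.
Qed.

Lemma mollifier_le (d d' : R) r : d <= d' -> mollifier d r -> mollifier d' r.
Proof. by move=> dd [sr r0 r1 re rd]; split => // x /(le_trans dd); exact: rd. Qed.

Variables (V u : 'rV[R]_n -> R).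
Hypotheses (mV : Rn_measurable_fun V) (V1 : ess_bounded_by_1 V) (uV : dist_solution V u).
Hypothesis u_loc : forall M : R, exists C : R, forall x, `|x| <= M -> `|u x| <= C.

Let mV' : measurable_fun setT V. Proof. exact: Rn_measurable_fun_rV. Qed.
Let mu' : measurable_fun setT u. Proof. by apply: Rn_measurable_fun_rV; case: uV. Qed.

Let Vbad := [set y | 1 < `|V y|].

Let mVbad : measurable Vbad.
Proof.
rewrite -[Vbad]setTI; have : measurable_fun setT (fun y => `|V y|) by exact: measurableT_comp.
by move=> /(_ measurableT `]1, +oo[%classic); rewrite preimage_itvoy; apply.
Qed.

Let Vbad0 : leb Vbad = 0%E.
Proof.
have := V1; rewrite /ess_bounded_by_1 ge0_intRnE.
- by rewrite integral_indic// setIT.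
- by apply/measurable_EFinP; exact: measurable_indic.
- by move=> x; rewrite lee_fin.
Qed.

(* Agrees with [V] almost everywhere, but is bounded pointwise. *)
Definition Vcut x : R := \1_(~` Vbad) x * V x.
(** The margin 1 is room for a mollifier of radius at most 1: at points of norm at most [M] its
    convolution sees only values of [u] itself. *)
Definition ucut (M : R) x : R := \1_[set y : 'rV[R]_n | `|y| <= M + 1] x * u x.

Lemma measurable_Vcut : measurable_fun setT Vcut.
Proof. by apply: measurable_funM => //; apply: measurable_indic; exact: measurableC. Qed.

Lemma Vcut_le1 x : `|Vcut x| <= 1.
Proof.
rewrite /Vcut indicE; have [h|h] := boolP (x \in ~` Vbad); last by rewrite mul0r normr0.
by rewrite mul1r; move: h; rewrite inE /Vbad /= => /negP; rewrite -leNgt.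
Qed.

Lemma ucutE M x : `|x| <= M + 1 -> ucut M x = u x.
Proof. by move=> h; rewrite /ucut indicE mem_set// mul1r. Qed.

Lemma bcs_ucut M : bcs (ucut M).
Proof.
split.
- by apply: measurable_funM => //; apply: measurable_indic; exact: measurable_rV_ballN.
- have [C uC] := u_loc (M + 1); exists `|C| => x.
  rewrite /ucut indicE; have [h|h] := boolP (x \in _); last by rewrite mul0r normr0.
  by rewrite mul1r; apply: le_trans (ler_norm _); apply: uC; move: h; rewrite inE.
- exists (M + 1) => x h; rewrite /ucut indicE memNset ?mul0r//=.
  by apply/negP; rewrite -ltNge.
Qed.

Lemma bcs_Vu M : bcs (fun x => Vcut x * ucut M x).
Proof. exact: (bcs_mul_bounded measurable_Vcut Vcut_le1 (bcs_ucut M)). Qed.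

Lemma test_fun_smooth f : smooth f -> csupp f -> test_fun f.
Proof.
move=> sf [M fM]; split.
  by move=> vs x; apply: smooth_diff; exact: smooth_iterD.
exists (Num.sqrt (n%:R * M ^+ 2)) => x; rewrite !ltNge => h; apply: fM; rewrite ltNge.
by apply: contra h; exact: enorm_le_norm.
Qed.

(** The equation is tested with [y |-> r (x - y)], which is supported where [ucut M] equals [u]. The
    whole product [V u] is mollified, so [V] needs no regularity. *)
Lemma convol_pde (M d : R) r x : mollifier d r -> d <= 1 -> `|x| <= M ->
  lap (convol (ucut M) r) x = convol (fun y => Vcut y * ucut M y) r x.
Proof.
move=> mr d1 xM; have [sr r0 r1 re rd] := mr; have cr := mollifier_csupp mr.
rewrite convol_lap//; last exact: bcs_ucut.
set phi := fun y => r (x - y).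
have sphi : smooth phi by exact: smooth_refl.
have cphi : csupp phi by exact: csupp_refl.
have far y : M + 1 < `|y| -> d <= `|x - y|.
  by have := ler_normB x (x - y); rewrite opprB addrC subrK; lra.
have phi0 y : M + 1 < `|y| -> phi y = 0 by move=> /far /rd.
have lapphi y : lap phi y = lap r (x - y) by exact: lap_refl.
have lphi0 y : M + 1 < `|y| -> lap phi y = 0.
  move=> h; rewrite lapE big1// => i _; apply: (@pd_supp _ _ (M + 1)) h => z hz.
  by apply: (@pd_supp _ _ (M + 1)) hz.
have [_ /(_ phi (test_fun_smooth sphi cphi))] := uV.
set f := fun y => _.
pose g y := - (ucut M y * lap r (x - y)) + (Vcut y * ucut M y) * r (x - y).
have b1 : bcs (fun y => ucut M y * lap r (x - y)).
  by apply: convol_bcs; [exact: bcs_ucut|exact/smooth_continuous/smooth_lap].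
have b2 : bcs (fun y => (Vcut y * ucut M y) * r (x - y)).
  by apply: (@convol_bcs _ _ (fun y => Vcut y * ucut M y)); [exact: bcs_Vu|exact: smooth_continuous].
have bg : bcs g by apply: bcs_add => //; exact: bcs_opp.
have mf : measurable_fun setT f.
  apply/measurable_EFinP; apply: measurable_funD.
    apply: measurable_funM; first exact: measurableT_comp.
    by apply: continuous_rV_measurable; apply: smooth_continuous; exact: smooth_lap.
  apply: measurable_funM; first exact: measurable_funM.
  by apply: continuous_rV_measurable; exact: smooth_continuous.
(* Off the null set where [|V| > 1] the integrand is a bounded function of compact support. Hence it
   is integrable, and the iterated integral in the definition of a solution is a genuine one. *)
have fg : ae_eq leb setT f (EFin \o g).
  exists Vbad; split => // y /= H; apply: contrapT => nb; apply: H => _; congr EFin.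
  have Vy : Vcut y = V y by rewrite /Vcut indicE mem_set// mul1r.
  rewrite /g Vy -lapphi; have [h|h] := leP `|y| (M + 1); first by rewrite ucutE// mulNr.
  by rewrite lphi0// phi0// -/(phi y) phi0// !mulr0 oppr0.
have mg : measurable_fun setT (EFin \o g) by apply/measurable_EFinP; case: bg.
have intf : leb.-integrable setT f.
  apply/integrableP; split => //.
  rewrite (@ge0_ae_eq_integral _ _ _ _ _ _ (fun y => `|(g y)%:E|%E))//.
  - by have /integrableP[] := bcs_integrable bg.
  - exact: measurableT_comp.
  - exact: measurableT_comp.
  - by apply: filterS fg => y H Dy; congr abse; exact: H.
rewrite intRnE// (@ae_eq_integral _ _ _ _ _ (EFin \o g) f)// -EFin_Int//.
rewrite /g IntD//; last exact: bcs_opp.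
rewrite (_ : (fun y => - (ucut M y * lap r (x - y))) = fun y => -1 * (ucut M y * lap r (x - y))); last first.
  by apply/funext => y; rewrite mulN1r.
rewrite IntZ// mulN1r => -[] /eqP; rewrite addrC subr_eq0 => /eqP h.
by rewrite /convol h.
Qed.

Section limit.
Variables (x0 : 'rV[R]_n) (tau b Rad : R) (chi eta : 'rV[R]_n -> R).
Hypotheses (R0 : 0 < Rad) (t0 : 0 < tau) (bE : b = (32 * Rad ^+ 2)^-1).
Hypotheses (h1 : 1024 * (n%:R - 4) ^+ 2 * Rad ^+ 2 <= tau ^+ 2)
  (h2 : 2048 * Rad ^+ 4 <= tau ^+ 3).
Let e x := expR (cphi x0 tau b x).
Hypotheses (schi : smooth chi) (seta : smooth eta) (cchi : csupp chi) (ceta : csupp eta).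
Hypotheses (chi_in : forall x, sqdist x0 x < 16^-1 -> chi x = 0)
  (chi_out : forall x, 16 * Rad ^+ 2 < sqdist x0 x -> chi x = 0).
Hypothesis eta_ge : forall x, e x ^+ 2 * gradsq chi x <= eta x.

(** This is [enP + enQ] without the part [2 (e chi)^2] of [enP], which moves to the left side once
    [lap u] is replaced by [V u]. *)
Definition enZ x := 4 * (e x * lap chi x) ^+ 2 + 8 * lap eta x + 16 * eta x.

(** In the limit [lap w] becomes [V u], bounded by [|u|]. Of the factor 4 on the left, 2 is spent on
    the term [2 (e chi)^2] of [enP] and 2 remains. *)
Lemma carleman_solution :
  2 * Int (fun x => (e x * chi x * u x) ^+ 2) <= Int (fun x => enZ x * u x ^+ 2).
Proof.
have [M [M0 chiM etaM]] : exists M, [/\ 0 <= M, forall x, M < `|x| -> chi x = 0 &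
    forall x, M < `|x| -> eta x = 0].
  have [M1 hM1] := cchi; have [M2 hM2] := ceta; exists (`|M1| + `|M2|).
  by split; [rewrite addr_ge0|move=> x h; apply: hM1|move=> x h; apply: hM2];
     have := ler_norm M1; have := ler_norm M2; have := normr_ge0 M1; have := normr_ge0 M2; lra.
pose P := enP x0 tau b chi eta; pose Q := enQ x0 tau b chi eta.
pose S x := (e x * chi x) ^+ 2.
pose U := ucut M; pose G x := Vcut x * ucut M x.
have se : smooth e by apply: smooth_exp; exact: smooth_cphi.
have bP : bcs P by apply: smooth_bcs; [exact: smooth_enP|exact: csupp_enP].
have bQ : bcs Q by apply: smooth_bcs; [exact: smooth_enQ|exact: csupp_enQ].
have bS : bcs S.
  apply: smooth_bcs; first by rewrite /S; smth.
  by apply: csupp_eq0 cchi _ => x; rewrite /S => ->; rewrite mulr0 expr0n.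
have bU : bcs U := bcs_ucut M.
have bG : bcs G := bcs_Vu M.
have [K UK] : exists K, forall x, `|U x| <= K by case: bU.
have K0 : 0 <= K by apply: le_trans (UK 0).
have GU x : `|G x| <= `|U x|.
  by rewrite /G normrM -[leRHS]mul1r ler_wpM2r// Vcut_le1.
have GK x : `|G x| <= K by apply: le_trans (GU x) (UK x).
have [B [B0 PB QB SB]] : exists B, [/\ 0 <= B, forall x, `|P x| <= B,
    forall x, `|Q x| <= B & forall x, `|S x| <= B].
  have [_ [B1 hB1] _] := bP; have [_ [B2 hB2] _] := bQ; have [_ [B3 hB3] _] := bS.
  have := le_trans (normr_ge0 _) (hB1 0); have := le_trans (normr_ge0 _) (hB2 0).
  have := le_trans (normr_ge0 _) (hB3 0) => p3 p2 p1.
  exists (B1 + B2 + B3); split; first by rewrite !addr_ge0.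
  - by move=> x; apply: le_trans (hB1 x) _; lra.
  - by move=> x; apply: le_trans (hB2 x) _; lra.
  - by move=> x; apply: le_trans (hB3 x) _; lra.
have main : 4 * Int (fun x => S x * U x ^+ 2) <=
    Int (fun x => P x * G x ^+ 2) + Int (fun x => Q x * U x ^+ 2).
  apply/ler_addgt0Pr => ep ep0.
  (* Each of the three integrals moves by at most [ep / 6]; the one on the left counts four times,
     so the total error is [ep]. *)
  pose T := B * (2 * K) + 1; have T0 : 0 < T by rewrite ltr_wpDl// !mulr_ge0.
  have ep6 : 0 < ep / (6 * T) by rewrite divr_gt0// mulr_gt0.
  have [d1 d10 hd1] := convol_L1 bU ep6; have [d2 d20 hd2] := convol_L1 bG ep6.
  pose d := Num.min 1 (Num.min d1 d2).
  have d0 : 0 < d by rewrite !lt_min ltr01 d10.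
  have [r mr] := mollifier_exists n d0.
  have /hd1 L1 : mollifier d1 r by apply: mollifier_le mr; rewrite !ge_min lexx !orbT.
  have /hd2 L2 : mollifier d2 r by apply: mollifier_le mr; rewrite !ge_min lexx !orbT.
  have le6 L : L <= ep / (6 * T) -> B * (2 * K) * L <= ep / 6.
    move=> h; apply: (@le_trans _ _ (T * (ep / (6 * T)))).
      apply: (@le_trans _ _ (B * (2 * K) * (ep / (6 * T)))).
        by rewrite ler_wpM2l// !mulr_ge0.
      by rewrite ler_pM2r// /T lerDl.
    rewrite le_eqVlt; apply/orP; left; apply/eqP; field; exact: lt0r_neq0.
  have H1 := le_trans (convol_sqr_close bS bU mr UK SB) (le6 _ L1).
  have H2 := le_trans (convol_sqr_close bQ bU mr UK QB) (le6 _ L1).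
  have H3 := le_trans (convol_sqr_close bP bG mr GK PB) (le6 _ L2).
  have [sr _ _ _ _] := mr; have cr := mollifier_csupp mr.
  have scv f : bcs f -> smooth (convol f r) by move=> bf; exact: convol_smooth.
  have bcv f : bcs f -> bcs (convol f r).
    by move=> bf; apply: smooth_bcs (scv _ bf) _; apply: convol_csupp => //; have [] := bf.
  have := energy R0 t0 bE h1 h2 schi seta cchi ceta chi_in chi_out eta_ge (scv _ bU).
  rewrite (_ : (fun x => (_ * chi x * convol U r x) ^+ 2) = fun x => S x * convol U r x ^+ 2); last first.
    by apply/funext => x; rewrite exprMn.
  rewrite (_ : (fun x => enP _ _ _ _ _ x * _ + _) =
    fun x => P x * convol G r x ^+ 2 + Q x * convol U r x ^+ 2); last first.
    (* The mollified equation holds for [|x| <= M]; beyond that radius [P] vanishes. *)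
    apply/funext => x; congr (_ + _); rewrite -/(P x).
    have [h|h] := leP `|x| M; first by rewrite (convol_pde mr)// /d ge_min lexx.
    by rewrite /P /enP chiM// etaM// !mulr0 expr0n /= mulr0 addr0 !mul0r.
  rewrite IntD; last 2 first.
  - by apply: bcs_mul => //; apply: bcs_mul; exact: bcv.
  - by apply: bcs_mul => //; apply: bcs_mul; exact: bcv.
  move: H1 H2 H3; rewrite !ler_norml => /andP[H1 _] /andP[_ H2] /andP[_ H3] H4.
  by move: (Int _) (Int _) (Int _) (Int _) (Int _) (Int _) H1 H2 H3 H4 => *; lra.
have eta0 x : 0 <= eta x.
  by apply: le_trans (eta_ge x); rewrite mulr_ge0 ?sqr_ge0// gradsq_ge0.
have P0 x : 0 <= P x.
  by rewrite /P /enP addr_ge0// mulr_ge0// sqr_ge0.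
have bSU : bcs (fun x => S x * U x ^+ 2) by apply: bcs_mul => //; exact: bcs_mul.
have bPG : bcs (fun x => P x * G x ^+ 2) by apply: bcs_mul => //; exact: bcs_mul.
have bPU : bcs (fun x => P x * U x ^+ 2) by apply: bcs_mul => //; exact: bcs_mul.
have bQU : bcs (fun x => Q x * U x ^+ 2) by apply: bcs_mul => //; exact: bcs_mul.
have PGU : Int (fun x => P x * G x ^+ 2) <= Int (fun x => P x * U x ^+ 2).
  apply: Int_le => // x; rewrite ler_wpM2l//.
  by rewrite -(real_normK (num_real (G x))) -(real_normK (num_real (U x))) ler_sqr ?nnegrE.
have -> : (fun x => (e x * chi x * u x) ^+ 2) = fun x => S x * U x ^+ 2.
  apply/funext => x; rewrite exprMn -/(S x); have [h|h] := leP `|x| (M + 1).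
    by rewrite /U ucutE.
  by rewrite /S chiM ?mulr0 ?expr0n ?mul0r//; lra.
have -> : (fun x => enZ x * u x ^+ 2) =
    fun x => (P x * U x ^+ 2 + Q x * U x ^+ 2) - 2 * (S x * U x ^+ 2).
  apply/funext => x; have [h|h] := leP `|x| (M + 1).
    by rewrite /U ucutE// /enZ /P /Q /S /enP /enQ -/(e x);
       move: (lap chi x) (lap eta x) => *; ring.
  have hM : M < `|x| by lra.
  have lx f : (forall y, M < `|y| -> f y = 0) -> lap f x = 0.
    move=> fM; rewrite lapE big1// => i _; apply: (@pd_supp _ _ M) hM => y hy.
    exact: (@pd_supp _ _ M) hy.
  by rewrite /enZ /P /Q /S /enP /enQ !lx// chiM// etaM//; ring.
rewrite IntB//; [|by apply: bcs_add|by apply: bcs_scale].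
rewrite IntD// IntZ//.
by move: (Int _) (Int _) (Int _) (Int _) main PGU => *; lra.
Qed.

End limit.

End regularization.

(** * Euclidean balls and the mass of [u] on them *)

Section locally_bounded.
Variables (R : realType) (n : nat).
Implicit Types (x y : 'rV[R]_n).

Lemma enorm_ge0 x : 0 <= enorm x.
Proof. exact: sqrtr_ge0. Qed.

Lemma enorm_sqr x x0 : enorm (x - x0) ^+ 2 = sqdist x0 x.
Proof.
rewrite /enorm sqr_sqrtr; last by apply: sumr_ge0 => i _; exact: sqr_ge0.
by apply: eq_bigr => i _; rewrite !mxE expr2.
Qed.

Lemma enormD x y : enorm (x + y) <= enorm x + enorm y.
Proof.
rewrite -ler_sqr ?nnegrE ?addr_ge0 ?enorm_ge0// sqrrD.
pose G := \sum_(i < n) x ord0 i * y ord0 i.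
have N (z : 'rV[R]_n) : enorm z ^+ 2 = \sum_(i < n) z ord0 i * z ord0 i.
  by rewrite /enorm sqr_sqrtr//; apply: sumr_ge0 => i _; exact: sqr_ge0.
have GN : G <= enorm x * enorm y.
  apply: le_trans (ler_norm _) _.
  rewrite -ler_sqr ?nnegrE ?mulr_ge0 ?enorm_ge0// real_normK ?num_real// exprMn !N.
  exact: sum_sqr_le.
have -> : enorm (x + y) ^+ 2 = enorm x ^+ 2 + G *+ 2 + enorm y ^+ 2.
  by rewrite !N /G -sumrMnl -!big_split; apply: eq_bigr => i _ /=; rewrite !mxE; ring.
by rewrite lerD2r lerD2l lerMn2r GN orbT.
Qed.

Lemma enormN x : enorm (- x) = enorm x.
Proof. by rewrite /enorm; congr Num.sqrt; apply: eq_bigr => i _; rewrite !mxE sqrrN. Qed.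

Lemma norm_le_enorm x : `|x| <= enorm x.
Proof.
rewrite -ler_sqr ?nnegrE ?enorm_ge0// -[x]subr0 enorm_sqr.
exact: norm_sqdist.
Qed.

Lemma sqdist_lt x0 x (r : R) : 0 < r -> (sqdist x0 x < r ^+ 2) = (enorm (x - x0) < r).
Proof.
by move=> r0; rewrite -enorm_sqr ltr_pXn2r ?nnegrE ?enorm_ge0// ltW.
Qed.

Variable u : 'rV[R]_n -> R.
Hypothesis mu : measurable_fun setT u.
Hypothesis u_loc : forall M : R, exists C : R, forall x, `|x| <= M -> `|u x| <= C.

Definition ballsq (x0 : 'rV[R]_n) (K : R) x : R := (sqdist x0 x < K)%R%:R * u x ^+ 2.

Lemma bcs_ball_indic x0 K : bcs (fun x => (sqdist x0 x < K)%R%:R : R).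
Proof.
split.
- rewrite (_ : (fun x => _) = \1_[set x | sqdist x0 x < K]).
    apply: measurable_indic; apply: rV_open_measurable.
    rewrite openE => x /= h; apply: near_sqdist_lt h.
  apply/funext => x; rewrite indicE.
  by have -> : (x \in [set y | sqdist x0 y < K]) = (sqdist x0 x < K) by apply/idP/idP; rewrite inE.
- by exists 1 => x; case: (_ < _); rewrite ?normr1 ?normr0.
- by apply: (@csupp_sqdist _ _ x0 K) => x h; rewrite ltNge (ltW h).
Qed.

Lemma bcs_mul_sqr g : bcs g -> bcs (fun x => g x * u x ^+ 2).
Proof.
move=> [mg [B gB] [M gM]]; split.
- by apply: measurable_funM => //; exact: measurable_funX.
- have [C uC] := u_loc M; exists (B * C ^+ 2) => x.
  have B0 : 0 <= B by apply: le_trans (gB x).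
  have [h|h] := leP `|x| M; last by rewrite gM// mul0r normr0 mulr_ge0 ?sqr_ge0.
  by rewrite normrM ler_pM// normrX lerXn2r ?nnegrE ?uC// (le_trans _ (uC x h)).
- by exists M => x /gM ->; rewrite mul0r.
Qed.

Lemma bcs_ballsq x0 K : bcs (ballsq x0 K).
Proof. exact: bcs_mul_sqr (bcs_ball_indic x0 K). Qed.

Lemma L2sq_ballE x0 (r : R) : 0 < r -> L2sq_ball u x0 r = (Int (ballsq x0 (r ^+ 2)))%:E.
Proof.
move=> r0; rewrite EFin_Int; last exact: bcs_ballsq.
rewrite /L2sq_ball (_ : (fun x => _) = fun x => (ballsq x0 (r ^+ 2) x)%:E).
  rewrite ge0_intRnE//; first by apply/measurable_EFinP; have [] := bcs_ballsq x0 (r ^+ 2).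
  by move=> x; rewrite lee_fin mulr_ge0 ?ler0n ?sqr_ge0.
apply/funext => x; rewrite /ballsq sqdist_lt// indicE.
by have -> : (x \in eball x0 r) = (enorm (x - x0) < r) by apply/idP/idP; rewrite inE.
Qed.

End locally_bounded.

(** * Choice of the parameters *)

Section psi.
Variable R : realType.
Implicit Types (tau b s t Rad : R).

(** Twice the weight [cphi], as a function of the squared distance: only squares of the weight are
    compared from here on. *)
Definition psi tau b s : R := tau * (b * s - ln s).

Lemma expR_cphi n (x0 x : 'rV[R]_n) tau b : 32^-1 <= sqdist x0 x ->
  expR (cphi x0 tau b x) ^+ 2 = expR (psi tau b (sqdist x0 x)).
Proof.
move=> h; rewrite -expRM_natr; congr expR.
by rewrite /cphi /psi sregE//; field.
Qed.

Lemma ln_le_sub1 t : 0 < t -> ln t <= t - 1.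
Proof. by move=> t0; rewrite lerBrDl; have := expR_ge1Dx (ln t); rewrite lnK. Qed.

(** [b s - ln s] decreases up to [s = 1 / b], which is [32 Rad^2], well beyond the support of
    [chi]. *)
Lemma psi_decr tau b s t : 0 < tau -> 0 < s -> s <= t -> b * t <= 1 ->
  psi tau b t <= psi tau b s.
Proof.
move=> tau0 s0 st bt; rewrite ler_pM2l//.
have t0 : 0 < t by apply: lt_le_trans st.
have := ln_le_sub1 (divr_gt0 s0 t0); rewrite ln_div ?posrE// => h.
suff : b * (t - s) <= 1 - s / t by lra.
rewrite (_ : 1 - s / t = (t - s) / t); last by field; exact: lt0r_neq0.
by rewrite ler_pdivlMr// mulrAC ler_piMl// subr_ge0.
Qed.

(** For [Rad >= 3] the ratio of the two squared radii is at most 4/9, so the logarithm gains at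
    least 5/9, while the quadratic part costs at most 1/8. *)
Lemma psi_gap tau Rad : 0 < tau -> 3 <= Rad ->
  tau / 4 + psi tau (32 * Rad ^+ 2)^-1 (4 * Rad ^+ 2) <=
  psi tau (32 * Rad ^+ 2)^-1 ((Rad + 1) ^+ 2).
Proof.
move=> tau0 R3; rewrite /psi -mulrDr ler_pM2l//.
have R0 : 0 < Rad by lra.
have a0 : 0 < 4 * Rad ^+ 2 by rewrite mulr_gt0// exprn_gt0.
have c0 : 0 < (Rad + 1) ^+ 2 by rewrite exprn_gt0//; lra.
have := ln_le_sub1 (divr_gt0 c0 a0); rewrite ln_div ?posrE//.
have : (Rad + 1) ^+ 2 / (4 * Rad ^+ 2) <= 4 / 9 by rewrite ler_pdivrMr//; nra.
have -> : (32 * Rad ^+ 2)^-1 * (4 * Rad ^+ 2) = 8^-1 by field; exact: lt0r_neq0.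
have : 0 <= (32 * Rad ^+ 2)^-1 * (Rad + 1) ^+ 2.
  by rewrite mulr_ge0 ?sqr_ge0// invr_ge0 mulr_ge0 ?sqr_ge0.
lra.
Qed.

Lemma ln_ge1 Rad : 16 <= Rad -> 1 <= ln Rad.
Proof.
move=> R16; have l16 : ln 16 <= ln Rad by rewrite ler_ln ?posrE//; lra.
have h : 0 < (2^-1 : R) by [].
have l2 : 2^-1 <= ln (2 : R) by have := ln_le_sub1 h; rewrite lnV ?posrE//; lra.
have e : 16 = 2 ^+ 4 :> R by ring.
by apply: le_trans l16; rewrite e lnXn// -[ln 2 *+ 4]mulr_natl; lra.
Qed.

(** The logarithmic loss of the theorem. Of the six multiples of [tau ln Rad], four bound
    [ln ((Rad + 1)^2)] through [(Rad + 1)^2 <= Rad^4], one bounds [ln 16], and one covers the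
    quadratic part. *)
Lemma psi_lower tau Rad : 0 < tau -> 16 <= Rad ->
  psi tau (32 * Rad ^+ 2)^-1 16^-1 - 6 * tau * ln Rad <=
  psi tau (32 * Rad ^+ 2)^-1 ((Rad + 1) ^+ 2).
Proof.
move=> tau0 R16.
have R0 : 0 < Rad by lra.
have l16 : ln 16 <= ln Rad by rewrite ler_ln ?posrE.
have l1 := ln_ge1 R16.
have lR : ln ((Rad + 1) ^+ 2) <= 4 * ln Rad.
  apply: (@le_trans _ _ (ln (Rad ^+ 4))); last by rewrite lnXn// -[ln Rad *+ 4]mulr_natl.
  rewrite ler_ln ?posrE ?exprn_gt0//; last by lra.
  rewrite (_ : Rad ^+ 4 = (Rad ^+ 2) ^+ 2); last by ring.
  by rewrite ler_sqr ?nnegrE; nra.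
have b0 : 0 < (32 * Rad ^+ 2)^-1 by rewrite invr_gt0 mulr_gt0// exprn_gt0.
have b1 : (32 * Rad ^+ 2)^-1 <= 1 by rewrite invf_le1 ?mulr_gt0 ?exprn_gt0//; nra.
have b2 : 0 <= (32 * Rad ^+ 2)^-1 * (Rad + 1) ^+ 2 by rewrite mulr_ge0 ?sqr_ge0// ltW.
rewrite /psi lnV ?posrE//.
rewrite (_ : _ - 6 * tau * ln Rad = tau * ((32 * Rad ^+ 2)^-1 / 16 - - ln 16 - 6 * ln Rad)); last by ring.
by rewrite ler_pM2l//; lra.
Qed.

End psi.

Lemma locally_bounded (R : realType) (n : nat) (C0 : R) (u : 'rV[R]_n -> R) : 0 < C0 ->
  (forall x, `|u x| <= expR (C0 * enorm x `^ (4 / 3))) ->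
  forall N : R, (forall x : 'rV[R]_n, enorm x <= N -> `|u x| <= expR (C0 * N `^ (4 / 3))).
Proof.
move=> C00 ub N x xN; apply: le_trans (ub x) _.
rewrite ler_expR ler_pM2l// ge0_ler_powR ?nnegrE//; first exact: enorm_ge0.
by apply: le_trans xN; exact: enorm_ge0.
Qed.

Lemma powR43 (R : realType) (a : R) : 1 <= a ->
  [/\ a <= a `^ (4 / 3), (a `^ (4 / 3)) ^+ 3 = a ^+ 4 & a `^ (4 / 3) <= a ^+ 2].
Proof.
move=> a1; have a0 : 0 <= a by lra.
split.
- by rewrite -[leLHS]powRr1// ler_powR//; lra.
- rewrite -powR_mulrn ?powR_ge0// -powRrM (_ : 4 / 3 * 3%:R = 4%:R); last by field.
  by rewrite powR_mulrn.
- by rewrite -powR_mulrn// ler_powR//; lra.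
Qed.

Lemma bcs_enZ (R : realType) (n : nat) (x0 : 'rV[R]_n) tau b chi eta :
  smooth chi -> smooth eta -> csupp chi -> csupp eta -> bcs (enZ x0 tau b chi eta).
Proof.
move=> schi seta cchi ceta.
have se : smooth (fun x => expR (cphi x0 tau b x)) by apply: smooth_exp; exact: smooth_cphi.
apply: smooth_bcs; first by rewrite /enZ; smth.
apply: csupp_add; last by apply: csupp_eq0 ceta _ => x ->; rewrite mulr0.
apply: csupp_add; last by apply: csupp_eq0 (csupp_lap ceta) _ => x ->; rewrite mulr0.
by apply: csupp_eq0 (csupp_lap cchi) _ => x ->; rewrite mulr0 expr0n mulr0.
Qed.

Lemma enorm_far (R : realType) (n : nat) (x0 x : 'rV[R]_n) (Rad : R) : 0 < Rad ->
  enorm x0 = Rad -> sqdist x0 x < 64 * Rad ^+ 2 -> enorm x <= 9 * Rad.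
Proof.
move=> R0 x0R; rewrite (_ : 64 * Rad ^+ 2 = (8 * Rad) ^+ 2); last by ring.
rewrite sqdist_lt; last by lra.
by move=> h; have := enormD (x - x0) x0; rewrite subrK x0R; lra.
Qed.

Lemma sqdist_near (R : realType) (n : nat) (x0 x : 'rV[R]_n) (Rad : R) : 2 <= Rad ->
  enorm x0 = Rad -> sqdist 0 x < 1 -> 4^-1 <= sqdist x0 x <= (Rad + 1) ^+ 2.
Proof.
move=> R2 x0R hx.
have nx : enorm x < 1 by rewrite -[x]subr0 -sqdist_lt// expr1n.
have d1 : enorm (x - x0) <= Rad + 1.
  by apply: le_trans (enormD _ _) _; rewrite enormN x0R; lra.
have d2 : Rad - 1 <= enorm (x - x0).
  have := enormD (x0 - x) x; rewrite subrK x0R -opprB enormN; lra.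
rewrite -enorm_sqr; apply/andP; split; first by nra.
by rewrite lerXn2r ?nnegrE ?enorm_ge0//; lra.
Qed.

Lemma Int_ballsq_far (R : realType) (n : nat) (u : 'rV[R]_n -> R) (x0 : 'rV[R]_n) (Rad B : R) :
  0 < Rad -> enorm x0 = Rad -> 0 <= B -> (forall x, enorm x <= 9 * Rad -> `|u x| <= B) ->
  bcs (ballsq u x0 (64 * Rad ^+ 2)) ->
  Int (ballsq u x0 (64 * Rad ^+ 2)) <= B ^+ 2 * (2 * (9 * Rad)) ^+ n.
Proof.
move=> R0 x0R B0 uB bb; have far x := @enorm_far R n x0 x Rad R0 x0R.
have R9 : 0 <= 9 * Rad by rewrite mulr_ge0// ltW.
have B2 : 0 <= B ^+ 2 by exact: sqr_ge0.
apply: Int_ballN_le => // [x|x hx]; rewrite /ballsq.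
  have [h|h] := ltP (sqdist x0 x) _; last by rewrite mul0r.
  by rewrite mul1r -(real_normK (num_real (u x))) ler_sqr ?nnegrE//; exact/uB/far.
have [h|h] := ltP (sqdist x0 x) _; last by rewrite mul0r.
by have := lt_le_trans hx (le_trans (norm_le_enorm x) (far x h)); rewrite ltxx.
Qed.

(** * The size of [tau] and the conclusion *)

Section constants.
Variables (R : realType) (n : nat) (C0 C1 : R).
Hypotheses (C00 : 0 < C0) (C10 : 0 < C1).

(** The first summand makes [tau / 4], the gap of [psi], exceed the logarithm of the far error: [C1]
    for the cutoff constant, [18 n] for the volume of a cube of side [18 Rad], and [162 = 2 * 81]
    for the squared growth bound at radius [9 Rad], since [9^(4/3) <= 81]. The second summand serves
    the two conditions of the Carleman estimate. *)
Definition tau_coef := 4 * (C1 + 18 * n%:R + 162 * C0) + 32 * (n%:R + 4).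

Lemma tau_cond (Rad : R) (tau := tau_coef * Rad `^ (4 / 3)) : 1 <= Rad ->
  [/\ 0 < tau, 1024 * (n%:R - 4) ^+ 2 * Rad ^+ 2 <= tau ^+ 2 & 2048 * Rad ^+ 4 <= tau ^+ 3].
Proof.
move=> R1; have [RP P3 _] := powR43 R1; rewrite /tau /tau_coef.
move: (Rad `^ _) RP P3 => P RP P3.
have : 0 <= n%:R :> R by [].
move: (n%:R : R) => m n0.
have : 32 * (m + 4) <= 4 * (C1 + 18 * m + 162 * C0) + 32 * (m + 4).
  by have := C00; have := C10; lra.
move: (4 * _ + _) => K K1.
have P0 : 0 < P by lra.
have K0 : 0 < K by lra.
split; first exact: mulr_gt0.
- rewrite -subr_ge0.
  have -> : (K * P) ^+ 2 - 1024 * (m - 4) ^+ 2 * Rad ^+ 2 =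
    (K * P - 32 * (m - 4) * Rad) * (K * P + 32 * (m - 4) * Rad) by ring.
  have a1 : 0 <= (K - 32 * (m + 4)) * P by apply: mulr_ge0; lra.
  have a2 : 0 <= (m + 4) * (P - Rad) by apply: mulr_ge0; lra.
  have a3 : 0 <= m * Rad by apply: mulr_ge0; lra.
  by apply: mulr_ge0; lra.
- rewrite [leRHS]exprMn P3 ler_pM2r ?exprn_gt0//; last by lra.
  apply: (@le_trans _ _ (16 ^+ 3)); first by lra.
  by rewrite lerXn2r ?nnegrE; lra.
Qed.

(** The far error is at most the contribution of the unit ball at the origin. The constants enter
    the exponent through [x <= expR x]; as [1 <= Rad <= Rad^(4/3)], the sum there is linear in
    [Rad^(4/3)] and stays below [tau / 4]. *)
Lemma outer_small (Rad : R) (tau := tau_coef * Rad `^ (4 / 3)) (b := (32 * Rad ^+ 2)^-1) : 16 <= Rad ->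
  C1 * expR (psi tau b (4 * Rad ^+ 2)) * (expR (C0 * (9 * Rad) `^ (4 / 3)) ^+ 2 * (2 * (9 * Rad)) ^+ n)
  <= expR (psi tau b ((Rad + 1) ^+ 2)).
Proof.
move=> R16; have R1 : 1 <= Rad by lra.
have [RP _ _] := powR43 R1; have [t0 _ _] := tau_cond R1.
apply: (@le_trans _ _ (expR (C1 + psi tau b (4 * Rad ^+ 2) + (C0 * (9 * Rad) `^ (4 / 3) * 2%:R + (18 * Rad) * n%:R)))).
  rewrite !expRD !expRM_natr (_ : 2 * (9 * Rad) = 18 * Rad); last by ring.
  have e1 x : x <= expR x :> R by have := expR_ge1Dx x; lra.
  rewrite ler_pM ?mulr_ge0 ?expR_ge0 ?exprn_ge0 ?sqr_ge0//; first exact: ltW; first by lra.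
    by rewrite ler_pM2r ?expR_gt0.
  by rewrite ler_pM2l ?exprn_gt0 ?expR_gt0// lerXn2r ?nnegrE ?expR_ge0//; lra.
rewrite ler_expR; apply: le_trans (psi_gap t0 _); last by lra.
rewrite -/tau -/b -addrA addrCA [leRHS]addrC lerD2l.
have -> : (9 * Rad) `^ (4 / 3) = 9 `^ (4 / 3) * Rad `^ (4 / 3) by rewrite powRM//; lra.
have [_ _ P9] : [/\ (9 : R) <= 9 `^ (4 / 3), (9 `^ (4 / 3)) ^+ 3 = (9 : R) ^+ 4 & 9 `^ (4 / 3) <= (9 : R) ^+ 2].
  by apply: powR43; lra.
rewrite /tau /tau_coef; move: (Rad `^ (4 / 3)) RP (9 `^ (4 / 3)) P9 => P RP N N9.
have : 0 <= n%:R :> R by [].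
move: (n%:R : R) => m m0.
have : C0 * P * N <= C0 * P * 81.
  by rewrite ler_wpM2l ?mulr_ge0 ?(ltW C00)//; [lra|move: N9; rewrite (_ : 9 ^+ 2 = 81)//; ring].
have : C1 <= C1 * P by rewrite ler_peMr ?(ltW C10)//; lra.
have : Rad * m <= P * m by rewrite ler_wpM2r.
have : 0 <= m * P by rewrite mulr_ge0//; lra.
by lra.
Qed.
End constants.

Theorem theorem2p1 (R : realType) (n : nat) (C0 : R) :
  (2 <= n)%N -> 0 < C0 ->
  exists C : R, 0 < C /\
  exists R0 : R, 1 <= R0 /\
  forall V u : 'rV[R]_n -> R,
    Rn_measurable_fun V -> ess_bounded_by_1 V ->
    dist_solution V u ->
    (forall x, `|u x| <= expR (C0 * enorm x `^ (4 / 3))) ->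
    (1%:E <= L2sq_ball u 0 1)%E ->
    forall (Rad : R) (x0 : 'rV[R]_n), R0 <= Rad -> enorm x0 = Rad ->
      (((expR (- C * Rad `^ (4 / 3) * ln Rad)) ^+ 2)%:E <= L2sq_ball u x0 1)%E.
Proof.
move=> _ C00; have [C1 C10 cut] := @cutoffs R n.
pose K := @tau_coef R n C0 C1.
have [t1 _ _] := @tau_cond R n C0 C1 C00 C10 1 (lexx _).
have K0 : 0 < K by move: t1; rewrite powR1 mulr1.
(* The conclusion is squared, which doubles the exponent: [6 K] comes from [psi_lower], and [C1]
   covers the factor [C1 <= expR C1] because [Rad^(4/3) ln Rad >= 1]. *)
exists (3 * K + C1); split; first by lra.
(* From 16 on, [ln Rad] is at least 1 and dominates [ln 16]. *)
exists 16; split; first by lra.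
move=> V u mV V1 uV ub u1 Rad x0 R16 x0R.
have R1 : 1 <= Rad by lra.
have mu : measurable_fun setT u by apply: Rn_measurable_fun_rV; case: uV.
have ubN := locally_bounded C00 ub.
have u_loc M : exists C, forall x, `|x| <= M -> `|u x| <= C.
  by eexists => x /enorm_le_norm; exact: ubN.
rewrite !(L2sq_ballE mu u_loc)// !lee_fin expr1n in u1 *.
have [t0 h1 h2] := tau_cond n C00 C10 R1.
set tau := _ * _ in t0 h1 h2.
set b := (32 * Rad ^+ 2)^-1.
have R21 : 1 <= Rad ^+ 2 by rewrite exprn_ege1.
have R20 : 0 < Rad ^+ 2 by rewrite exprn_gt0//; clear - R1; lra.
have b0 : 0 < b by rewrite invr_gt0 mulr_gt0.
have bR : b * Rad ^+ 2 = 32^-1 by rewrite /b invfM mulfVK// gt_eqF.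
pose e (x : 'rV[R]_n) := expR (cphi x0 tau b x).
have eE x s : 0 < s -> 32^-1 <= sqdist x0 x -> s <= sqdist x0 x -> sqdist x0 x <= 16 * Rad ^+ 2 ->
    e x ^+ 2 <= expR (psi tau b s).
  move=> s0 sx sle sge; rewrite expR_cphi// ler_expR psi_decr//.
  by apply: (@le_trans _ _ (b * (16 * Rad ^+ 2))); [rewrite ler_pM2l|rewrite mulrCA bR; clear; lra].
have [||||chi [eta [[schi seta cchi ceta] chi_in chi_out chi1 enb]]] :=
    cut x0 Rad (expR (psi tau b 16^-1)) (expR (psi tau b (4 * Rad ^+ 2))) e R1.
- exact: expR_ge0.
- exact: expR_ge0.
- by move=> x /andP[s1 s2]; apply: eE => //; clear - s1 s2 R21; lra.
- by move=> x /andP[s1 s2]; apply: eE => //; clear - s1 s2 R21; lra.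
have Rp : 0 < Rad by clear - R1; lra.
have := carleman_solution mV V1 uV u_loc Rp t0 (erefl _) h1 h2 schi seta cchi ceta chi_in chi_out
  (fun x => (enb x).1).
rewrite -/b.
pose I1 := Int (ballsq u x0 1); pose I2 := Int (ballsq u x0 (64 * Rad ^+ 2)).
have bb y k : bcs (ballsq u y k) by exact: bcs_ballsq.
have upper : Int (fun x => enZ x0 tau b chi eta x * u x ^+ 2) <=
    C1 * (expR (psi tau b 16^-1) * I1 + expR (psi tau b (4 * Rad ^+ 2)) * I2).
  rewrite -!IntZ// -IntD; [|exact: bcs_scale..].
  rewrite -IntZ; last by apply: bcs_add; exact: bcs_scale.
  apply: Int_le.
  - by apply: bcs_mul_sqr => //; apply: bcs_enZ.
  - by apply: bcs_scale; apply: bcs_add; exact: bcs_scale.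
  move=> x; have [_ h] := enb x; rewrite /ballsq.
  apply: (@le_trans _ _ (C1 * (expR (psi tau b 16^-1) * (sqdist x0 x < 1)%R%:R +
    expR (psi tau b (4 * Rad ^+ 2)) * (sqdist x0 x < 64 * Rad ^+ 2)%R%:R) * u x ^+ 2)).
    by rewrite ler_wpM2r// sqr_ge0.
  by rewrite le_eqVlt; apply/orP; left; apply/eqP; ring.
have near x : sqdist 0 x < 1 -> 4^-1 <= sqdist x0 x <= (Rad + 1) ^+ 2.
  by apply: sqdist_near x0R; lra.
have s3 : (Rad + 1) ^+ 2 <= 4 * Rad ^+ 2 by clear - R1; nra.
(* The unit ball at the origin lies at squared distance between [1/4] and [(Rad + 1)^2 <= 4 Rad^2]
   from [x0]. There [chi] is 1 and the weight is smallest at the outer end. *)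
have lower : expR (psi tau b ((Rad + 1) ^+ 2)) <=
    Int (fun x => (e x * chi x * u x) ^+ 2).
  apply: (@le_trans _ _ (expR (psi tau b ((Rad + 1) ^+ 2)) * Int (ballsq u 0 1))).
    by rewrite ler_peMr ?expR_ge0.
  rewrite -IntZ//; apply: Int_le; first exact: bcs_scale.
    rewrite (_ : (fun x => _) = fun x => (e x * chi x) ^+ 2 * u x ^+ 2).
      apply: bcs_mul_sqr => //; apply: smooth_bcs.
        have se : smooth e by apply: smooth_exp; exact: smooth_cphi.
        by smth.
      by apply: csupp_eq0 cchi _ => x ->; rewrite mulr0 expr0n.
    by apply/funext => x; rewrite exprMn.
  move=> x; rewrite /ballsq.
  have [/near/andP[s1 s2]|_] := ltP (sqdist 0 x) 1; last by rewrite mul0r mulr0 sqr_ge0.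
  have s4 := le_trans s2 s3.
  rewrite chi1 ?s1// mul1r mulr1 exprMn ler_wpM2r ?sqr_ge0// /e expR_cphi; last first.
    by clear - s1; lra.
  rewrite ler_expR psi_decr//; first by clear - s1; lra.
  apply: (@le_trans _ _ (b * (4 * Rad ^+ 2))); first by rewrite ler_pM2l.
  by rewrite mulrCA bR; clear; lra.
have I2le : I2 <= expR (C0 * (9 * Rad) `^ (4 / 3)) ^+ 2 * (2 * (9 * Rad)) ^+ n.
  by apply: Int_ballsq_far => //; exact: ubN.
move=> CS.
have out := outer_small n C00 C10 R16.
rewrite -/tau -/b in out.
have low := psi_lower t0 R16; rewrite -/b in low.
(* The far error uses up one of the two copies of the left side in [carleman_solution]; the other is
   left for the ball around [x0]. *)
have key : expR (psi tau b ((Rad + 1) ^+ 2)) <= C1 * expR (psi tau b 16^-1) * I1.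
  have h : C1 * expR (psi tau b (4 * Rad ^+ 2)) * I2 <= expR (psi tau b ((Rad + 1) ^+ 2)).
    by apply: le_trans out; rewrite ler_pM2l// mulr_gt0// expR_gt0.
  move: (Int (fun x => (e x * chi x * u x) ^+ 2)) (Int (fun x => enZ _ _ _ _ _ x * _)) lower CS upper h.
  clear I2le out low bb u1.
  move: (expR _) (expR _) (expR _) I1 I2; clear => *; lra.
rewrite -/I1 -expRM_natr.
have I1_ge : expR (psi tau b ((Rad + 1) ^+ 2) - psi tau b 16^-1 - C1) <= I1.
  rewrite -(@ler_pM2l _ (expR C1 * expR (psi tau b 16^-1))) ?mulr_gt0 ?expR_gt0//.
  apply: (@le_trans _ _ (C1 * expR (psi tau b 16^-1) * I1)).
    apply: le_trans key; rewrite -!expRD; rewrite le_eqVlt; apply/orP; left; apply/eqP.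
    by congr expR; ring.
  have I10 : 0 <= I1 by apply: Int_ge0 => x; rewrite /ballsq mulr_ge0 ?ler0n ?sqr_ge0.
  rewrite ler_wpM2r// ler_pM2r ?expR_gt0//.
  by have := expR_ge1Dx C1; clear; lra.
apply: le_trans I1_ge; rewrite ler_expR.
have [RP _ _] := powR43 R1.
have l1 : 1 <= ln Rad by exact: ln_ge1.
have tE : tau = K * Rad `^ (4 / 3) by [].
have RL : C1 <= C1 * (Rad `^ (4 / 3) * ln Rad).
  rewrite ler_peMr ?(ltW C10)//; clear - l1 RP R1; nra.
move: low; rewrite tE; move: (psi _ _ _) (psi _ _ _) C10 RL; clear => *; lra.
Qed.
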